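(* Let $0<\delta<1$ and $1/2\le\sigma<1$ be fixed, let $t>1$, let $\lambda_c:=\frac{t^{\delta-1}}{1-t^{\delta-1}}=\frac{1}{t^{1-\delta}-1}$, and let $\lambda$ satisfy $\lambda_c\le\lambda\le t^{1-\delta}-1$. Write $\lambda=\lambda_c(1+\Lambda)$ (so $0\le\Lambda<\frac{t^{1-\delta}-1}{\lambda_c}-1$) and set $$\omega(t,\Lambda):=\sqrt{\frac{\lambda_c t}{2}}\,\frac{\ln(1+\Lambda)}{1+\lambda_c}\ \ (\ge 0).$$ Let $J_B$ and $\widetilde J_B$ be as in the context. Then $$J_B(t;\lambda)=\left(\frac{\lambda_c}{1+\lambda_c}\right)^{1/2}\left(\frac{1}{1+\lambda_c}\right)^{\sigma-1/2}\exp\!\left(\frac{{\rm i} t f_0(\Lambda,\lambda_c)}{1+\lambda_c}\right)\widetilde J_B(t;\Lambda),$$ and, as $t\to\infty$, $$\widetilde J_B(t;\Lambda)={\rm e}^{-{\rm i}\omega^2}\sqrt{\frac{2}{\lambda_c t}}\left(\int_\omega^{\infty{\rm e}^{{\rm i}\pi/4}}{\rm e}^{{\rm i}\xi^2}\,{\rm d}\xi\right)\big(1+o(1)\big),$$ where the $o(1)$ is independent of $\Lambda$. If $\Lambda$ is such that $\omega={\cal O}(1)$ as $t\to\infty$ (e.g. $\Lambda=0$), then the integral $\int_\omega^{\infty{\rm e}^{{\rm i}\pi/4}}{\rm e}^{{\rm i}\xi^2}{\rm d}\xi$ is ${\cal O}(1)$ with implied constant independent of $\Lambda$. If $\Lambda$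 is such that $\omega\to\infty$ as $t\to\infty$, then $$\widetilde J_B(t;\Lambda)=\sqrt{\frac{2}{\lambda_c t}}\left(\frac{-1}{2{\rm i}\omega}+{\cal O}\!\left(\frac{1}{\omega^3}\right)\right)\big(1+o(1)\big)\quad (t\to\infty),$$ where both the $o(1)$ and the implied constant in ${\cal O}(1/\omega^3)$ are independent of $\Lambda$.
   Context: $F(z;\lambda):=(1-z)\ln(1-z)+z\ln z+z\ln\lambda$, with branch cuts $(-\infty,0]$ and $[1,\infty)$. The angle $\phi$ satisfies $0<\phi<\pi/2$ if $\ln\lambda\ge0$ and $0<\phi<\arctan(\pi/|\ln\lambda|)$ if $\ln\lambda<0$ (equivalently, the integrand below decays exponentially at infinity along the ray). $J_B(t;\lambda):=\int_{1-t^{\delta-1}}^{\infty{\rm e}^{{\rm i}\phi}}(1-z)^{-1/2}z^{\sigma-1/2}\exp({\rm i} tF(z;\lambda))\,{\rm d} z$, where $\int_c^{\infty{\rm e}^{{\rm i}\theta}}$ denotes integration from $c$ to infinity along the ray $c+r{\rm e}^{{\rm i}\theta}$, $r\ge0$. Further, $f_0(\Lambda,\lambda_c):=\ln\!\big(\frac{\lambda_c(1+\Lambda)}{1+\lambda_c}\big)-\lambda_c\ln\!\big(\frac{1+\lambda_c}{\lambda_c}\big)$, $g(\zeta;t):=(1-\zeta)^{-1/2}(1+\lambda_c\zeta)^{\sigma-1/2}$, $f_1(\zeta;t,\Lambda):=\lambda_c\zeta[\ln(1+\Lambda)+\ln(1+\lambda_c\zeta)-\ln(1-\zeta)]+\ln(1+\lambda_c\zeta)+\lambda_c\ln(1-\zeta)$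 (branch cut of $\ln(1+\lambda_c\zeta)$ on $(-\infty,-1/\lambda_c]$, of $\ln(1-\zeta)$ on $[1,\infty)$), $h:=f_1/(1+\lambda_c)$, and $\widetilde J_B(t;\Lambda):=\int_0^{\infty{\rm e}^{{\rm i}\phi}}g(\zeta;t)\exp({\rm i} t h(\zeta;t,\Lambda))\,{\rm d}\zeta$ (this corresponds to the substitution $z=(1+\lambda_c\zeta)/(1+\lambda_c)$). *)

(* Defs.v *)
From Stdlib Require Import Reals.
From Coquelicot Require Import Coquelicot.
Open Scope R_scope.

Definition Carg (z : C) : R :=
  let x := fst z in let y := snd z in
  if Rlt_dec 0 x then atan (y / x)
  else if Rlt_dec x 0 then
    (if Rle_dec 0 y then atan (y / x) + PI else atan (y / x) - PI)
  else if Rlt_dec 0 y then PI / 2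
  else if Rlt_dec y 0 then - (PI / 2) else 0.

Definition Cexp (z : C) : C :=
  (exp (fst z) * cos (snd z), exp (fst z) * sin (snd z)).

Definition Clog (z : C) : C := (ln (Cmod z), Carg z).

Definition Cpow (z : C) (a : R) : C := Cexp (RtoC a * Clog z).

Definition ray_int (f : C -> C) (c : C) (theta : R) : C :=
  @RInt_gen C_R_CompleteNormedModule
    (fun r : R => f (c + RtoC r * Cexp (0, theta))%C * Cexp (0, theta))%C
    (at_point 0) (Rbar_locally p_infty).

Definition Fz (z : C) (lam : R) : C :=
  ((1 - z) * Clog (1 - z) + z * Clog z + z * RtoC (ln lam))%C.

Definition adm_phi (lam phi : R) : Prop :=
  0 < phi /\
  (0 <= ln lam -> phi < PI / 2) /\
  (ln lam < 0 -> phi < atan (PI / Rabs (ln lam))).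

Definition J_B (delta sigma phi t lam : R) : C :=
  ray_int (fun z => Cpow (1 - z) (-(1/2)) * Cpow z (sigma - 1/2)
                    * Cexp (Ci * RtoC t * Fz z lam))%C
          (RtoC (1 - Rpower t (delta - 1))) phi.

Definition lam_c (delta t : R) : R :=
  Rpower t (delta - 1) / (1 - Rpower t (delta - 1)).

Definition f0 (Lam lc : R) : R :=
  ln (lc * (1 + Lam) / (1 + lc)) - lc * ln ((1 + lc) / lc).

Definition g_fun (sigma lc : R) (zeta : C) : C :=
  (Cpow (1 - zeta) (-(1/2)) * Cpow (1 + RtoC lc * zeta) (sigma - 1/2))%C.

Definition f1 (lc Lam : R) (zeta : C) : C :=
  (RtoC lc * zeta * (RtoC (ln (1 + Lam)) + Clog (1 + RtoC lc * zeta)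
                     - Clog (1 - zeta))
   + Clog (1 + RtoC lc * zeta) + RtoC lc * Clog (1 - zeta))%C.

Definition h_fun (lc Lam : R) (zeta : C) : C :=
  (f1 lc Lam zeta / RtoC (1 + lc))%C.

Definition JB_tilde (delta sigma phi t Lam : R) : C :=
  let lc := lam_c delta t in
  ray_int (fun zeta => g_fun sigma lc zeta
                       * Cexp (Ci * RtoC t * h_fun lc Lam zeta))%C
          0 phi.

Definition omega (delta t Lam : R) : R :=
  let lc := lam_c delta t in
  sqrt (lc * t / 2) * (ln (1 + Lam) / (1 + lc)).

Definition fresnel_tail (w : R) : C :=
  ray_int (fun xi => Cexp (Ci * xi * xi))%C (RtoC w) (PI / 4).

Definition adm_Lam (delta t Lam : R) : Prop :=
  lam_c delta t <= lam_c delta t * (1 + Lam) <= Rpower t (1 - delta) - 1.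

Definition tends_to_0 (eps : R -> R) : Prop :=
  forall e, 0 < e -> exists T, forall t, T < t -> Rabs (eps t) < e.

(* Main.v *)
(** With [c = lam_c], the integrand of [JB_tilde] is a single exponential [exp Psi], holomorphic on the plane cut along [(-oo, -1/c]] and [[1, oo)], a star-shaped domain, so it has a primitive [P] there and the ray integral is a limit of [P]. In the horizontal direction [Im h] increases at rate tending to [pi c / (1 + c)], and in the vertical direction it decreases at rate at most [c |ln lambda| / (1 + c)]; admissibility of [phi] says exactly that the first wins in the sector below the ray, so the ray may be replaced by the diagonal from [0] to [(1 + i)/2] followed by a horizontal half-line, whatever [phi] is.

On the diagonal [zeta = x (1 + i)], with [N = c t] and [L = ln (1 + Lam)], both [exp Psi] and its quadratic model are [O(exp (- N (L x / 2 + x^2 / 8)))] and the exponents differ by [O(x + N x^3)]; the horizontal part is exponentially small in [N (1 + L)]. The total error is [O(1 / (N (1 + sqrt N L)))]. The model integral is a Fresnel tail [G / sqrt N], where [G] is the integral of [exp (- x^2 - a x (1 - i))] with [a = sqrt 2 omega]; an integration by parts shows [|G| >= const / (1 + a)], which turns the absolute error into a relative error [O(1 / sqrt N)] uniform in [Lam] and [phi]. *)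

Require Import Defs.
From Stdlib Require Import Reals Lra Psatz FunctionalExtensionality.
From Coquelicot Require Import Coquelicot.
Open Scope R_scope.

(** The obstacle is uniformity in [Lam] and [phi]. Bounds along the given ray degenerate as [phi]
    approaches its limit, so they serve only to identify a limit; every quantitative estimate is
    made on a contour independent of [phi]. The diagonal is the steepest descent direction of the
    quadratic model, since i zeta^2 = -2 x^2 there, and the linear term adds further decay. It is
    left at (1 + i)/2, before the singularity at 1 can spoil the cubic Taylor bound; horizontally
    the arguments of 1 + c zeta and 1 - zeta alone give linear growth of Im h.

    As omega grows the Fresnel tail decays like 1/omega, so an absolute error O(1/N) would not be
    enough: the error must carry the same factor 1/(1 + sqrt N L) as the tail, and for this reason
    the weight in L is kept through all estimates. Contour integrals are never bounded as integrals:
    they are increments of primitives, controlled by comparing derivatives along real curves. *)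

(** * Moduli and the complex exponential *)

Lemma C_ext (z w : C) : fst z = fst w -> snd z = snd w -> z = w.
Proof. destruct z, w; simpl; intros; subst; reflexivity. Qed.

Lemma Cmod_le_sum (z : C) : Cmod z <= Rabs (fst z) + Rabs (snd z).
Proof.
  unfold Cmod.
  replace (Rabs (fst z) + Rabs (snd z))
    with (sqrt ((Rabs (fst z) + Rabs (snd z)) ^ 2)).
  - apply sqrt_le_1_alt.
    rewrite <- (pow2_abs (fst z)), <- (pow2_abs (snd z)).
    pose proof (Rabs_pos (fst z)). pose proof (Rabs_pos (snd z)). nra.
  - rewrite <- Rsqr_pow2. apply sqrt_Rsqr.
    pose proof (Rabs_pos (fst z)). pose proof (Rabs_pos (snd z)). lra.
Qed.

Lemma fst_le_Cmod (z : C) : Rabs (fst z) <= Cmod z.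
Proof. eapply Rle_trans; [apply Rmax_l | apply Rmax_Cmod]. Qed.

Lemma snd_le_Cmod (z : C) : Rabs (snd z) <= Cmod z.
Proof. eapply Rle_trans; [apply Rmax_r | apply Rmax_Cmod]. Qed.

Lemma Cmod_sqr (z : C) : Cmod z * Cmod z = fst z * fst z + snd z * snd z.
Proof.
  unfold Cmod. rewrite sqrt_sqrt; [ring | nra].
Qed.

Lemma Cmod_le_sqr (z : C) (a : R) :
  0 <= a -> fst z * fst z + snd z * snd z <= a * a -> Cmod z <= a.
Proof.
  intros Ha H. rewrite <- Cmod_sqr in H.
  pose proof (Cmod_ge_0 z). nra.
Qed.

Lemma Cmod_ge_sqr (z : C) (a : R) :
  0 <= a -> a * a <= fst z * fst z + snd z * snd z -> a <= Cmod z.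
Proof.
  intros Ha H. rewrite <- Cmod_sqr in H.
  pose proof (Cmod_ge_0 z). nra.
Qed.

Lemma Cmod_Ci : Cmod Ci = 1.
Proof.
  unfold Cmod, Ci; simpl.
  replace (0 * (0 * 1) + 1 * (1 * 1)) with 1 by ring. apply sqrt_1.
Qed.

Lemma Cmod_Cexp (z : C) : Cmod (Cexp z) = exp (fst z).
Proof.
  unfold Cmod, Cexp; simpl fst; simpl snd.
  replace ((exp (fst z) * cos (snd z)) ^ 2 + (exp (fst z) * sin (snd z)) ^ 2)
    with (Rsqr (exp (fst z))).
  - apply sqrt_Rsqr. left; apply exp_pos.
  - pose proof (sin2_cos2 (snd z)) as H. unfold Rsqr in *.
    transitivity (exp (fst z) * exp (fst z)
                  * (sin (snd z) * sin (snd z) + cos (snd z) * cos (snd z)));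
      [rewrite H|]; ring.
Qed.

Lemma Cexp_plus (z w : C) : Cexp (z + w) = (Cexp z * Cexp w)%C.
Proof.
  apply C_ext; unfold Cexp; simpl; rewrite exp_plus, ?cos_plus, ?sin_plus; ring.
Qed.

Lemma Cexp_0 : Cexp 0 = RtoC 1.
Proof. apply C_ext; unfold Cexp; simpl; rewrite exp_0, ?cos_0, ?sin_0; ring. Qed.

Lemma Cexp_RtoC (a : R) : Cexp (RtoC a) = RtoC (exp a).
Proof. apply C_ext; unfold Cexp; simpl; rewrite ?cos_0, ?sin_0; ring. Qed.

(** * Differentiation along curves *)

(** Derivatives are taken by coordinates along real curves, so that real calculus suffices;
    holomorphy enters through the chain rule in [curve_differentiable]. *)
Definition curve_deriv (p : R -> C) (r : R) (l : C) : Prop :=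
  is_derive (fun x => fst (p x)) r (fst l)
  /\ is_derive (fun x => snd (p x)) r (snd l).

Lemma is_derive_eq (f : R -> R) (x l l' : R) :
  is_derive f x l -> l = l' -> is_derive f x l'.
Proof. intros H <-; exact H. Qed.

Lemma curve_deriv_eq (p : R -> C) (r : R) (l l' : C) :
  curve_deriv p r l -> l = l' -> curve_deriv p r l'.
Proof. intros H <-; exact H. Qed.

Lemma curve_deriv_ext (p q : R -> C) (r : R) (l : C) :
  (forall x, p x = q x) -> curve_deriv p r l -> curve_deriv q r l.
Proof.
  intros E [H1 H2]; split;
    (eapply is_derive_ext; [intros x; rewrite <- E; reflexivity | assumption]).
Qed.

Lemma curve_deriv_const (a : C) (r : R) : curve_deriv (fun _ => a) r 0.
Proof. split; apply (is_derive_const (K := R_AbsRing) (V := R_NormedModule)). Qed.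

Lemma curve_deriv_plus (p q : R -> C) (r : R) (l m : C) :
  curve_deriv p r l -> curve_deriv q r m ->
  curve_deriv (fun x => p x + q x)%C r (l + m)%C.
Proof.
  intros [H1 H2] [H3 H4]; split; simpl.
  - exact (is_derive_plus (fun x => fst (p x)) (fun x => fst (q x)) r _ _ H1 H3).
  - exact (is_derive_plus (fun x => snd (p x)) (fun x => snd (q x)) r _ _ H2 H4).
Qed.

Lemma curve_deriv_mult (p q : R -> C) (r : R) (l m : C) :
  curve_deriv p r l -> curve_deriv q r m ->
  curve_deriv (fun x => p x * q x)%C r (l * q r + p r * m)%C.
Proof.
  intros [H1 H2] [H3 H4].
  pose proof (fun f g df dg (Hf : is_derive f r df) (Hg : is_derive g r dg) =>
    is_derive_mult f g r df dg Hf Hg Rmult_comm) as M.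
  split; simpl.
  - eapply is_derive_eq;
      [exact (is_derive_minus _ _ r _ _ (M _ _ _ _ H1 H3) (M _ _ _ _ H2 H4))|].
    unfold minus, plus, opp, mult; simpl. ring.
  - eapply is_derive_eq;
      [exact (is_derive_plus _ _ r _ _ (M _ _ _ _ H1 H4) (M _ _ _ _ H2 H3))|].
    unfold plus, mult; simpl. ring.
Qed.

Lemma curve_deriv_scal (k : C) (p : R -> C) (r : R) (l : C) :
  curve_deriv p r l -> curve_deriv (fun x => k * p x)%C r (k * l)%C.
Proof.
  intros H. eapply curve_deriv_eq;
    [apply curve_deriv_mult; [apply (curve_deriv_const k) | exact H]|].
  cbv beta; ring.
Qed.

Lemma curve_deriv_minus (p q : R -> C) (r : R) (l m : C) :
  curve_deriv p r l -> curve_deriv q r m ->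
  curve_deriv (fun x => p x - q x)%C r (l - m)%C.
Proof.
  intros H1 H2.
  apply curve_deriv_ext with (fun x => p x + (-(1)) * q x)%C; [intros; ring|].
  eapply curve_deriv_eq;
    [apply curve_deriv_plus; [exact H1 | apply curve_deriv_scal; exact H2]|].
  cbv beta; ring.
Qed.

Lemma curve_deriv_RtoC (f : R -> R) (r l : R) :
  is_derive f r l -> curve_deriv (fun x => RtoC (f x)) r (RtoC l).
Proof.
  intros H; split; simpl; [exact H|].
  apply (is_derive_const (K := R_AbsRing) (V := R_NormedModule)).
Qed.

Lemma curve_deriv_affine (a b : C) (r : R) :
  curve_deriv (fun x => a + RtoC x * b)%C r b.
Proof.
  eapply curve_deriv_eq.
  - apply curve_deriv_plus; [apply curve_deriv_const|].
    apply curve_deriv_mult; [|apply (curve_deriv_const b)].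
    apply curve_deriv_RtoC. exact (is_derive_id (K := R_AbsRing) r : is_derive (fun x => x) r 1).
  - cbv beta; ring.
Qed.

Lemma curve_deriv_rescale (p : R -> C) (k r : R) (l : C) :
  curve_deriv p (k * r) l -> curve_deriv (fun x => p (k * x)) r (RtoC k * l)%C.
Proof.
  intros [H1 H2].
  assert (D : is_derive (fun x => k * x) r k).
  { eapply is_derive_eq; [apply is_derive_scal, (is_derive_id (K := R_AbsRing))|].
    unfold one; simpl; ring. }
  split; simpl.
  - eapply is_derive_eq;
      [exact (is_derive_comp (fun y => fst (p y)) (fun x => k * x) r _ _ H1 D)|].
    unfold scal; simpl; unfold mult; simpl; ring.
  - eapply is_derive_eq;
      [exact (is_derive_comp (fun y => snd (p y)) (fun x => k * x) r _ _ H2 D)|].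
    unfold scal; simpl; unfold mult; simpl; ring.
Qed.

Lemma curve_deriv_Cexp (p : R -> C) (r : R) (l : C) :
  curve_deriv p r l -> curve_deriv (fun x => Cexp (p x)) r (l * Cexp (p r))%C.
Proof.
  intros [H1 H2].
  pose proof (fun f g df dg (Hf : is_derive f r df) (Hg : is_derive g r dg) =>
    is_derive_mult f g r df dg Hf Hg Rmult_comm) as M.
  pose proof (is_derive_comp exp _ r _ _ (is_derive_exp _) H1) as E.
  pose proof (is_derive_comp cos _ r _ _ (is_derive_cos _) H2) as Co.
  pose proof (is_derive_comp sin _ r _ _ (is_derive_sin _) H2) as Si.
  split; simpl.
  - eapply is_derive_eq; [exact (M _ _ _ _ E Co)|].
    unfold plus, mult, scal; simpl; unfold mult; simpl. ring.
  - eapply is_derive_eq; [exact (M _ _ _ _ E Si)|].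
    unfold plus, mult, scal; simpl; unfold mult; simpl. ring.
Qed.

(** * The principal logarithm on the slit plane *)

Definition slit (z : C) : Prop := 0 < fst z \/ snd z <> 0.

Lemma slit_Cmod_pos (z : C) : slit z -> 0 < Cmod z.
Proof.
  intros H. apply Cmod_gt_0. intros ->. destruct H as [H|H]; simpl in H; lra.
Qed.

Lemma Carg_right (z : C) : 0 < fst z -> Carg z = atan (snd z / fst z).
Proof. intros H. unfold Carg. destruct (Rlt_dec 0 (fst z)); [reflexivity|lra]. Qed.

Lemma atan_flip (x y : R) : 0 < x -> 0 < y -> atan (y / x) = PI / 2 - atan (x / y).
Proof.
  intros Hx Hy. replace (y / x) with (/ (x / y)) by (field; lra).
  apply atan_inv. apply Rdiv_lt_0_compat; assumption.
Qed.

(** An arctangent of x / y is smooth across the imaginary axis, where the cases of [Carg] change.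
    With [Carg_right] and [Carg_lower] this covers the slit plane by three open charts, enough to
    differentiate the argument everywhere on it. *)
Lemma Carg_upper (z : C) : 0 < snd z -> Carg z = PI / 2 - atan (fst z / snd z).
Proof.
  destruct z as [x y]; simpl; intros Hy. unfold Carg; simpl.
  destruct (Rlt_dec 0 x) as [Hx|Hx]; [apply atan_flip; assumption|].
  destruct (Rlt_dec x 0) as [Hx'|Hx'].
  - destruct (Rle_dec 0 y); [|lra].
    replace (y / x) with (- (y / (- x))) by (field; lra).
    replace (x / y) with (- (- x / y)) by (field; lra).
    rewrite !atan_opp, atan_flip by lra. lra.
  - replace x with 0 by lra. destruct (Rlt_dec 0 y); [|lra].
    replace (0 / y) with 0 by (field; lra). rewrite atan_0. lra.
Qed.

Lemma Carg_lower (z : C) : snd z < 0 -> Carg z = - (PI / 2) - atan (fst z / snd z).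
Proof.
  destruct z as [x y]; simpl; intros Hy. unfold Carg; simpl.
  destruct (Rlt_dec 0 x) as [Hx|Hx].
  - replace (y / x) with (- (- y / x)) by (field; lra).
    replace (x / y) with (- (x / - y)) by (field; lra).
    rewrite !atan_opp, atan_flip by lra. lra.
  - destruct (Rlt_dec x 0) as [Hx'|Hx'].
    + destruct (Rle_dec 0 y); [lra|].
      replace (y / x) with (- y / - x) by (field; lra).
      replace (x / y) with (- x / - y) by (field; lra).
      rewrite atan_flip by lra. lra.
    + replace x with 0 by lra.
      destruct (Rlt_dec 0 y); [lra|]. destruct (Rlt_dec y 0); [|lra].
      replace (0 / y) with 0 by (field; lra). rewrite atan_0. lra.
Qed.

Lemma locally_curve_pos (f : R -> R) (r l : R) :
  is_derive f r l -> 0 < f r -> locally r (fun x => 0 < f x).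
Proof.
  intros D H.
  apply (ex_derive_continuous f r (ex_intro _ l D)).
  exact (open_gt 0 (f r) H).
Qed.

Lemma is_derive_atan_quot (k : R) (X Y : R -> R) (r a b : R) :
  is_derive X r a -> is_derive Y r b -> Y r <> 0 ->
  is_derive (fun x => k + atan (X x / Y x)) r
    ((a * Y r - X r * b) / (X r * X r + Y r * Y r)).
Proof.
  intros HX HY H0.
  assert (EX : ex_derive X r) by (eexists; exact HX).
  assert (EY : ex_derive Y r) by (eexists; exact HY).
  assert (0 < X r * X r + Y r * Y r) by (destruct (Rdichotomy _ _ H0); nra).
  auto_derive; [repeat split; assumption|].
  change (Derive (fun x => X x) r) with (Derive X r).
  change (Derive (fun x => Y x) r) with (Derive Y r).
  rewrite (is_derive_unique X r _ HX), (is_derive_unique Y r _ HY).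
  field. repeat split; nra.
Qed.

Lemma is_derive_ln_norm (X Y : R -> R) (r a b : R) :
  is_derive X r a -> is_derive Y r b -> 0 < X r * X r + Y r * Y r ->
  is_derive (fun x => ln (sqrt (X x ^ 2 + Y x ^ 2))) r
    ((a * X r + b * Y r) / (X r * X r + Y r * Y r)).
Proof.
  intros HX HY H0.
  assert (EX : ex_derive X r) by (eexists; exact HX).
  assert (EY : ex_derive Y r) by (eexists; exact HY).
  assert (Hs : 0 < sqrt (X r * (X r * 1) + Y r * (Y r * 1)))
    by (apply sqrt_lt_R0; nra).
  assert (Hq : sqrt (X r * (X r * 1) + Y r * (Y r * 1))
               * sqrt (X r * (X r * 1) + Y r * (Y r * 1)) = X r * X r + Y r * Y r)
    by (rewrite sqrt_sqrt; nra).
  auto_derive; [repeat split; try assumption; nra|].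
  change (Derive (fun x => X x) r) with (Derive X r).
  change (Derive (fun x => Y x) r) with (Derive Y r).
  rewrite (is_derive_unique X r _ HX), (is_derive_unique Y r _ HY).
  set (s := sqrt _) in *. rewrite <- Hq. field. lra.
Qed.

Lemma is_derive_Carg (p : R -> C) (r : R) (l : C) :
  slit (p r) -> curve_deriv p r l ->
  is_derive (fun x => Carg (p x)) r (snd (l / p r)%C).
Proof.
  intros Hs [H1 H2]. pose proof (slit_Cmod_pos _ Hs) as Hm.
  assert (Hsq : 0 < fst (p r) * fst (p r) + snd (p r) * snd (p r))
    by (rewrite <- Cmod_sqr; nra).
  assert (H1' : is_derive (fun x => - fst (p x)) r (- fst l))
    by exact (is_derive_opp _ _ _ H1).
  assert (H2' : is_derive (fun x => - snd (p x)) r (- snd l))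
    by exact (is_derive_opp _ _ _ H2).
  destruct (Rlt_dec 0 (snd (p r))) as [Hy|Hy].
  { eapply is_derive_ext_loc;
      [eapply filter_imp; [|exact (locally_curve_pos _ _ _ H2 Hy)]|
       eapply is_derive_eq;
         [apply (is_derive_atan_quot (PI / 2) _ _ _ _ _ H1' H2); lra|]].
    - intros x Hx. cbv beta in Hx |- *. rewrite Carg_upper by exact Hx.
      replace (- fst (p x) / snd (p x)) with (- (fst (p x) / snd (p x))) by (field; lra).
      rewrite atan_opp. reflexivity.
    - simpl. field. nra. }
  destruct (Rlt_dec (snd (p r)) 0) as [Hy'|Hy'].
  { assert (Hy2 : 0 < - snd (p r)) by lra.
    eapply is_derive_ext_loc;
      [eapply filter_imp; [|exact (locally_curve_pos _ _ _ H2' Hy2)]|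
       eapply is_derive_eq;
         [apply (is_derive_atan_quot (- (PI / 2)) _ _ _ _ _ H1' H2); lra|]].
    - intros x Hx. cbv beta in Hx |- *. rewrite Carg_lower by lra.
      replace (- fst (p x) / snd (p x)) with (- (fst (p x) / snd (p x))) by (field; lra).
      rewrite atan_opp. reflexivity.
    - simpl. field. nra. }
  assert (Hx : 0 < fst (p r)) by (destruct Hs; lra).
  eapply is_derive_ext_loc;
    [eapply filter_imp; [|exact (locally_curve_pos _ _ _ H1 Hx)]|
     eapply is_derive_eq;
       [apply (is_derive_atan_quot 0 _ _ _ _ _ H2 H1); lra|]].
  - intros x Hx'. cbv beta in Hx' |- *. rewrite Carg_right by exact Hx'. apply Rplus_0_l.
  - simpl. field. nra.
Qed.

Lemma is_derive_ln_Cmod (p : R -> C) (r : R) (l : C) :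
  slit (p r) -> curve_deriv p r l ->
  is_derive (fun x => ln (Cmod (p x))) r (fst (l / p r)%C).
Proof.
  intros Hs [H1 H2]. pose proof (slit_Cmod_pos _ Hs) as Hm.
  assert (Hsq : 0 < fst (p r) * fst (p r) + snd (p r) * snd (p r))
    by (rewrite <- Cmod_sqr; nra).
  eapply is_derive_eq; [exact (is_derive_ln_norm _ _ _ _ _ H1 H2 Hsq)|].
  simpl. field. nra.
Qed.

Lemma curve_deriv_Clog (p : R -> C) (r : R) (l : C) :
  slit (p r) -> curve_deriv p r l ->
  curve_deriv (fun x => Clog (p x)) r (l / p r)%C.
Proof.
  intros Hs H. split; simpl fst; simpl snd.
  - exact (is_derive_ln_Cmod p r l Hs H).
  - exact (is_derive_Carg p r l Hs H).
Qed.

(** * Mean value inequalities *)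

Lemma is_derive_le_increment (f M f' m : R -> R) (a b : R) :
  a <= b ->
  (forall x, a <= x <= b -> is_derive f x (f' x)) ->
  (forall x, a <= x <= b -> is_derive M x (m x)) ->
  (forall x, a <= x <= b -> f' x <= m x) ->
  f b - f a <= M b - M a.
Proof.
  intros Hab Hf HM Hle.
  destruct (MVT_gen (fun x => M x - f x) a b (fun x => m x - f' x)) as [c [Hc E]].
  - intros x Hx. rewrite Rmin_left, Rmax_right in Hx by lra.
    apply (is_derive_minus M f); [apply HM | apply Hf]; lra.
  - intros x Hx. rewrite Rmin_left, Rmax_right in Hx by lra.
    apply derivable_continuous_pt. exists (m x - f' x).
    apply is_derive_Reals. apply (is_derive_minus M f); [apply HM | apply Hf]; lra.
  - rewrite Rmin_left, Rmax_right in Hc by lra.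
    specialize (Hle c Hc). nra.
Qed.

(** Project the curve on the direction v = p b - p a: by Cauchy-Schwarz the real function <v, p> has
    derivative at most |v| m, so |v|^2 <= |v| (M b - M a). A real majorant M in place of a constant
    lets exponentially decaying bounds be integrated exactly. *)
Lemma curve_mean_value (p p' : R -> C) (M m : R -> R) (a b : R) :
  a <= b ->
  (forall x, a <= x <= b -> curve_deriv p x (p' x)) ->
  (forall x, a <= x <= b -> is_derive M x (m x)) ->
  (forall x, a <= x <= b -> Cmod (p' x) <= m x) ->
  Cmod (p b - p a) <= M b - M a.
Proof.
  intros Hab Hp HM Hle.
  set (v := (p b - p a)%C).
  pose proof (Cmod_ge_0 v) as H0.
  assert (Hinc : forall k : R,
    (forall x, a <= x <= b -> fst v * fst (p' x) + snd v * snd (p' x) <= k * m x) ->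
    Cmod v * Cmod v <= k * (M b - M a)).
  { intros k Hk.
    replace (Cmod v * Cmod v) with
      ((fst v * fst (p b) + snd v * snd (p b))
       - (fst v * fst (p a) + snd v * snd (p a)))
      by (rewrite Cmod_sqr; unfold v; simpl; ring).
    replace (k * (M b - M a)) with (k * M b - k * M a) by ring.
    apply (is_derive_le_increment
      (fun x => fst v * fst (p x) + snd v * snd (p x)) (fun x => k * M x)
      (fun x => fst v * fst (p' x) + snd v * snd (p' x)) (fun x => k * m x));
      [exact Hab | | | exact Hk].
    - intros x Hx. destruct (Hp x Hx) as [D1 D2].
      exact (is_derive_plus _ _ _ _ _ (is_derive_scal _ x (fst v) _ D1)
                            (is_derive_scal _ x (snd v) _ D2)).
    - intros x Hx. exact (is_derive_scal _ x k _ (HM x Hx)). }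
  assert (Hcs : forall x, a <= x <= b ->
    fst v * fst (p' x) + snd v * snd (p' x) <= Cmod v * m x).
  { intros x Hx. specialize (Hle x Hx).
    pose proof (Cmod_ge_0 (p' x)). pose proof (Cmod_sqr v). pose proof (Cmod_sqr (p' x)).
    apply Rle_trans with (Cmod v * Cmod (p' x)); [|nra].
    set (s := fst v * fst (p' x) + snd v * snd (p' x)).
    assert (s * s <= (Cmod v * Cmod (p' x)) * (Cmod v * Cmod (p' x))).
    { replace (Cmod v * Cmod (p' x) * (Cmod v * Cmod (p' x)))
        with ((Cmod v * Cmod v) * (Cmod (p' x) * Cmod (p' x))) by ring.
      rewrite !Cmod_sqr. unfold s.
      pose proof (Rle_0_sqr (fst v * snd (p' x) - snd v * fst (p' x))) as Q.
      unfold Rsqr in Q. nra. }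
    assert (0 <= Cmod v * Cmod (p' x)) by (apply Rmult_le_pos; assumption).
    nra. }
  specialize (Hinc (Cmod v) Hcs).
  assert (Hm : 0 <= M b - M a).
  { replace 0 with ((fun _ : R => 0) b - (fun _ : R => 0) a) by (cbv beta; ring).
    apply (is_derive_le_increment (fun _ => 0) M (fun _ => 0) m); try assumption.
    - intros x _. apply (is_derive_const (K := R_AbsRing) (V := R_NormedModule)).
    - intros x Hx. specialize (Hle x Hx). pose proof (Cmod_ge_0 (p' x)). lra. }
  destruct (Req_dec (Cmod v) 0) as [E|E]; [rewrite E; exact Hm|].
  nra.
Qed.

(** * Limits at infinity and improper integrals *)

Definition curve_lim (p : R -> C) (l : C) : Prop :=
  forall eps, 0 < eps -> exists X, forall x, X <= x -> Cmod (p x - l) < eps.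

Lemma curve_lim_near (p q : R -> C) (l : C) :
  curve_lim p l -> curve_lim (fun x => q x - p x)%C 0 -> curve_lim q l.
Proof.
  intros Hp Hq eps He.
  destruct (Hp (eps / 2)) as [X1 H1]; [lra|].
  destruct (Hq (eps / 2)) as [X2 H2]; [lra|].
  exists (Rmax X1 X2). intros x Hx.
  specialize (H1 x (Rle_trans _ _ _ (Rmax_l _ _) Hx)).
  specialize (H2 x (Rle_trans _ _ _ (Rmax_r _ _) Hx)).
  replace (q x - l)%C with ((q x - p x - 0) + (p x - l))%C by ring.
  eapply Rle_lt_trans; [apply Cmod_triangle|]. lra.
Qed.

Lemma curve_lim_minus (p q : R -> C) (l m : C) :
  curve_lim p l -> curve_lim q m -> curve_lim (fun x => p x - q x)%C (l - m)%C.
Proof.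
  intros Hp Hq eps He.
  destruct (Hp (eps / 2)) as [X1 H1]; [lra|].
  destruct (Hq (eps / 2)) as [X2 H2]; [lra|].
  exists (Rmax X1 X2). intros x Hx.
  specialize (H1 x (Rle_trans _ _ _ (Rmax_l _ _) Hx)).
  specialize (H2 x (Rle_trans _ _ _ (Rmax_r _ _) Hx)).
  replace (p x - q x - (l - m))%C with ((p x - l) + - (q x - m))%C by ring.
  eapply Rle_lt_trans; [apply Cmod_triangle|]. rewrite Cmod_opp. lra.
Qed.

Lemma curve_lim_scal (k : C) (p : R -> C) (l : C) :
  curve_lim p l -> curve_lim (fun x => k * p x)%C (k * l)%C.
Proof.
  intros Hp eps He. pose proof (Cmod_ge_0 k).
  destruct (Hp (eps / (Cmod k + 1))) as [X H1]; [apply Rdiv_lt_0_compat; lra|].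
  exists X. intros x Hx. specialize (H1 x Hx).
  replace (k * p x - k * l)%C with (k * (p x - l))%C by ring.
  rewrite Cmod_mult. pose proof (Cmod_ge_0 (p x - l)).
  apply Rle_lt_trans with ((Cmod k + 1) * Cmod (p x - l)); [nra|].
  apply Rmult_lt_compat_l with (r := Cmod k + 1) in H1; [|lra].
  replace ((Cmod k + 1) * (eps / (Cmod k + 1))) with eps in H1 by (field; lra).
  exact H1.
Qed.

Lemma curve_lim_rescale (k : R) (p : R -> C) (l : C) :
  0 < k -> curve_lim p l -> curve_lim (fun x => p (k * x)) l.
Proof.
  intros Hk Hp eps He. destruct (Hp eps He) as [X H]. exists (X / k).
  intros x Hx. apply H.
  apply Rmult_le_compat_l with (r := k) in Hx; [|lra].
  replace (k * (X / k)) with X in Hx by (field; lra). exact Hx.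
Qed.

Lemma curve_lim_Cmod_le (p : R -> C) (l a : C) (B X : R) :
  curve_lim p l -> (forall x, X <= x -> Cmod (p x - a) <= B) -> Cmod (l - a) <= B.
Proof.
  intros Hp HB. apply le_epsilon. intros eps He.
  destruct (Hp eps He) as [Y HY].
  specialize (HY _ (Rmax_r X Y)). specialize (HB _ (Rmax_l X Y)).
  set (x := Rmax X Y) in *.
  replace (l - a)%C with ((p x - a) + - (p x - l))%C by ring.
  eapply Rle_trans; [apply Cmod_triangle|]. rewrite Cmod_opp. lra.
Qed.

Lemma curve_lim_fst_ge (p : R -> C) (l : C) (B X : R) :
  curve_lim p l -> (forall x, X <= x -> B <= fst (p x)) -> B <= fst l.
Proof.
  intros Hp HB. apply le_epsilon. intros eps He.
  destruct (Hp eps He) as [Y HY].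
  specialize (HY _ (Rmax_r X Y)). specialize (HB _ (Rmax_l X Y)).
  pose proof (fst_le_Cmod (p (Rmax X Y) - l)) as H. simpl in H.
  apply Rabs_le_between in H. lra.
Qed.

Lemma curve_exp_increment (p p' : R -> C) (M a u v : R) :
  0 < a -> u <= v ->
  (forall x, u <= x <= v -> curve_deriv p x (p' x)) ->
  (forall x, u <= x <= v -> Cmod (p' x) <= M * exp (- a * x)) ->
  Cmod (p v - p u) <= M / a * exp (- a * u).
Proof.
  intros Ha Huv Hp HM.
  assert (HM0 : 0 <= M).
  { specialize (HM u (conj (Rle_refl u) Huv)). pose proof (Cmod_ge_0 (p' u)).
    pose proof (exp_pos (- a * u)). nra. }
  apply Rle_trans with (- (M / a) * exp (- a * v) - - (M / a) * exp (- a * u)).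
  - apply (curve_mean_value p p' (fun x => - (M / a) * exp (- a * x))
      (fun x => M * exp (- a * x))); [exact Huv | exact Hp | | exact HM].
    intros x Hx. auto_derive; [exact I|]. field. lra.
  - pose proof (exp_pos (- a * v)).
    assert (0 <= M / a) by (apply Rdiv_le_0_compat; assumption).
    nra.
Qed.

Lemma exp_small (a K eps : R) :
  0 < a -> 0 < eps -> exists X, forall x, X <= x -> K * exp (- a * x) < eps.
Proof.
  intros Ha He. exists (Rmax 1 ((Rabs K + 1) / (a * eps))). intros x Hx.
  pose proof (Rle_trans _ _ _ (Rmax_l _ _) Hx) as Hx1.
  pose proof (Rle_trans _ _ _ (Rmax_r _ _) Hx) as Hx2.
  pose proof (Rabs_pos K). pose proof (Rle_abs K).
  assert (Hax : 0 < a * x) by nra.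
  pose proof (exp_pos (- a * x)) as Ep.
  assert (E : exp (- a * x) * (a * x) < 1).
  { replace 1 with (exp (- a * x) * exp (a * x))
      by (rewrite <- exp_plus, <- exp_0; f_equal; ring).
    apply Rmult_lt_compat_l; [exact Ep|]. pose proof (exp_ineq1 (a * x)). lra. }
  assert (H2 : Rabs K + 1 <= eps * (a * x)).
  { apply Rmult_le_compat_l with (r := a * eps) in Hx2; [|nra].
    replace (a * eps * ((Rabs K + 1) / (a * eps))) with (Rabs K + 1) in Hx2
      by (field; lra). lra. }
  nra.
Qed.

(** Exponential decay of the derivative makes the curve Cauchy at infinity, and completeness of R is
    applied to each coordinate. *)
Lemma curve_lim_exp (p p' : R -> C) (x0 M a : R) :
  0 < a ->
  (forall x, x0 <= x -> curve_deriv p x (p' x)) ->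
  (forall x, x0 <= x -> Cmod (p' x) <= M * exp (- a * x)) ->
  exists l, curve_lim p l.
Proof.
  intros Ha Hp HM.
  assert (Hinc : forall u v, x0 <= u -> u <= v ->
    Cmod (p v - p u) <= M / a * exp (- a * u)).
  { intros u v Hu Huv. apply (curve_exp_increment p p'); try assumption;
      intros x Hx; [apply Hp | apply HM]; lra. }
  assert (Hcau : forall eps, 0 < eps -> exists X, forall u v, X <= u -> X <= v ->
    Cmod (p u - p v) < eps).
  { intros eps He. destruct (exp_small a (M / a) eps Ha He) as [X HX].
    exists (Rmax X x0). intros u v Hu Hv.
    pose proof (Rmax_l X x0). pose proof (Rmax_r X x0).
    destruct (Rle_dec u v) as [Huv|Huv].
    - rewrite <- Cmod_opp. replace (- (p u - p v))%C with (p v - p u)%C by ring.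
      eapply Rle_lt_trans; [apply Hinc; lra | apply HX; lra].
    - eapply Rle_lt_trans; [apply Hinc; lra | apply HX; lra]. }
  assert (Hreal : forall f : R -> R,
    (forall u v, Rabs (f u - f v) <= Cmod (p u - p v)) ->
    exists l, filterlim f (Rbar_locally p_infty) (locally l)).
  { intros f Hf.
    apply (proj1 (filterlim_locally_cauchy (U := R_CompleteSpace) f)).
    intros eps. destruct (Hcau eps (cond_pos eps)) as [X HX].
    exists (fun x => X < x). split; [exists X; tauto|].
    intros u v Hu Hv. unfold ball; simpl; unfold AbsRing_ball, abs, minus, plus, opp; simpl.
    eapply Rle_lt_trans; [apply (Hf v u) | apply HX; lra]. }
  destruct (Hreal (fun x => fst (p x))) as [l1 H1].
  { intros u v. exact (fst_le_Cmod (p u - p v)). }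
  destruct (Hreal (fun x => snd (p x))) as [l2 H2].
  { intros u v. exact (snd_le_Cmod (p u - p v)). }
  exists (l1, l2). intros eps He.
  assert (He2 : 0 < eps / 2) by lra.
  destruct (proj1 (filterlim_locally _ _) H1 (mkposreal _ He2)) as [X1 HX1].
  destruct (proj1 (filterlim_locally _ _) H2 (mkposreal _ He2)) as [X2 HX2].
  exists (Rmax X1 X2 + 1). intros x Hx.
  pose proof (Rmax_l X1 X2). pose proof (Rmax_r X1 X2).
  assert (A1 : Rabs (fst (p x) - l1) < eps / 2) by (apply (HX1 x); lra).
  assert (A2 : Rabs (snd (p x) - l2) < eps / 2) by (apply (HX2 x); lra).
  eapply Rle_lt_trans; [apply Cmod_le_sum|]. simpl. unfold Rminus in *. lra.
Qed.

Lemma curve_deriv_continuous (p : R -> C) (r : R) (l : C) :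
  curve_deriv p r l ->
  continuous (fun x => fst (p x)) r /\ continuous (fun x => snd (p x)) r.
Proof.
  intros [H1 H2]; split; apply (ex_derive_continuous (V := R_NormedModule));
    eexists; eassumption.
Qed.

(** The fundamental theorem of calculus by coordinates, followed by the limit at infinity. The
    derivative of [f] along the curve is the source of the continuity it requires. *)
Lemma improper_integral_curve_lim (f p : R -> C) (l : C) :
  (forall r, 0 <= r -> curve_deriv p r (f r)) ->
  (forall r, 0 <= r -> exists d, curve_deriv f r d) ->
  curve_lim p l ->
  @RInt_gen C_R_CompleteNormedModule f (at_point 0) (Rbar_locally p_infty)
    = (l - p 0)%C.
Proof.
  intros Hp Hf Hl.
  apply (is_RInt_gen_unique (V := C_R_CompleteNormedModule)).
  apply (filterlimi_locally (U := C_R_CompleteNormedModule)).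
  intros eps.
  destruct (Hl eps (cond_pos eps)) as [X HX].
  exists (fun a => a = 0) (fun b => Rmax X 0 < b); [reflexivity | exists (Rmax X 0); tauto|].
  intros a b -> Hb. pose proof (Rmax_l X 0). pose proof (Rmax_r X 0).
  exists (p b - p 0)%C. split.
  - simpl fst; simpl snd.
    assert (Hi : forall x, Rmin 0 b <= x <= Rmax 0 b -> 0 <= x)
      by (intros x Hx; rewrite Rmin_left in Hx; lra).
    apply (is_RInt_fct_extend_pair (U := R_NormedModule) (V := R_NormedModule)).
    + apply (is_RInt_derive (V := R_CompleteNormedModule) (fun x => fst (p x))).
      * intros x Hx. apply (Hp x (Hi x Hx)).
      * intros x Hx. destruct (Hf x (Hi x Hx)) as [d Hd].
        apply (curve_deriv_continuous _ _ _ Hd).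
    + apply (is_RInt_derive (V := R_CompleteNormedModule) (fun x => snd (p x))).
      * intros x Hx. apply (Hp x (Hi x Hx)).
      * intros x Hx. destruct (Hf x (Hi x Hx)) as [d Hd].
        apply (curve_deriv_continuous _ _ _ Hd).
  - assert (E : Cmod (p b - l) < eps) by (apply HX; lra).
    replace (p b - l)%C with ((p b - p 0) - (l - p 0))%C in E by ring.
    split; (eapply Rle_lt_trans; [|exact E]).
    + apply (fst_le_Cmod ((p b - p 0) - (l - p 0))).
    + apply (snd_le_Cmod ((p b - p 0) - (l - p 0))).
Qed.

(** * Primitives on star-shaped domains *)

(** The base space is arbitrary because continuity is used over R, over C and, for differentiation
    under the integral sign, over the product of R with itself. *)
Definition Ccont {U : UniformSpace} (f : U -> C) (z : U) : Prop :=
  continuous (fun x => fst (f x)) z /\ continuous (fun x => snd (f x)) z.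

Lemma Ccont_const {U : UniformSpace} (a : C) (z : U) : Ccont (fun _ : U => a) z.
Proof. split; apply continuous_const. Qed.

Lemma Ccont_plus {U : UniformSpace} (f g : U -> C) (z : U) :
  Ccont f z -> Ccont g z -> Ccont (fun x => f x + g x)%C z.
Proof.
  intros [H1 H2] [H3 H4]; split; simpl.
  - exact (continuous_plus _ _ z H1 H3).
  - exact (continuous_plus _ _ z H2 H4).
Qed.

Lemma Ccont_mult {U : UniformSpace} (f g : U -> C) (z : U) :
  Ccont f z -> Ccont g z -> Ccont (fun x => f x * g x)%C z.
Proof.
  intros [H1 H2] [H3 H4]; split; simpl.
  - exact (continuous_minus _ _ z (continuous_mult _ _ z H1 H3)
                            (continuous_mult _ _ z H2 H4)).
  - exact (continuous_plus _ _ z (continuous_mult _ _ z H1 H4)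
                            (continuous_mult _ _ z H2 H3)).
Qed.

Lemma Ccont_RtoC {U : UniformSpace} (f : U -> R) (z : U) :
  continuous f z -> Ccont (fun x => RtoC (f x)) z.
Proof. intros H; split; simpl; [exact H | apply continuous_const]. Qed.

Lemma Ccont_id (z : C) : Ccont (U := C_UniformSpace) (fun x : C => x) z.
Proof. split; [apply continuous_fst | apply continuous_snd]. Qed.

Lemma Ccont_comp {U : UniformSpace} (f : C -> C) (q : U -> C) (z : U) :
  Ccont (U := C_UniformSpace) f (q z) -> Ccont q z -> Ccont (fun x => f (q x)) z.
Proof.
  intros [H1 H2] [H3 H4]. split.
  - apply (continuous_ext (fun x => (fun a b => fst (f (a, b))) (fst (q x)) (snd (q x)))).
    { intros x. cbv beta. rewrite <- surjective_pairing. reflexivity. }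
    apply (continuous_comp_2 _ _ (fun a b => fst (f (a, b))) z H3 H4).
    rewrite <- surjective_pairing.
    eapply continuous_ext; [|exact H1].
    intros x. cbv beta. rewrite <- surjective_pairing. reflexivity.
  - apply (continuous_ext (fun x => (fun a b => snd (f (a, b))) (fst (q x)) (snd (q x)))).
    { intros x. cbv beta. rewrite <- surjective_pairing. reflexivity. }
    apply (continuous_comp_2 _ _ (fun a b => snd (f (a, b))) z H3 H4).
    rewrite <- surjective_pairing.
    eapply continuous_ext; [|exact H2].
    intros x. cbv beta. rewrite <- surjective_pairing. reflexivity.
Qed.

Lemma Ccont_curve (p : R -> C) (r : R) (l : C) :
  curve_deriv p r l -> Ccont (U := R_UniformSpace) p r.
Proof. exact (curve_deriv_continuous p r l). Qed.

(** The real part of k times the integral of [f] along the segment from 0 to z. Since Re (- i w) =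
    Im w, the values k = 1 and k = - i yield both coordinates of the primitive from one
    computation. *)
Definition star_form (f : C -> C) (k z : C) : R :=
  RInt (fun u => fst (k * (z * f (RtoC u * z)))%C) 0 1.

Definition star_primitive (f : C -> C) (z : C) : C :=
  (star_form f 1 z, star_form f (- Ci) z).

(** Holomorphy with derivative [f'], in the form of the chain rule along every real curve through
    [D]. *)
Definition curve_differentiable (D : C -> Prop) (f f' : C -> C) : Prop :=
  forall p r l, D (p r) -> curve_deriv p r l ->
    curve_deriv (fun x => f (p x)) r (f' (p r) * l)%C.

Section StarPrimitive.
Variables (D : C -> Prop) (f f' : C -> C).
Hypothesis D_star : forall z u, D z -> 0 <= u <= 1 -> D (RtoC u * z)%C.
Hypothesis D_open : open (T := C_UniformSpace) D.
Hypothesis f_deriv : curve_differentiable D f f'.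
Hypothesis f_cont : forall z, D z -> Ccont (U := C_UniformSpace) f z.
Hypothesis f'_cont : forall z, D z -> Ccont (U := C_UniformSpace) f' z.

Let radial_integrand (z : C) : C := (f z + z * f' z)%C.

Lemma Ccont_locally {U : UniformSpace} (q : U -> C) (x : U) :
  Ccont q x -> D (q x) -> locally x (fun y => D (q y)).
Proof.
  intros [H1 H2] Hx.
  destruct (D_open (q x) Hx) as [e He].
  pose proof (proj1 (filterlim_locally _ _) H1 e) as L1.
  pose proof (proj1 (filterlim_locally _ _) H2 e) as L2.
  eapply filter_imp; [|exact (filter_and _ _ L1 L2)].
  intros y [B1 B2]. apply He. split; assumption.
Qed.

Lemma star_form_radial_integrand (k a b : C) (r u : R) :
  D (RtoC u * (a + RtoC r * b))%C ->
  is_derive (fun s => fst (k * ((a + RtoC s * b)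
                         * f (RtoC u * (a + RtoC s * b))))%C) r
    (fst (k * (b * radial_integrand (RtoC u * (a + RtoC r * b))))%C).
Proof.
  intros HD.
  assert (H : curve_deriv (fun s => k * ((a + RtoC s * b)
                         * f (RtoC u * (a + RtoC s * b))))%C r
    (k * (b * radial_integrand (RtoC u * (a + RtoC r * b))))%C); [|exact (proj1 H)].
  apply curve_deriv_scal.
  eapply curve_deriv_eq.
  - apply curve_deriv_mult; [apply curve_deriv_affine|].
    apply (f_deriv (fun s => RtoC u * (a + RtoC s * b))%C); [exact HD|].
    apply curve_deriv_scal, curve_deriv_affine.
  - unfold radial_integrand. cbv beta. ring.
Qed.

Lemma radial_deriv (k z : C) (u : R) :
  D (RtoC u * z)%C ->
  curve_deriv (fun v => k * (RtoC v * f (RtoC v * z)))%C u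
    (k * radial_integrand (RtoC u * z))%C.
Proof.
  intros HD. apply curve_deriv_scal.
  assert (Hv : curve_deriv (fun v => RtoC v) u 1)
    by (apply curve_deriv_RtoC; exact (is_derive_id (K := R_AbsRing) u)).
  eapply curve_deriv_eq.
  - apply curve_deriv_mult; [exact Hv|].
    apply (f_deriv (fun v => RtoC v * z)%C); [exact HD|].
    apply curve_deriv_mult; [exact Hv | apply curve_deriv_const].
  - unfold radial_integrand. cbv beta. ring.
Qed.

Lemma Ccont_radial_integrand (z : C) :
  D z -> Ccont (U := C_UniformSpace) radial_integrand z.
Proof.
  intros Hz. apply (Ccont_plus (U := C_UniformSpace)); [apply f_cont; exact Hz|].
  apply (Ccont_mult (U := C_UniformSpace)); [apply Ccont_id | apply f'_cont; exact Hz].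
Qed.

(** Differentiation under the integral sign in the direction b produces b (f + w f') at w = u z,
    which is b times the u-derivative of u f(u z). Its integral over [0, 1] is therefore b f(z).
    Path independence is thus built into the primitive, and no separate form of Cauchy's theorem is
    needed. *)
Lemma star_form_deriv (k a b : C) (r : R) :
  D (a + RtoC r * b)%C ->
  is_derive (fun s => star_form f k (a + RtoC s * b)%C) r
    (fst (k * (b * f (a + RtoC r * b)))%C).
Proof.
  intros Hr.
  set (F := fun (s u : R) => fst (k * ((a + RtoC s * b)
                         * f (RtoC u * (a + RtoC s * b))))%C).
  assert (Hloc : locally (T := R_UniformSpace) r (fun s => D (a + RtoC s * b)%C)).
  { apply (Ccont_locally (U := R_UniformSpace) (fun s => a + RtoC s * b)%C r);
      [|exact Hr].
    eapply Ccont_curve, curve_deriv_affine. }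
  assert (I01 : forall u, Rmin 0 1 <= u <= Rmax 0 1 -> 0 <= u <= 1)
    by (intros u; rewrite Rmin_left, Rmax_right; lra).
  eapply is_derive_eq.
  - apply (is_derive_RInt_param F 0 1 r).
    + eapply filter_imp; [|exact Hloc]. intros s Hs u Hu. eexists.
      apply star_form_radial_integrand, D_star; [exact Hs | apply I01, Hu].
    + intros u Hu.
      set (q := fun z : R * R => (RtoC (snd z) * (a + RtoC (fst z) * b))%C).
      assert (Hq : Ccont (U := prod_UniformSpace R_UniformSpace R_UniformSpace) q (r, u)).
      { apply Ccont_mult; [apply Ccont_RtoC, continuous_snd|].
        apply Ccont_plus; [apply Ccont_const|].
        apply Ccont_mult; [apply Ccont_RtoC, continuous_fst | apply Ccont_const]. }
      assert (HDq : D (q (r, u))) by (apply D_star; [exact Hr | apply I01, Hu]).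
      (* Joint continuity is asked of the [Derive] of the integrand; it agrees with the explicit
         formula near (r, u) because the domain is open. *)
      apply continuity_2d_pt_ext_loc with
        (f := fun s v => fst (k * (b * radial_integrand (q (s, v))))%C).
      * apply locally_2d_locally.
        eapply filter_imp; [|exact (Ccont_locally q (r, u) Hq HDq)].
        intros [s v] Hsv. symmetry. apply is_derive_unique.
        apply star_form_radial_integrand. exact Hsv.
      * apply continuity_2d_pt_filterlim.
        assert (HC : Ccont (U := prod_UniformSpace R_UniformSpace R_UniformSpace)
          (fun z => k * (b * radial_integrand (q z)))%C (r, u)).
        { apply Ccont_mult; [apply Ccont_const|].
          apply Ccont_mult; [apply Ccont_const|].
          apply Ccont_comp; [apply Ccont_radial_integrand; exact HDq | exact Hq]. }
        eapply filterlim_ext; [|exact (proj1 HC)].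
        intros [s v]. reflexivity.
    + eapply filter_imp; [|exact Hloc]. intros s Hs.
      apply (ex_RInt_continuous (V := R_CompleteNormedModule)). intros u Hu.
      assert (HC : Ccont (U := R_UniformSpace) (fun u => k * ((a + RtoC s * b)
                         * f (RtoC u * (a + RtoC s * b))))%C u); [|exact (proj1 HC)].
      apply Ccont_mult; [apply Ccont_const|].
      apply Ccont_mult; [apply Ccont_const|].
      apply (Ccont_comp f (fun u => RtoC u * (a + RtoC s * b))%C).
      * apply f_cont, D_star; [exact Hs | apply I01, Hu].
      * apply Ccont_mult; [apply Ccont_RtoC, continuous_id | apply Ccont_const].
  - set (z := (a + RtoC r * b)%C).
    rewrite (RInt_ext _ (fun u => fst (k * b * radial_integrand (RtoC u * z))%C)).
    + apply is_RInt_unique.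
      replace (fst (k * (b * f z))%C) with
        (minus (fst (k * b * (RtoC 1 * f (RtoC 1 * z)))%C)
               (fst (k * b * (RtoC 0 * f (RtoC 0 * z)))%C)).
      * apply (is_RInt_derive (V := R_CompleteNormedModule)
          (fun u => fst (k * b * (RtoC u * f (RtoC u * z)))%C)).
        -- intros u Hu. apply (radial_deriv (k * b) z u).
           apply D_star; [exact Hr | apply I01, Hu].
        -- intros u Hu.
           assert (HC : Ccont (U := R_UniformSpace)
             (fun u => k * b * radial_integrand (RtoC u * z))%C u); [|exact (proj1 HC)].
           apply Ccont_mult; [apply Ccont_const|].
           apply (Ccont_comp radial_integrand (fun u => RtoC u * z)%C).
           ++ apply Ccont_radial_integrand, D_star; [exact Hr | apply I01, Hu].
           ++ apply Ccont_mult; [apply Ccont_RtoC, continuous_id | apply Ccont_const].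
      * rewrite !Cmult_1_l, !Cmult_0_l, Cmult_0_r.
        replace (k * b * f z)%C with (k * (b * f z))%C by ring.
        unfold minus, plus, opp; simpl. ring.
    + intros u Hu. rewrite Rmin_left, Rmax_right in Hu by lra.
      replace (k * b * radial_integrand (RtoC u * z))%C
        with (k * (b * radial_integrand (RtoC u * z)))%C by ring.
      apply is_derive_unique, star_form_radial_integrand, D_star; [exact Hr | lra].
Qed.

Lemma star_primitive_deriv (a b : C) (r : R) :
  D (a + RtoC r * b)%C ->
  curve_deriv (fun s => star_primitive f (a + RtoC s * b)%C) r
    (b * f (a + RtoC r * b))%C.
Proof.
  intros Hr. split.
  - eapply is_derive_eq; [exact (star_form_deriv 1 a b r Hr)|].
    rewrite Cmult_1_l. reflexivity.
  - eapply is_derive_eq; [exact (star_form_deriv (- Ci) a b r Hr)|].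
    set (w := (b * f (a + RtoC r * b))%C). simpl. ring.
Qed.

End StarPrimitive.

Lemma star_primitive_0 (f : C -> C) : star_primitive f 0 = 0%C.
Proof.
  unfold star_primitive, star_form. apply C_ext; simpl fst; simpl snd;
    (erewrite RInt_ext; [rewrite RInt_const; apply Rmult_0_r |]);
    intros x _; simpl; ring.
Qed.

(** * Continuity of the exponential, the inverse and the logarithm *)

Lemma Ccont_Cexp {U : UniformSpace} (f : U -> C) (z : U) :
  Ccont f z -> Ccont (fun x => Cexp (f x)) z.
Proof.
  intros [H1 H2]. split; simpl.
  - exact (continuous_mult _ _ z (continuous_comp _ exp z H1 (continuous_exp _))
                            (continuous_comp _ cos z H2 (continuous_cos _))).
  - exact (continuous_mult _ _ z (continuous_comp _ exp z H1 (continuous_exp _))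
                            (continuous_comp _ sin z H2 (continuous_sin _))).
Qed.

Lemma continuous_div {U : UniformSpace} (X Y : U -> R) (z : U) :
  continuous X z -> continuous Y z -> Y z <> 0 -> continuous (fun x => X x / Y x) z.
Proof.
  intros HX HY H0.
  exact (continuous_mult X (fun x => / Y x) z HX
           (continuous_comp Y Rinv z HY (continuous_Rinv _ H0))).
Qed.

Lemma continuous_sqr_norm {U : UniformSpace} (f : U -> C) (z : U) :
  Ccont f z -> continuous (fun x => fst (f x) ^ 2 + snd (f x) ^ 2) z.
Proof.
  intros [H1 H2].
  eapply continuous_ext;
    [|exact (continuous_plus _ _ z (continuous_mult _ _ z H1 H1)
                             (continuous_mult _ _ z H2 H2))].
  intros x. unfold plus, mult; simpl. ring.
Qed.

Lemma Ccont_inv {U : UniformSpace} (f : U -> C) (z : U) :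
  Ccont f z -> f z <> 0 -> Ccont (fun x => / f x)%C z.
Proof.
  intros Hf H0. pose proof (continuous_sqr_norm f z Hf) as Hn. destruct Hf as [H1 H2].
  assert (Hp : fst (f z) ^ 2 + snd (f z) ^ 2 <> 0).
  { intros E. apply H0, C_ext; simpl; nra. }
  split; simpl fst; simpl snd.
  - exact (continuous_div _ _ z H1 Hn Hp).
  - exact (continuous_div _ _ z (continuous_opp _ z H2) Hn Hp).
Qed.

Lemma slit_neq_0 (z : C) : slit z -> z <> 0%C.
Proof. intros H ->. destruct H as [H|H]; simpl in H; lra. Qed.

Lemma Ccont_Clog {U : UniformSpace} (f : U -> C) (z : U) :
  Ccont f z -> slit (f z) -> Ccont (fun x => Clog (f x)) z.
Proof.
  intros Hf Hs. pose proof (slit_Cmod_pos _ Hs) as Hm.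
  pose proof (continuous_sqr_norm f z Hf) as Hn.
  destruct Hf as [H1 H2].
  assert (Hq : forall k (X Y : U -> R), continuous X z -> continuous Y z -> Y z <> 0 ->
    continuous (fun x => k - atan (X x / Y x)) z).
  { intros k X Y HX HY H0.
    exact (continuous_minus (V := R_NormedModule) _ _ z (continuous_const k z)
      (continuous_comp _ atan z (continuous_div X Y z HX HY H0) (continuous_atan _))). }
  split; simpl fst; simpl snd.
  - unfold Cmod in *.
    exact (continuous_comp _ ln z
      (continuous_comp _ sqrt z Hn (continuous_sqrt _)) (continuous_ln _ Hm)).
  - destruct (Rlt_dec 0 (snd (f z))) as [Hy|Hy].
    { eapply continuous_ext_loc; [|apply (Hq (PI / 2) _ _ H1 H2); lra].
      eapply filter_imp; [|exact (H2 _ (open_gt 0 _ Hy))].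
      intros x Hx. symmetry. apply Carg_upper. exact Hx. }
    destruct (Rlt_dec (snd (f z)) 0) as [Hy'|Hy'].
    { eapply continuous_ext_loc; [|apply (Hq (- (PI / 2)) _ _ H1 H2); lra].
      eapply filter_imp; [|exact (H2 _ (open_lt 0 _ Hy'))].
      intros x Hx. symmetry. apply Carg_lower. exact Hx. }
    assert (Hx : 0 < fst (f z)) by (destruct Hs; lra).
    eapply continuous_ext_loc;
      [|exact (continuous_comp _ atan z
          (continuous_div _ _ z H2 H1 (Rgt_not_eq _ _ Hx)) (continuous_atan _))].
    eapply filter_imp; [|exact (H1 _ (open_gt 0 _ Hx))].
    intros x Hx'. symmetry. apply Carg_right. exact Hx'.
Qed.

(** * The phase and the integrand *)

Definition cut_plane (c : R) (z : C) : Prop :=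
  (fst z < 1 \/ snd z <> 0) /\ (-1 < c * fst z \/ snd z <> 0).

Lemma cut_plane_star (c : R) (z : C) (u : R) :
  cut_plane c z -> 0 <= u <= 1 -> cut_plane c (RtoC u * z).
Proof.
  intros [H1 H2] Hu. destruct z as [x y]. unfold cut_plane in *. simpl in *.
  replace (u * x - 0 * y) with (u * x) by ring.
  replace (u * y + 0 * x) with (u * y) by ring.
  destruct (Req_dec u 0) as [->|Hu0]; [split; left; lra|].
  split.
  - destruct H1 as [H1|H1]; [left; nra | right; apply Rmult_integral_contrapositive; tauto].
  - destruct H2 as [H2|H2]; [left; nra | right; apply Rmult_integral_contrapositive; tauto].
Qed.

Lemma cut_plane_open (c : R) : open (T := C_UniformSpace) (cut_plane c).
Proof.
  assert (O1 : open (T := C_UniformSpace) (fun z : C => snd z <> 0))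
    by (apply (open_comp (T := C_UniformSpace) (U := R_UniformSpace) snd (fun y => y <> 0));
        [intros z _; exact (proj2 (Ccont_id z)) | apply open_neq]).
  apply open_and; apply open_or; try exact O1.
  - apply (open_comp (T := C_UniformSpace) (U := R_UniformSpace) fst (fun y => y < 1));
      [intros z _; exact (proj1 (Ccont_id z)) | apply open_lt].
  - apply (open_comp (T := C_UniformSpace) (U := R_UniformSpace)
             (fun z : C => c * fst z) (fun y => -1 < y)); [|apply open_gt].
    intros z _. exact (continuous_mult (K := R_AbsRing) (U := C_UniformSpace)
      (fun _ => c) fst z (continuous_const _ _) (proj1 (Ccont_id z))).
Qed.

Lemma cut_plane_slit_minus (c : R) (z : C) : cut_plane c z -> slit (1 - z).
Proof.
  intros [H _]. unfold slit; simpl. destruct H; [left; lra | right; lra].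
Qed.

Lemma cut_plane_slit_plus (c : R) (z : C) :
  0 < c -> cut_plane c z -> slit (1 + RtoC c * z).
Proof.
  intros Hc [_ H]. unfold slit; simpl. destruct H as [H|H]; [left; lra | right].
  replace (0 + (c * snd z + 0 * fst z)) with (c * snd z) by ring.
  apply Rmult_integral_contrapositive; split; lra.
Qed.

Lemma cut_plane_upper (c : R) (z : C) : 0 < snd z -> cut_plane c z.
Proof. intros H; split; right; lra. Qed.

Lemma curve_deriv_1_minus (p : R -> C) (r : R) (l : C) :
  curve_deriv p r l -> curve_deriv (fun x => 1 - p x)%C r (- l)%C.
Proof.
  intros H. eapply curve_deriv_eq;
    [apply curve_deriv_minus; [apply curve_deriv_const | exact H] | ring].
Qed.

Lemma curve_deriv_1_plus (c : R) (p : R -> C) (r : R) (l : C) :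
  curve_deriv p r l -> curve_deriv (fun x => 1 + RtoC c * p x)%C r (RtoC c * l)%C.
Proof.
  intros H. eapply curve_deriv_eq;
    [apply curve_deriv_plus; [apply curve_deriv_const | apply curve_deriv_scal, H] | ring].
Qed.

Definition log_sum (c L : R) (z : C) : C :=
  (RtoC L + Clog (1 + RtoC c * z) - Clog (1 - z))%C.

Definition h_deriv (c L : R) (z : C) : C := (RtoC (c / (1 + c)) * log_sum c L z)%C.

Lemma RtoC_neq_0 (x : R) : x <> 0 -> RtoC x <> 0%C.
Proof. intros H E. apply H. exact (RtoC_inj _ _ E). Qed.

(** The rational terms cancel, c z (c / (1 + c z) + 1 / (1 - z)) + c / (1 + c z) - c / (1 - z) being
    c - c, so only logarithms survive. In particular the derivative at 0 is c L / (1 + c), and 0 is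
    a stationary point exactly when L = 0. *)
Lemma h_fun_deriv (c Lam : R) :
  0 < c -> curve_differentiable (cut_plane c) (h_fun c Lam) (h_deriv c (ln (1 + Lam))).
Proof.
  intros Hc p r l HD Hp.
  pose proof (cut_plane_slit_minus c _ HD) as S1.
  pose proof (cut_plane_slit_plus c _ Hc HD) as S2.
  pose proof (slit_neq_0 _ S1) as N1. pose proof (slit_neq_0 _ S2) as N2.
  pose proof (curve_deriv_Clog _ _ _ S1 (curve_deriv_1_minus _ _ _ Hp)) as D1.
  pose proof (curve_deriv_Clog _ _ _ S2 (curve_deriv_1_plus c _ _ _ Hp)) as D2.
  assert (N3 : RtoC (1 + c) <> 0%C) by (apply RtoC_neq_0; lra).
  apply curve_deriv_ext with (fun x => / RtoC (1 + c) * f1 c Lam (p x))%C;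
    [intros x; unfold h_fun, Cdiv; ring|].
  eapply curve_deriv_eq.
  - apply curve_deriv_scal. unfold f1.
    apply curve_deriv_plus; [apply curve_deriv_plus|].
    + apply curve_deriv_mult; [apply curve_deriv_scal, Hp|].
      apply curve_deriv_minus; [apply curve_deriv_plus; [apply curve_deriv_const|]|].
      * exact D2.
      * exact D1.
    + exact D2.
    + apply curve_deriv_scal, D1.
  - cbv beta. unfold h_deriv, log_sum. rewrite RtoC_div by lra. field.
    repeat split; assumption.
Qed.

Definition integrand (sigma c t Lam : R) (z : C) : C :=
  (g_fun sigma c z * Cexp (Ci * RtoC t * h_fun c Lam z))%C.

Definition amplitude_log (sigma c : R) (z : C) : C :=
  (RtoC (- (1 / 2)) * Clog (1 - z) + RtoC (sigma - 1 / 2) * Clog (1 + RtoC c * z))%C.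

Definition exponent (sigma c t Lam : R) (z : C) : C :=
  (amplitude_log sigma c z + Ci * RtoC t * h_fun c Lam z)%C.

Lemma integrand_exponent (sigma c t Lam : R) (z : C) :
  integrand sigma c t Lam z = Cexp (exponent sigma c t Lam z).
Proof.
  unfold integrand, exponent, amplitude_log, g_fun, Defs.Cpow. rewrite !Cexp_plus. reflexivity.
Qed.

Definition exponent_deriv (sigma c t L : R) (z : C) : C :=
  (RtoC (1 / 2) * / (1 - z) + RtoC ((sigma - 1 / 2) * c) * / (1 + RtoC c * z)
   + Ci * RtoC t * h_deriv c L z)%C.

Lemma integrand_deriv (sigma c t Lam : R) :
  0 < c ->
  curve_differentiable (cut_plane c) (integrand sigma c t Lam)
    (fun z => exponent_deriv sigma c t (ln (1 + Lam)) z * integrand sigma c t Lam z)%C.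
Proof.
  intros Hc p r l HD Hp.
  pose proof (cut_plane_slit_minus c _ HD) as S1.
  pose proof (cut_plane_slit_plus c _ Hc HD) as S2.
  pose proof (slit_neq_0 _ S1) as N1. pose proof (slit_neq_0 _ S2) as N2.
  pose proof (curve_deriv_Clog _ _ _ S1 (curve_deriv_1_minus _ _ _ Hp)) as D1.
  pose proof (curve_deriv_Clog _ _ _ S2 (curve_deriv_1_plus c _ _ _ Hp)) as D2.
  apply curve_deriv_ext with (fun x => Cexp (exponent sigma c t Lam (p x)));
    [intros x; symmetry; apply integrand_exponent|].
  rewrite integrand_exponent.
  eapply curve_deriv_eq.
  - apply curve_deriv_Cexp. unfold exponent, amplitude_log.
    apply curve_deriv_plus; [apply curve_deriv_plus|].
    + apply curve_deriv_scal, D1.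
    + apply curve_deriv_scal, D2.
    + apply curve_deriv_scal, (h_fun_deriv c Lam Hc p r l HD Hp).
  - cbv beta. unfold exponent_deriv. rewrite RtoC_opp, RtoC_mult. field.
    repeat split; assumption.
Qed.

Lemma Ccont_minus {U : UniformSpace} (f g : U -> C) (z : U) :
  Ccont f z -> Ccont g z -> Ccont (fun x => f x - g x)%C z.
Proof.
  intros [H1 H2] [H3 H4]; split; simpl.
  - exact (continuous_minus _ _ z H1 H3).
  - exact (continuous_minus _ _ z H2 H4).
Qed.

Lemma Ccont_1_minus (z : C) : Ccont (U := C_UniformSpace) (fun z => 1 - z)%C z.
Proof. apply (Ccont_minus (U := C_UniformSpace)); [apply Ccont_const | apply Ccont_id]. Qed.

Lemma Ccont_1_plus (c : R) (z : C) :
  Ccont (U := C_UniformSpace) (fun z => 1 + RtoC c * z)%C z.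
Proof.
  apply (Ccont_plus (U := C_UniformSpace)); [apply Ccont_const|].
  apply (Ccont_mult (U := C_UniformSpace)); [apply Ccont_const | apply Ccont_id].
Qed.

Lemma integrand_cont (sigma c t Lam : R) (z : C) :
  0 < c -> cut_plane c z -> Ccont (U := C_UniformSpace) (integrand sigma c t Lam) z.
Proof.
  intros Hc HD.
  assert (C1 : Ccont (U := C_UniformSpace) (fun z => Clog (1 - z)) z)
    by (apply Ccont_Clog; [apply Ccont_1_minus | exact (cut_plane_slit_minus c z HD)]).
  assert (C2 : Ccont (U := C_UniformSpace) (fun z => Clog (1 + RtoC c * z)) z)
    by (apply Ccont_Clog; [apply Ccont_1_plus | exact (cut_plane_slit_plus c z Hc HD)]).
  unfold integrand, g_fun, h_fun, f1, Defs.Cpow, Cdiv.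
  repeat match goal with
  | |- Ccont (fun x => Clog _) _ => first [exact C1 | exact C2]
  | |- Ccont (Cmult ?k) _ => apply (Ccont_mult (U := C_UniformSpace) (fun _ => k) (fun x => x))
  | |- Ccont (fun x => Cexp _) _ => apply (Ccont_Cexp (U := C_UniformSpace))
  | |- Ccont (fun x => _ * _)%C _ => apply (Ccont_mult (U := C_UniformSpace))
  | |- Ccont (fun x => _ + _)%C _ => apply (Ccont_plus (U := C_UniformSpace))
  | |- Ccont (fun x => _ - _)%C _ => apply (Ccont_minus (U := C_UniformSpace))
  | |- Ccont (fun x => x) _ => apply Ccont_id
  | |- _ => apply Ccont_const
  end.
Qed.

Lemma exponent_deriv_cont (sigma c t L : R) (z : C) :
  0 < c -> cut_plane c z -> Ccont (U := C_UniformSpace) (exponent_deriv sigma c t L) z.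
Proof.
  intros Hc HD.
  pose proof (cut_plane_slit_minus c z HD) as S1.
  pose proof (cut_plane_slit_plus c z Hc HD) as S2.
  assert (C1 : Ccont (U := C_UniformSpace) (fun z => Clog (1 - z)) z)
    by (apply Ccont_Clog; [apply Ccont_1_minus | exact S1]).
  assert (C2 : Ccont (U := C_UniformSpace) (fun z => Clog (1 + RtoC c * z)) z)
    by (apply Ccont_Clog; [apply Ccont_1_plus | exact S2]).
  assert (C3 : Ccont (U := C_UniformSpace) (fun z => / (1 - z))%C z)
    by (apply Ccont_inv; [apply Ccont_1_minus | exact (slit_neq_0 _ S1)]).
  assert (C4 : Ccont (U := C_UniformSpace) (fun z => / (1 + RtoC c * z))%C z)
    by (apply Ccont_inv; [apply Ccont_1_plus | exact (slit_neq_0 _ S2)]).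
  unfold exponent_deriv, h_deriv, log_sum.
  repeat match goal with
  | |- Ccont (fun x => Clog _) _ => first [exact C1 | exact C2]
  | |- Ccont (Cmult ?k) _ => apply (Ccont_mult (U := C_UniformSpace) (fun _ => k) (fun x => x))
  | |- Ccont (fun x => / _)%C _ => first [exact C3 | exact C4 | apply Ccont_const]
  | |- Ccont (fun x => _ * _)%C _ => apply (Ccont_mult (U := C_UniformSpace))
  | |- Ccont (fun x => _ + _)%C _ => apply (Ccont_plus (U := C_UniformSpace))
  | |- Ccont (fun x => _ - _)%C _ => apply (Ccont_minus (U := C_UniformSpace))
  | |- Ccont (fun x => x) _ => apply Ccont_id
  | |- _ => apply Ccont_const
  end.
Qed.

Lemma integrand_primitive (sigma c t Lam : R) (a b : C) (r : R) :
  0 < c -> cut_plane c (a + RtoC r * b) ->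
  curve_deriv (fun s => star_primitive (integrand sigma c t Lam) (a + RtoC s * b)%C) r
    (b * integrand sigma c t Lam (a + RtoC r * b))%C.
Proof.
  intros Hc HD.
  apply (star_primitive_deriv (cut_plane c) _
    (fun z => exponent_deriv sigma c t (ln (1 + Lam)) z * integrand sigma c t Lam z)%C).
  - intros z u Hz Hu. apply cut_plane_star; assumption.
  - apply cut_plane_open.
  - apply integrand_deriv, Hc.
  - intros z Hz. apply integrand_cont; assumption.
  - intros z Hz. apply (Ccont_mult (U := C_UniformSpace));
      [apply exponent_deriv_cont | apply integrand_cont]; assumption.
  - exact HD.
Qed.

(** * Lower bounds for the imaginary part of the phase *)

Lemma atan_le (x y : R) : x <= y -> atan x <= atan y.
Proof. intros [H| ->]; [left; apply atan_increasing; exact H | right; reflexivity]. Qed.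

Lemma atan_le_id (u : R) : 0 <= u -> atan u <= u.
Proof.
  intros Hu.
  pose proof (is_derive_le_increment atan (fun x => x) (fun x => / (1 + Rsqr x))
    (fun _ => 1) 0 u Hu) as H.
  rewrite atan_0 in H. enough (atan u - 0 <= u - 0) by lra. apply H.
  - intros x _. apply is_derive_atan.
  - intros x _. exact (is_derive_id (K := R_AbsRing) x).
  - intros x _. rewrite <- Rinv_1. apply Rinv_le_contravar; [lra|].
    unfold Rsqr. nra.
Qed.

Lemma atan_ge_half (u : R) : 0 <= u <= 1 -> u / 2 <= atan u.
Proof.
  intros Hu.
  pose proof (is_derive_le_increment (fun x => x / 2) atan (fun _ => / 2)
    (fun x => / (1 + Rsqr x)) 0 u (proj1 Hu)) as H.
  cbv beta in H. rewrite atan_0 in H. enough (u / 2 - 0 / 2 <= atan u - 0) by lra.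
  apply H.
  - intros x _. auto_derive; [exact I | lra].
  - intros x _. apply is_derive_atan.
  - intros x Hx. apply Rinv_le_contravar; unfold Rsqr; nra.
Qed.

(** Since Im (h' l) = Re h' dY + Im h' dX, vertical motion sees only the moduli of 1 + c z and 1 -
    z, and horizontal motion only their arguments. The choice of horizontal and vertical segments
    below rests on this separation. *)
Lemma im_h_deriv (c Lam : R) (X Y : R -> R) (r dX dY : R) :
  0 < c -> is_derive X r dX -> is_derive Y r dY -> cut_plane c (X r, Y r) ->
  is_derive (fun s => snd (h_fun c Lam (X s, Y s))) r
    (c / (1 + c) * ((ln (1 + Lam) + ln (Cmod (1 + RtoC c * (X r, Y r)))
                     - ln (Cmod (1 - (X r, Y r)))) * dY
       + (Carg (1 + RtoC c * (X r, Y r)) - Carg (1 - (X r, Y r))) * dX)).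
Proof.
  intros Hc HX HY HD.
  assert (Hp : curve_deriv (fun s => (X s, Y s)) r (dX, dY)) by (split; assumption).
  eapply is_derive_eq; [exact (proj2 (h_fun_deriv c Lam Hc _ r _ HD Hp))|].
  unfold h_deriv, log_sum, Clog. simpl. ring.
Qed.

Lemma Clog_1 : Clog 1 = 0%C.
Proof.
  apply C_ext; simpl; [rewrite Cmod_1; apply ln_1|].
  rewrite Carg_right by (simpl; lra). simpl. rewrite Rdiv_0_l. apply atan_0.
Qed.

Lemma h_fun_0 (c Lam : R) : h_fun c Lam 0 = 0%C.
Proof.
  unfold h_fun, f1, Cdiv.
  replace (1 + RtoC c * 0)%C with (RtoC 1) by ring.
  replace (1 - 0)%C with (RtoC 1) by ring. rewrite Clog_1. ring.
Qed.

Lemma ln_nonneg (x : R) : 1 <= x -> 0 <= ln x.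
Proof. intros H. rewrite <- ln_1. apply ln_le; lra. Qed.

Lemma ln_nonpos (x : R) : 0 < x -> x <= 1 -> ln x <= 0.
Proof. intros H0 H. rewrite <- ln_1. apply ln_le; lra. Qed.

Lemma Cmod_1_plus_ge (c x y : R) :
  0 < c -> 0 <= x -> 1 <= Cmod (1 + RtoC c * (x, y)).
Proof.
  intros Hc Hx. apply Cmod_ge_sqr; [lra|]. simpl.
  assert (0 <= c * x) by nra. nra.
Qed.

Lemma Carg_1_plus_ge (c x y : R) :
  0 < c -> 0 <= x -> 0 <= y -> 0 <= Carg (1 + RtoC c * (x, y)).
Proof.
  intros Hc Hx Hy. assert (0 <= c * x) by nra. assert (0 <= c * y) by nra.
  rewrite Carg_right; simpl; [|lra].
  pose proof (atan_le 0 ((0 + (c * y + 0 * x)) / (1 + (c * x - 0 * y)))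
    ltac:(apply Rdiv_le_0_compat; lra)) as H1.
  rewrite atan_0 in H1 at 1. exact H1.
Qed.

Lemma Carg_1_minus_upper (x y : R) :
  0 < y -> - Carg (1 - (x, y)) = PI / 2 + atan ((x - 1) / y).
Proof.
  intros Hy. rewrite Carg_lower by (simpl; lra). simpl.
  replace ((1 + - x) / (0 + - y)) with ((x - 1) / y) by (field; lra). ring.
Qed.

(** For s <= 1/2 every term of the derivative has a favourable sign: |1 + c z| >= 1, |1 - z| <= 1
    and arg (1 + c z) >= 0. The remaining one, - arg (1 - z) = atan (s / (1 - s)) >= s / 2, supplies
    the quadratic gain. *)
Lemma im_h_diagonal (c Lam x : R) :
  0 < c -> 0 <= Lam -> 0 <= x <= 1 / 2 ->
  c / (1 + c) * (ln (1 + Lam) * x + x * x / 4) <= snd (h_fun c Lam (x, x)).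
Proof.
  intros Hc HL Hx. set (L := ln (1 + Lam)).
  assert (Hk : 0 < c / (1 + c)) by (apply Rdiv_lt_0_compat; lra).
  pose proof (is_derive_le_increment
    (fun s => c / (1 + c) * (L * s + s * s / 4)) (fun s => snd (h_fun c Lam (s, s)))
    (fun s => c / (1 + c) * (L + s / 2))
    (fun s => c / (1 + c) * ((L + ln (Cmod (1 + RtoC c * (s, s)))
                     - ln (Cmod (1 - (s, s)))) * 1
       + (Carg (1 + RtoC c * (s, s)) - Carg (1 - (s, s))) * 1)) 0 x (proj1 Hx)) as H.
  cbv beta in H.
  change (0, 0) with (RtoC 0) in H. rewrite h_fun_0 in H. simpl snd in H.
  enough (c / (1 + c) * (L * x + x * x / 4) - c / (1 + c) * (L * 0 + 0 * 0 / 4)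
          <= snd (h_fun c Lam (x, x)) - 0) by lra.
  apply H.
  - intros s _. auto_derive; [exact I|]. field. lra.
  - intros s Hs. pose proof (is_derive_id (K := R_AbsRing) s : is_derive (fun s => s) s 1) as D.
    apply (im_h_deriv c Lam (fun s => s) (fun s => s)); try assumption.
    split; left; simpl; nra.
  - intros s Hs. apply Rmult_le_compat_l; [lra|].
    assert (A1 : 0 <= ln (Cmod (1 + RtoC c * (s, s))))
      by (apply ln_nonneg, Cmod_1_plus_ge; lra).
    assert (A2 : ln (Cmod (1 - (s, s))) <= 0).
    { apply ln_nonpos; [apply slit_Cmod_pos; left; simpl; lra|].
      apply Cmod_le_sqr; simpl; nra. }
    assert (A3 : 0 <= Carg (1 + RtoC c * (s, s))) by (apply Carg_1_plus_ge; lra).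
    assert (A4 : s / 2 <= - Carg (1 - (s, s))).
    { rewrite Carg_right by (simpl; lra). simpl. rewrite <- atan_opp.
      replace (- ((0 + - s) / (1 + - s))) with (s / (1 - s)) by (field; lra).
      eapply Rle_trans; [apply atan_ge_half; lra|]. apply atan_le.
      apply Rmult_le_reg_r with (1 - s); [lra|].
      replace (s / (1 - s) * (1 - s)) with s by (field; lra). nra. }
    lra.
Qed.

Lemma im_h_horizontal_increment (c Lam k x0 x : R) :
  0 < c -> 0 <= x0 -> x0 <= x ->
  (forall s, x0 <= s <= x -> k <= PI / 2 + atan ((s - 1) / (1 / 2))) ->
  c / (1 + c) * k * (x - x0)
  <= snd (h_fun c Lam (x, 1 / 2)) - snd (h_fun c Lam (x0, 1 / 2)).
Proof.
  intros Hc H0 Hx Hk.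
  assert (Hc1 : 0 < c / (1 + c)) by (apply Rdiv_lt_0_compat; lra).
  replace (c / (1 + c) * k * (x - x0))
    with (c / (1 + c) * k * x - c / (1 + c) * k * x0) by ring.
  apply (is_derive_le_increment
    (fun s => c / (1 + c) * k * s) (fun s => snd (h_fun c Lam (s, 1 / 2)))
    (fun s => c / (1 + c) * k)
    (fun s => c / (1 + c) * ((ln (1 + Lam) + ln (Cmod (1 + RtoC c * (s, 1 / 2)))
                     - ln (Cmod (1 - (s, 1 / 2)))) * 0
       + (Carg (1 + RtoC c * (s, 1 / 2)) - Carg (1 - (s, 1 / 2))) * 1))); [exact Hx| | |].
  - intros s _. auto_derive; [exact I | ring].
  - intros s Hs. apply (im_h_deriv c Lam (fun s => s) (fun _ => 1 / 2)); [exact Hc| | |].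
    + exact (is_derive_id (K := R_AbsRing) s).
    + apply (is_derive_const (K := R_AbsRing) (V := R_NormedModule)).
    + apply cut_plane_upper. simpl. lra.
  - intros s Hs. apply Rmult_le_compat_l; [lra|].
    assert (A3 : 0 <= Carg (1 + RtoC c * (s, 1 / 2))) by (apply Carg_1_plus_ge; lra).
    pose proof (Carg_1_minus_upper s (1 / 2) ltac:(lra)). specialize (Hk s Hs). lra.
Qed.

(** The value at (1 + i)/2 comes from the diagonal, with 1/16 = (1/2)^2 / 4. To its right - arg (1 -
    z) is at least pi/2 - pi/4, which exceeds 3/4. *)
Lemma im_h_horizontal (c Lam x : R) :
  0 < c -> 0 <= Lam -> 1 / 2 <= x ->
  c / (1 + c) * (ln (1 + Lam) / 2 + 1 / 16 + 3 / 4 * (x - 1 / 2))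
  <= snd (h_fun c Lam (x, 1 / 2)).
Proof.
  intros Hc HL Hx.
  pose proof (im_h_diagonal c Lam (1 / 2) Hc HL ltac:(lra)) as H1.
  pose proof (im_h_horizontal_increment c Lam (3 / 4) (1 / 2) x Hc ltac:(lra) Hx) as H2.
  enough (c / (1 + c) * (3 / 4) * (x - 1 / 2)
    <= snd (h_fun c Lam (x, 1 / 2)) - snd (h_fun c Lam (1 / 2, 1 / 2))) by lra.
  apply H2. intros s Hs.
  assert (- (PI / 4) <= atan ((s - 1) / (1 / 2))).
  { rewrite <- atan_1, <- atan_opp. apply atan_le. lra. }
  pose proof PI2_3_2. lra.
Qed.

Lemma im_h_horizontal_far (c Lam eta : R) :
  0 < c -> 0 < eta ->
  exists x0 B, 1 <= x0 /\ forall x, x0 <= x ->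
    c / (1 + c) * (PI - eta) * x - B <= snd (h_fun c Lam (x, 1 / 2)).
Proof.
  intros Hc He. pose proof (Rinv_0_lt_compat _ He) as Hi.
  (* Beyond 1 + 1/eta the argument u = 2 (s - 1) of the arctangent satisfies 1/u <= eta, and atan u
     = pi/2 - atan (1/u) >= pi/2 - eta. The constant B absorbs the value at the threshold. *)
  exists (1 + / eta),
    (c / (1 + c) * (PI - eta) * (1 + / eta) - snd (h_fun c Lam (1 + / eta, 1 / 2))).
  split; [lra|]. intros x Hx.
  pose proof (im_h_horizontal_increment c Lam (PI - eta) (1 + / eta) x Hc ltac:(lra) Hx) as H.
  assert (H' : forall s, 1 + / eta <= s <= x ->
    PI - eta <= PI / 2 + atan ((s - 1) / (1 / 2))).
  { intros s Hs.
    assert (Hu : 0 < (s - 1) / (1 / 2)) by lra.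
    pose proof (atan_inv _ Hu) as E.
    pose proof (atan_le_id (/ ((s - 1) / (1 / 2)))) as A.
    pose proof (Rinv_0_lt_compat _ Hu).
    assert (/ ((s - 1) / (1 / 2)) <= eta).
    { rewrite <- (Rinv_inv eta). apply Rinv_le_contravar; lra. }
    lra. }
  specialize (H H'). lra.
Qed.

(** For x >= 1 one has 1 + c x >= c (x - 1) >= 0, hence |1 + c z| >= c |1 - z|. So the vertical rate
    is at least c / (1 + c) times ln (1 + Lam) + ln c, which is the logarithm of lambda = c (1 +
    Lam). *)
Lemma im_h_vertical (c Lam x y : R) :
  0 < c -> 1 <= x -> 1 / 2 <= y ->
  c / (1 + c) * (ln (1 + Lam) + ln c) * (y - 1 / 2)
  <= snd (h_fun c Lam (x, y)) - snd (h_fun c Lam (x, 1 / 2)).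
Proof.
  intros Hc Hx Hy.
  assert (Hc1 : 0 < c / (1 + c)) by (apply Rdiv_lt_0_compat; lra).
  set (k := c / (1 + c) * (ln (1 + Lam) + ln c)).
  replace (k * (y - 1 / 2)) with (k * y - k * (1 / 2)) by ring.
  apply (is_derive_le_increment
    (fun s => k * s) (fun s => snd (h_fun c Lam (x, s)))
    (fun s => k)
    (fun s => c / (1 + c) * ((ln (1 + Lam) + ln (Cmod (1 + RtoC c * (x, s)))
                     - ln (Cmod (1 - (x, s)))) * 1
       + (Carg (1 + RtoC c * (x, s)) - Carg (1 - (x, s))) * 0))); [exact Hy| | |].
  - intros s _. auto_derive; [exact I | ring].
  - intros s Hs. apply (im_h_deriv c Lam (fun _ => x) (fun s => s)); [exact Hc| | |].
    + apply (is_derive_const (K := R_AbsRing) (V := R_NormedModule)).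
    + exact (is_derive_id (K := R_AbsRing) s).
    + apply cut_plane_upper. simpl. lra.
  - intros s Hs. apply Rmult_le_compat_l; [lra|].
    enough (ln c + ln (Cmod (1 - (x, s))) <= ln (Cmod (1 + RtoC c * (x, s)))) by lra.
    assert (0 < Cmod (1 - (x, s))) by (apply slit_Cmod_pos; right; simpl; lra).
    rewrite <- ln_mult by assumption. apply ln_le; [nra|].
    apply Cmod_ge_sqr; [nra|].
    replace (c * Cmod (1 - (x, s)) * (c * Cmod (1 - (x, s))))
      with (c * c * (Cmod (1 - (x, s)) * Cmod (1 - (x, s)))) by ring.
    rewrite Cmod_sqr. simpl. nra.
Qed.

(** Go horizontally at height 1/2, then vertically. The first leg gains almost pi x, the second
    loses at most |ln lambda| x tan phi, and admissibility reads tan phi < pi / |ln lambda|. *)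
Lemma im_h_sector (c Lam phi : R) :
  0 < c -> 0 <= Lam -> adm_phi (c * (1 + Lam)) phi ->
  exists A B x0, 0 < A /\ 1 <= x0 /\ forall x y, x0 <= x -> 1 / 2 <= y <= x * tan phi ->
    A * x - B <= snd (h_fun c Lam (x, y)).
Proof.
  intros Hc HL [Hphi [Hpos Hneg]].
  assert (Hc1 : 0 < c / (1 + c)) by (apply Rdiv_lt_0_compat; lra).
  set (k := c / (1 + c)) in *.
  assert (El : ln (c * (1 + Lam)) = ln (1 + Lam) + ln c) by (rewrite ln_mult; lra).
  set (l := ln (c * (1 + Lam))) in *.
  pose proof PI_RGT_0 as HPI.
  destruct (Rle_dec 0 l) as [Hl|Hl].
  (* When ln lambda >= 0 the vertical leg loses nothing, so a fixed loss of 1 out of pi is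
     harmless. *)
  - destruct (im_h_horizontal_far c Lam 1 Hc Rlt_0_1) as [x0 [B [Hx0 H]]].
    exists (k * (PI - 1)), B, x0. pose proof PI2_3_2.
    split; [apply Rmult_lt_0_compat; lra|]. split; [exact Hx0|].
    intros x y Hx Hy. specialize (H x Hx).
    pose proof (im_h_vertical c Lam x y Hc ltac:(lra) (proj1 Hy)) as V.
    fold k in H, V. rewrite <- El in V.
    assert (0 <= k * l * (y - 1 / 2)) by (apply Rmult_le_pos; [apply Rmult_le_pos|]; lra).
    lra.
  - assert (Hl' : l < 0) by lra. specialize (Hneg Hl').
    rewrite Rabs_left in Hneg by exact Hl'.
    assert (Ht : 0 < tan phi < PI / - l).
    { assert (P2 : phi < PI / 2) by (pose proof (atan_bound (PI / - l)); lra).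
      split; [apply tan_gt_0; assumption|].
      rewrite <- (tan_atan (PI / - l)). pose proof (atan_bound (PI / - l)).
      apply tan_increasing; lra. }
    assert (Hm : 0 < PI + l * tan phi).
    { destruct Ht as [_ Ht]. apply Rmult_lt_compat_l with (r := - l) in Ht; [|lra].
      replace (- l * (PI / - l)) with PI in Ht by (field; lra). lra. }
    (* Half of the surplus is spent on the arctangent and the other half remains as the growth
       rate. *)
    set (eta := (PI + l * tan phi) / 2).
    destruct (im_h_horizontal_far c Lam eta Hc) as [x0 [B [Hx0 H]]];
      [unfold eta; lra|].
    exists (k * eta), B, x0.
    split; [apply Rmult_lt_0_compat; unfold eta; lra|]. split; [exact Hx0|].
    intros x y Hx Hy. specialize (H x Hx).
    pose proof (im_h_vertical c Lam x y Hc ltac:(lra) (proj1 Hy)) as V.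
    fold k in H, V. rewrite <- El in V.
    assert (k * (l * (x * tan phi)) <= k * l * (y - 1 / 2)).
    { rewrite Rmult_assoc. apply Rmult_le_compat_l; [lra|].
      apply Ropp_le_cancel. rewrite <- !Ropp_mult_distr_l_reverse.
      apply Rmult_le_compat_l; lra. }
    assert (E : k * eta * x = k * (PI - eta) * x + k * (l * (x * tan phi)))
      by (unfold eta; field).
    lra.
Qed.

(** * Rotation of the ray onto a horizontal half-line *)

Lemma fst_exponent (sigma c t Lam : R) (z : C) :
  fst (exponent sigma c t Lam z)
  = - (1 / 2) * ln (Cmod (1 - z)) + (sigma - 1 / 2) * ln (Cmod (1 + RtoC c * z))
    - t * snd (h_fun c Lam z).
Proof. unfold exponent, amplitude_log, Clog. simpl. ring. Qed.

Lemma Cmod_integrand (sigma c t Lam : R) (z : C) :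
  Cmod (integrand sigma c t Lam z) = exp (fst (exponent sigma c t Lam z)).
Proof. rewrite integrand_exponent. apply Cmod_Cexp. Qed.

Lemma exp_mono (x y : R) : x <= y -> exp x <= exp y.
Proof. intros [H| ->]; [left; apply exp_increasing; exact H | right; reflexivity]. Qed.

(** The tangent line of ln at 1 / eps. It lets the growth of the factor (1 + c z)^(sigma - 1/2) be
    absorbed at an arbitrarily small linear rate. *)
Lemma ln_le_linear (eps y : R) : 0 < eps -> 0 < y -> ln y <= eps * y - 1 - ln eps.
Proof.
  intros He Hy.
  assert (E : ln (eps * y) = ln eps + ln y) by (apply ln_mult; assumption).
  assert (Hp : 0 < eps * y) by nra.
  pose proof (exp_ineq1_le (ln (eps * y))) as H.
  rewrite (exp_ln _ Hp) in H. lra.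
Qed.

Lemma Cmod_1_plus_le (c x y : R) :
  0 < c -> 0 <= x -> 0 <= y -> Cmod (1 + RtoC c * (x, y)) <= 1 + c * x + c * y.
Proof.
  intros Hc Hx Hy. assert (0 <= c * x) by nra. assert (0 <= c * y) by nra.
  apply Cmod_le_sqr; simpl; [lra|]. nra.
Qed.

Lemma neg_ln_Cmod_1_minus (x y : R) :
  1 / 2 <= y -> - ln (Cmod (1 - (x, y))) <= 1.
Proof.
  intros Hy.
  assert (H : 1 / 2 <= Cmod (1 - (x, y))) by (eapply Rle_trans; [|apply snd_le_Cmod]; simpl;
        rewrite <- Rabs_Ropp, Rabs_pos_eq; lra).
  assert (H2 : ln (1 / 2) <= ln (Cmod (1 - (x, y)))) by (apply ln_le; lra).
  replace (1 / 2) with (/ 2) in H2 by lra. rewrite ln_Rinv in H2 by lra.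
  pose proof (ln_le_linear 1 2 Rlt_0_1 ltac:(lra)) as L. rewrite ln_1 in L. lra.
Qed.

(** The height 1/2 keeps the sector away from the singularity at 1. The constants depend on [phi]
    and [Lam], which is harmless because they only justify the change of contour. *)
Lemma integrand_sector_decay (sigma c t Lam phi : R) :
  1 / 2 <= sigma < 1 -> 0 < c -> 0 < t -> 0 <= Lam -> 0 < phi < PI / 2 ->
  adm_phi (c * (1 + Lam)) phi ->
  exists M a x0, 0 < a /\ 1 <= x0 /\ forall x y, x0 <= x -> 1 / 2 <= y <= x * tan phi ->
    Cmod (integrand sigma c t Lam (x, y)) <= M * exp (- a * x).
Proof.
  intros Hs Hc Ht HL Hphi Hadm.
  destruct (im_h_sector c Lam phi Hc HL Hadm) as [A [B [x0 [HA [Hx0 H]]]]].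
  pose proof (tan_gt_0 phi (proj1 Hphi) (proj2 Hphi)) as Htan.
  assert (HtA : 0 < t * A) by (apply Rmult_lt_0_compat; assumption).
  (* Chosen so that eps c x (1 + tan phi) is exactly half of the available decay t A x. *)
  set (eps := t * A / (2 * (c * (1 + tan phi)))).
  assert (Hden : 0 < c * (1 + tan phi)) by (apply Rmult_lt_0_compat; lra).
  assert (Heps : 0 < eps) by (apply Rdiv_lt_0_compat; lra).
  exists (exp (1 / 2 + (eps - 1 - ln eps) + t * B)), (t * A / 2), x0.
  split; [lra|]. split; [exact Hx0|]. intros x y Hx Hy. specialize (H x y Hx Hy).
  rewrite Cmod_integrand, fst_exponent, <- exp_plus. apply exp_mono.
  pose proof (neg_ln_Cmod_1_minus x y (proj1 Hy)) as H1.
  pose proof (Cmod_1_plus_ge c x y Hc ltac:(lra)) as H2.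
  pose proof (Cmod_1_plus_le c x y Hc ltac:(lra) ltac:(lra)) as H3.
  pose proof (ln_nonneg _ H2) as H4.
  pose proof (ln_le_linear eps _ Heps (Rlt_le_trans _ _ _ Rlt_0_1 H2)) as H5.
  assert (H6 : (sigma - 1 / 2) * ln (Cmod (1 + RtoC c * (x, y)))
               <= ln (Cmod (1 + RtoC c * (x, y)))) by nra.
  assert (H7 : eps * Cmod (1 + RtoC c * (x, y)) <= eps + t * A / 2 * x).
  { apply Rle_trans with (eps * (1 + c * x * (1 + tan phi))).
    - apply Rmult_le_compat_l; [lra|]. nra.
    - right. unfold eps. field. split; lra. }
  assert (H8 : t * (A * x - B) <= t * snd (h_fun c Lam (x, y)))
    by (apply Rmult_le_compat_l; lra).
  lra.
Qed.

Lemma primitive_horizontal (sigma c t Lam x : R) :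
  0 < c ->
  curve_deriv (fun s => star_primitive (integrand sigma c t Lam) (s, 1 / 2)) x
    (integrand sigma c t Lam (x, 1 / 2)).
Proof.
  intros Hc.
  assert (E : forall s, Cplus (0, 1 / 2) (RtoC s * 1)%C = (s, 1 / 2))
    by (intros s; apply C_ext; simpl; ring).
  apply (curve_deriv_ext
    (fun s => star_primitive (integrand sigma c t Lam) (Cplus (0, 1 / 2) (RtoC s * 1)%C)));
    [intros s; rewrite E; reflexivity|].
  eapply curve_deriv_eq.
  - apply integrand_primitive; [exact Hc|]. rewrite E. apply cut_plane_upper. simpl. lra.
  - rewrite E. ring.
Qed.

Lemma primitive_vertical (sigma c t Lam x y : R) :
  0 < c -> 0 < y ->
  curve_deriv (fun s => star_primitive (integrand sigma c t Lam) (x, s)) y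
    (Ci * integrand sigma c t Lam (x, y))%C.
Proof.
  intros Hc Hy.
  assert (E : forall s, (RtoC x + RtoC s * Ci)%C = (x, s))
    by (intros s; apply C_ext; simpl; ring).
  apply (curve_deriv_ext
    (fun s => star_primitive (integrand sigma c t Lam) (RtoC x + RtoC s * Ci)%C));
    [intros s; rewrite E; reflexivity|].
  eapply curve_deriv_eq.
  - apply integrand_primitive; [exact Hc|]. rewrite E. apply cut_plane_upper. exact Hy.
  - rewrite E. reflexivity.
Qed.

(** At abscissa x the half-line and the ray are joined by a vertical segment of length at most x tan
    phi on which the integrand is O(exp (- a x)). The increment of the primitive across it tends to
    0, so both limits agree. *)
Lemma primitive_ray_lim (sigma c t Lam phi : R) :
  1 / 2 <= sigma < 1 -> 0 < c -> 0 < t -> 0 <= Lam -> 0 < phi < PI / 2 ->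
  adm_phi (c * (1 + Lam)) phi ->
  exists l,
    curve_lim (fun x => star_primitive (integrand sigma c t Lam) (x, 1 / 2)) l
    /\ curve_lim (fun r => star_primitive (integrand sigma c t Lam)
                             (0 + RtoC r * Cexp (0, phi))%C) l.
Proof.
  intros Hs Hc Ht HL Hphi Hadm.
  destruct (integrand_sector_decay sigma c t Lam phi Hs Hc Ht HL Hphi Hadm)
    as [M [a [x0 [Ha [Hx0 H]]]]].
  pose proof (tan_gt_0 phi (proj1 Hphi) (proj2 Hphi)) as Htan.
  assert (Hcos : 0 < cos phi) by (apply cos_gt_0; lra).
  set (P := star_primitive (integrand sigma c t Lam)).
  (* Past this abscissa the ray lies above height 1/2, inside the sector where decay is known. *)
  set (x1 := Rmax x0 (1 / 2 / tan phi)).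
  pose proof (Rmax_l x0 (1 / 2 / tan phi)) as Hm1.
  pose proof (Rmax_r x0 (1 / 2 / tan phi)) as Hm2. fold x1 in Hm1, Hm2.
  assert (Hx1 : forall x, x1 <= x -> 1 / 2 <= x * tan phi).
  { intros x Hx. apply Rmult_le_reg_r with (/ tan phi); [apply Rinv_0_lt_compat; exact Htan|].
    replace (x * tan phi * / tan phi) with x by (field; lra).
    unfold Rdiv in Hm2. lra. }
  destruct (curve_lim_exp (fun x => P (x, 1 / 2))
    (fun x => integrand sigma c t Lam (x, 1 / 2)) x1 M a Ha) as [l Hl].
  { intros x _. apply primitive_horizontal, Hc. }
  { intros x Hx. apply H; [lra|]. specialize (Hx1 x Hx). lra. }
  exists l. split; [exact Hl|].
  assert (HM : 0 <= M).
  { pose proof (H x1 (1 / 2) Hm1 (conj (Rle_refl _) (Hx1 x1 (Rle_refl _)))) as H0.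
    pose proof (Cmod_ge_0 (integrand sigma c t Lam (x1, 1 / 2))).
    pose proof (exp_pos (- a * x1)). nra. }
  assert (Hdiff : forall x, x1 <= x ->
    Cmod (P (x, (x * tan phi)%R) - P (x, 1 / 2)) <= 2 / a * (M * tan phi) * exp (- (a / 2) * x)).
  { intros x Hx.
    apply Rle_trans with (M * exp (- a * x) * (x * tan phi) - M * exp (- a * x) * (1 / 2)).
    - apply (curve_mean_value (fun s => P (x, s)) (fun s => Ci * integrand sigma c t Lam (x, s))%C
        (fun s => M * exp (- a * x) * s) (fun _ => M * exp (- a * x))).
      + apply Hx1, Hx.
      + intros s Hs'. apply primitive_vertical; [exact Hc | lra].
      + intros s _. auto_derive; [exact I | ring].
      + intros s Hs'. rewrite Cmod_mult.
        rewrite Cmod_Ci, Rmult_1_l. apply H; lra.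
    - pose proof (exp_pos (- a * x)) as E1.
      (* The factor x from the length of the segment is paid with half of the exponent. *)
      assert (E2 : exp (- a * x) * x <= 2 / a * exp (- (a / 2) * x)).
      { replace (- a * x) with (- (a / 2) * x + - (a / 2 * x)) by field.
        rewrite exp_plus, Rmult_assoc, (Rmult_comm (2 / a)).
        apply Rmult_le_compat_l; [left; apply exp_pos|].
        apply Rmult_le_reg_r with (exp (a / 2 * x)); [apply exp_pos|].
        rewrite Rmult_assoc, (Rmult_comm x), <- Rmult_assoc, <- exp_plus.
        replace (- (a / 2 * x) + a / 2 * x) with 0 by ring. rewrite exp_0.
        pose proof (exp_ineq1_le (a / 2 * x)) as E3.
        apply Rmult_le_compat_l with (r := 2 / a) in E3;
          [|left; apply Rdiv_lt_0_compat; lra].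
        replace (2 / a * (1 + a / 2 * x)) with (2 / a + x) in E3 by (field; lra).
        assert (0 < 2 / a) by (apply Rdiv_lt_0_compat; lra). lra. }
      assert (0 <= M * exp (- a * x) * (1 / 2))
        by (apply Rmult_le_pos; [apply Rmult_le_pos|]; lra).
      apply Rle_trans with (M * tan phi * (exp (- a * x) * x)); [lra|].
      replace (2 / a * (M * tan phi) * exp (- (a / 2) * x))
        with (M * tan phi * (2 / a * exp (- (a / 2) * x))) by ring.
      apply Rmult_le_compat_l; [apply Rmult_le_pos; lra | exact E2]. }
  assert (Hl2 : curve_lim (fun x => P (x, (x * tan phi)%R)) l).
  { apply (curve_lim_near (fun x => P (x, 1 / 2))); [exact Hl|].
    intros eps He.
    destruct (exp_small (a / 2) (2 / a * (M * tan phi)) eps ltac:(lra) He) as [X HX].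
    exists (Rmax X x1). intros x Hx.
    pose proof (Rmax_l X x1). pose proof (Rmax_r X x1).
    replace (P (x, (x * tan phi)%R) - P (x, (1 / 2)%R) - 0)%C
      with (P (x, (x * tan phi)%R) - P (x, (1 / 2)%R))%C by ring.
    eapply Rle_lt_trans; [apply Hdiff; lra | apply HX; lra]. }
  intros eps He.
  (* The ray is parametrised by its length r, and its abscissa is r cos phi. *)
  destruct (curve_lim_rescale (cos phi) _ _ Hcos Hl2 eps He) as [X HX].
  exists X. intros r Hr. specialize (HX r Hr).
  replace (0 + RtoC r * Cexp (0, phi))%C
    with ((cos phi * r)%R, (cos phi * r * tan phi)%R); [exact HX|].
  apply C_ext; unfold Cexp, tan; simpl; rewrite exp_0; field; lra.
Qed.

Lemma ray_cut_plane (c r phi : R) :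
  0 < phi < PI / 2 -> cut_plane c (0 + RtoC r * Cexp (0, phi)).
Proof.
  intros Hphi. destruct (Req_dec r 0) as [->|H0].
  - unfold cut_plane; simpl. split; left; lra.
  - assert (Hs : 0 < sin phi) by (apply sin_gt_0; lra).
    split; right; simpl; rewrite exp_0;
      replace (0 + (r * (1 * sin phi) + 0 * (1 * cos phi))) with (r * sin phi) by ring;
      apply Rmult_integral_contrapositive; split; lra.
Qed.

Lemma adm_phi_bound (lam phi : R) : adm_phi lam phi -> 0 < phi < PI / 2.
Proof.
  intros [H0 [H1 H2]]. split; [exact H0|].
  destruct (Rle_dec 0 (ln lam)) as [H|H]; [auto|].
  specialize (H2 ltac:(lra)). pose proof (atan_bound (PI / Rabs (ln lam))). lra.
Qed.

(** The factors [k] and [K] allow one statement to cover both integrals: k = K = 1 gives [JB_tilde],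
    while in [J_B] the variable zeta runs along the ray at speed (1 + c) / c and [K] is the explicit
    prefactor. *)
Lemma ray_integral_scaled (sigma c t Lam phi k : R) (K l : C) :
  0 < c -> 0 < k -> 0 < phi < PI / 2 ->
  curve_lim (fun r => star_primitive (integrand sigma c t Lam)
                        (0 + RtoC r * Cexp (0, phi))%C) l ->
  @RInt_gen C_R_CompleteNormedModule
    (fun r => K * integrand sigma c t Lam (0 + RtoC (k * r) * Cexp (0, phi))
              * (RtoC k * Cexp (0, phi)))%C (at_point 0) (Rbar_locally p_infty)
  = (K * l)%C.
Proof.
  intros Hc Hk Hphi Hl.
  rewrite (improper_integral_curve_lim _
    (fun r => K * star_primitive (integrand sigma c t Lam)
                    (0 + RtoC (k * r) * Cexp (0, phi)))%C (K * l)%C).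
  - rewrite Rmult_0_r. replace (0 + 0 * Cexp (0, phi))%C with (RtoC 0) by ring.
    rewrite star_primitive_0.
    match goal with |- ?x = ?y => change (x = y :> C) end. ring.
  - intros r Hr.
    eapply curve_deriv_eq.
    + apply curve_deriv_scal.
      apply (curve_deriv_rescale (fun s => star_primitive (integrand sigma c t Lam)
                    (0 + RtoC s * Cexp (0, phi))%C)).
      apply integrand_primitive; [exact Hc|].
      apply ray_cut_plane, Hphi.
    + ring.
  - intros r Hr. eexists.
    apply curve_deriv_mult; [|apply curve_deriv_const].
    apply curve_deriv_scal.
    apply (curve_deriv_rescale (fun s => integrand sigma c t Lam
                    (0 + RtoC s * Cexp (0, phi))%C)).
    apply (integrand_deriv sigma c t Lam Hc (fun s => 0 + RtoC s * Cexp (0, phi))%C);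
      [|apply curve_deriv_affine].
    apply ray_cut_plane, Hphi.
  - apply curve_lim_scal. apply (curve_lim_rescale k (fun s => star_primitive
      (integrand sigma c t Lam) (0 + RtoC s * Cexp (0, phi))%C)); assumption.
Qed.

(** * Identification of the integrals and the change of variable for [J_B] *)

Lemma lam_c_pos (delta t : R) : 0 < delta < 1 -> 1 < t -> 0 < lam_c delta t.
Proof.
  intros Hd Ht. unfold lam_c.
  pose proof (Rpower_lt t (delta - 1) 0 Ht ltac:(lra)) as H.
  rewrite Rpower_O in H by lra.
  apply Rdiv_lt_0_compat; [apply exp_pos | lra].
Qed.

Lemma adm_Lam_nonneg (delta t Lam : R) :
  0 < delta < 1 -> 1 < t -> adm_Lam delta t Lam -> 0 <= Lam.
Proof.
  intros Hd Ht [H _]. pose proof (lam_c_pos delta t Hd Ht). nra.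
Qed.

(** The second limit is the one that matters for the asymptotics: its curve is independent of
    [phi]. *)
Lemma JB_tilde_lim (delta sigma t Lam phi : R) :
  0 < delta < 1 -> 1 / 2 <= sigma < 1 -> 1 < t -> 0 <= Lam ->
  adm_phi (lam_c delta t * (1 + Lam)) phi ->
  curve_lim (fun r => star_primitive (integrand sigma (lam_c delta t) t Lam)
                        (0 + RtoC r * Cexp (0, phi))%C) (JB_tilde delta sigma phi t Lam)
  /\ curve_lim (fun x => star_primitive (integrand sigma (lam_c delta t) t Lam)
                        (x, 1 / 2)) (JB_tilde delta sigma phi t Lam).
Proof.
  intros Hd Hs Ht HL Hadm.
  pose proof (lam_c_pos delta t Hd Ht) as Hc. set (c := lam_c delta t) in *.
  pose proof (adm_phi_bound _ _ Hadm) as Hphi.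
  destruct (primitive_ray_lim sigma c t Lam phi Hs Hc ltac:(lra) HL Hphi Hadm)
    as [l [Hl1 Hl2]].
  replace (JB_tilde delta sigma phi t Lam) with l; [split; assumption|].
  pose proof (ray_integral_scaled sigma c t Lam phi 1 1 l Hc Rlt_0_1 Hphi Hl2) as H.
  replace l with (RtoC 1 * l)%C by ring. rewrite <- H.
  unfold JB_tilde, ray_int. f_equal.
  apply functional_extensionality. intros r.
  rewrite Rmult_1_l, !Cmult_1_l. reflexivity.
Qed.

Lemma Clog_scale (k : R) (z : C) :
  0 < k -> z <> 0 -> Clog (RtoC k * z) = (RtoC (ln k) + Clog z)%C.
Proof.
  intros Hk Hz. pose proof (Cmod_gt_0 z) as [Hm _]. specialize (Hm Hz).
  apply C_ext.
  - simpl. rewrite Cmod_mult, Cmod_R, Rabs_pos_eq by lra. apply ln_mult; assumption.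
  - simpl. rewrite Rplus_0_l. destruct z as [x y]. unfold Carg. simpl.
    replace (k * x - 0 * y) with (k * x) by ring.
    replace (k * y + 0 * x) with (k * y) by ring.
    assert (S : forall s, (0 < k * s <-> 0 < s) /\ (k * s < 0 <-> s < 0)
                          /\ (0 <= k * s <-> 0 <= s)).
    { intros s. repeat split; intros; nra. }
    pose proof (S x) as [Sx1 [Sx2 _]]. pose proof (S y) as [Sy1 [Sy2 Sy3]].
    assert (Q : x <> 0 -> k * y / (k * x) = y / x) by (intros; field; split; lra).
    destruct (Rlt_dec 0 (k * x)), (Rlt_dec 0 x); try tauto; [apply f_equal, Q; lra|].
    destruct (Rlt_dec (k * x) 0), (Rlt_dec x 0); try tauto.
    + rewrite Q by lra. destruct (Rle_dec 0 (k * y)), (Rle_dec 0 y); tauto.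
    + destruct (Rlt_dec 0 (k * y)), (Rlt_dec 0 y); try tauto.
      destruct (Rlt_dec (k * y) 0), (Rlt_dec y 0); tauto.
Qed.

Lemma RtoC_Rpower (x a : R) : RtoC (Rpower x a) = Cexp (RtoC a * RtoC (ln x)).
Proof. unfold Rpower. rewrite <- Cexp_RtoC, RtoC_mult. reflexivity. Qed.

(** Both z and 1 - z are positive multiples of 1 + c zeta and 1 - zeta, so their logarithms split
    without branch corrections. The constants collected in the phase form [f0]. *)
Lemma J_B_integrand (sigma c t Lam : R) (zeta : C) :
  0 < c -> 0 <= Lam -> cut_plane c zeta ->
  let z := (RtoC (1 / (1 + c)) * (1 + RtoC c * zeta))%C in
  (Defs.Cpow (1 - z) (- (1 / 2))%R * Defs.Cpow z (sigma - 1 / 2)%R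
   * Cexp (Ci * RtoC t * Fz z (c * (1 + Lam))))%C
  = (RtoC (Rpower (c / (1 + c)) (- (1 / 2))) * RtoC (Rpower (1 / (1 + c)) (sigma - 1 / 2))
     * Cexp (Ci * RtoC (t * f0 Lam c / (1 + c))) * integrand sigma c t Lam zeta)%C.
Proof.
  intros Hc HL HD z.
  pose proof (slit_neq_0 _ (cut_plane_slit_minus c _ HD)) as N1.
  pose proof (slit_neq_0 _ (cut_plane_slit_plus c _ Hc HD)) as N2.
  assert (N3 : (1 + RtoC c)%C <> 0%C) by (rewrite <- RtoC_plus; apply RtoC_neq_0; lra).
  assert (E1 : (1 - z)%C = (RtoC (c / (1 + c)) * (1 - zeta))%C).
  { unfold z. rewrite !RtoC_div, RtoC_plus by lra. field. exact N3. }
  assert (K1 : 0 < c / (1 + c)) by (apply Rdiv_lt_0_compat; lra).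
  assert (K2 : 0 < 1 / (1 + c)) by (apply Rdiv_lt_0_compat; lra).
  assert (L1 : Clog (1 - z) = (RtoC (ln c - ln (1 + c)) + Clog (1 - zeta))%C).
  { rewrite E1, Clog_scale, ln_div by (assumption || lra). reflexivity. }
  assert (L2 : Clog z = (RtoC (- ln (1 + c)) + Clog (1 + RtoC c * zeta))%C).
  { unfold z at 1. rewrite Clog_scale, ln_div, ln_1, Rminus_0_l by (assumption || lra).
    reflexivity. }
  assert (L3 : f0 Lam c = ln c + ln (1 + Lam) - ln (1 + c) - c * (ln (1 + c) - ln c)).
  { unfold f0. rewrite !ln_div, ln_mult by nra. reflexivity. }
  rewrite integrand_exponent, !RtoC_Rpower. unfold Defs.Cpow. rewrite <- !Cexp_plus. f_equal.
  unfold Fz. rewrite L1, L2, E1, L3, !ln_div, ln_mult, ln_1 by lra.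
  unfold exponent, amplitude_log, h_fun, f1, z.
  set (a1 := Clog (1 - zeta)). set (a2 := Clog (1 + RtoC c * zeta)).
  repeat first [rewrite RtoC_div by lra | rewrite RtoC_minus | rewrite RtoC_plus
               | rewrite RtoC_mult | rewrite RtoC_opp].
  field. exact N3.
Qed.

Lemma J_B_identity (delta sigma t Lam phi : R) :
  0 < delta < 1 -> 1 / 2 <= sigma < 1 -> 1 < t -> 0 <= Lam ->
  adm_phi (lam_c delta t * (1 + Lam)) phi ->
  let lc := lam_c delta t in
  J_B delta sigma phi t (lc * (1 + Lam)) =
    (RtoC (Rpower (lc / (1 + lc)) (1/2))
     * RtoC (Rpower (1 / (1 + lc)) (sigma - 1/2))
     * Cexp (Ci * RtoC (t * f0 Lam lc / (1 + lc)))
     * JB_tilde delta sigma phi t Lam)%C.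
Proof.
  intros Hd Hs Ht HL Hadm c.
  pose proof (lam_c_pos delta t Hd Ht) as Hc. fold c in Hc, Hadm.
  pose proof (adm_phi_bound _ _ Hadm) as Hphi.
  destruct (JB_tilde_lim delta sigma t Lam phi Hd Hs Ht HL Hadm) as [Hl _]. fold c in Hl.
  (* The starting point of the ray of [J_B] is the image of zeta = 0. *)
  assert (Hq : 1 - Rpower t (delta - 1) = 1 / (1 + c)).
  { pose proof (Rpower_lt t (delta - 1) 0 Ht ltac:(lra)) as H.
    rewrite Rpower_O in H by lra. unfold c, lam_c. field. lra. }
  assert (K1 : 0 < c / (1 + c)) by (apply Rdiv_lt_0_compat; lra).
  assert (Hk : 0 < (1 + c) / c) by (apply Rdiv_lt_0_compat; lra).
  (* The Jacobian c / (1 + c) turns the exponent -1/2 of the integrand into the 1/2 of the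
     prefactor. *)
  assert (Hhalf : Rpower (c / (1 + c)) (1 / 2)
                  = Rpower (c / (1 + c)) (- (1 / 2)) * (c / (1 + c))).
  { rewrite <- (Rpower_1 (c / (1 + c)) K1) at 3. rewrite <- Rpower_plus.
    f_equal. lra. }
  pose proof (ray_integral_scaled sigma c t Lam phi ((1 + c) / c)
    (RtoC (Rpower (c / (1 + c)) (1 / 2)) * RtoC (Rpower (1 / (1 + c)) (sigma - 1 / 2))
     * Cexp (Ci * RtoC (t * f0 Lam c / (1 + c))))%C _ Hc Hk Hphi Hl) as H.
  rewrite <- H. unfold J_B, ray_int. rewrite Hq. f_equal.
  apply functional_extensionality. intros r.
  set (e := Cexp (0, phi)). cbv beta.
  assert (Hz : (RtoC (1 / (1 + c)) + RtoC r * e)%C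
    = (RtoC (1 / (1 + c)) * (1 + RtoC c * (0 + RtoC ((1 + c) / c * r) * e)))%C).
  { rewrite RtoC_mult, !RtoC_div, !RtoC_plus by lra. field.
    split; [apply RtoC_neq_0; lra | rewrite <- RtoC_plus; apply RtoC_neq_0; lra]. }
  rewrite Hz.
  pose proof (J_B_integrand sigma c t Lam _ Hc HL (ray_cut_plane c ((1 + c) / c * r) phi Hphi))
    as E. cbv zeta in E. fold e in E. rewrite E, Hhalf.
  assert (Hce : (RtoC (c / (1 + c)) * RtoC ((1 + c) / c))%C = RtoC 1).
  { rewrite <- RtoC_mult. f_equal. field. lra. }
  rewrite (RtoC_mult (Rpower _ _)).
  match goal with |- ?u = ?v => change (u = v :> C) end.
  transitivity (RtoC (Rpower (c / (1 + c)) (- (1 / 2)))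
    * RtoC (Rpower (1 / (1 + c)) (sigma - 1 / 2))
    * Cexp (Ci * RtoC (t * f0 Lam c / (1 + c)))
    * integrand sigma c t Lam (0 + RtoC ((1 + c) / c * r) * e)
    * e * (RtoC (c / (1 + c)) * RtoC ((1 + c) / c)))%C; [rewrite Hce|]; ring.
Qed.

(** * The Fresnel tail *)

(* On the ray [w + r e^{i pi/4}] one has [i xi^2 = i w^2 - r^2 - a r (1 - i)] with [a = sqrt 2 * w]. *)
Definition gauss (a x : R) : C := Cexp (- (x * x) - a * x, a * x).

Definition gauss_primitive (a x : R) : C :=
  (RInt (fun s => fst (gauss a s)) 0 x, RInt (fun s => snd (gauss a s)) 0 x).

Lemma gauss_deriv (a x : R) :
  curve_deriv (gauss a) x (((- (2 * x) - a)%R, a) * gauss a x)%C.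
Proof.
  apply (curve_deriv_Cexp (fun x => (- (x * x) - a * x, a * x))).
  split; simpl; auto_derive; try exact I; ring.
Qed.

Lemma gauss_primitive_deriv (a x : R) :
  curve_deriv (gauss_primitive a) x (gauss a x).
Proof.
  assert (H : forall f : R -> R, (forall y, continuous f y) ->
    is_derive (fun y => RInt f 0 y) x (f x)).
  { intros f Hf. apply (is_derive_RInt (V := R_NormedModule) f _ 0).
    - apply filter_forall. intros y.
      apply (RInt_correct (V := R_CompleteNormedModule)).
      apply (ex_RInt_continuous (V := R_CompleteNormedModule)). intros; apply Hf.
    - apply Hf. }
  split; apply H; intros y; apply (curve_deriv_continuous _ _ _ (gauss_deriv a y)).
Qed.

Lemma gauss_primitive_0 (a : R) : gauss_primitive a 0 = 0%C.
Proof. apply C_ext; simpl; apply (RInt_point (V := R_CompleteNormedModule)). Qed.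

Lemma Cmod_gauss (a x : R) : Cmod (gauss a x) = exp (- (x * x) - a * x).
Proof. apply Cmod_Cexp. Qed.

Lemma gauss_bound (a x : R) :
  0 <= a -> 0 <= x -> Cmod (gauss a x) <= exp 1 * exp (- (2) * x).
Proof.
  intros Ha Hx. rewrite Cmod_gauss, <- exp_plus. apply exp_mono.
  assert (0 <= a * x) by nra.
  pose proof (Rle_0_sqr (x - 1)) as Q. unfold Rsqr in Q. lra.
Qed.

Lemma gauss_primitive_lim (a : R) :
  0 <= a -> exists G, curve_lim (gauss_primitive a) G.
Proof.
  intros Ha.
  apply (curve_lim_exp (gauss_primitive a) (gauss a) 0 (exp 1) 2 ltac:(lra)).
  - intros x _. apply gauss_primitive_deriv.
  - intros x Hx. apply gauss_bound; assumption.
Qed.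

Lemma gauss_lim_le (a : R) (G : C) :
  0 <= a -> curve_lim (gauss_primitive a) G -> Cmod G <= exp 1 / 2.
Proof.
  intros Ha HG. replace G with (G - 0)%C by ring.
  apply (curve_lim_Cmod_le _ G 0 _ 0 HG). intros x Hx.
  rewrite <- (gauss_primitive_0 a).
  replace (exp 1 / 2) with (exp 1 / 2 * exp (- (2) * 0))
    by (rewrite Rmult_0_r, exp_0; ring).
  apply (curve_exp_increment (gauss_primitive a) (gauss a)); try lra.
  - intros y _. apply gauss_primitive_deriv.
  - intros y Hy. apply gauss_bound; [exact Ha | apply Hy].
Qed.

Lemma one_minus_exp_ge (a : R) : 0 <= a -> a / (1 + a) <= 1 - exp (- a).
Proof.
  intros Ha. rewrite exp_Ropp. pose proof (exp_ineq1_le a).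
  assert (/ exp a <= / (1 + a)) by (apply Rinv_le_contravar; lra).
  replace (a / (1 + a)) with (1 - / (1 + a)) by (field; lra). lra.
Qed.

(* Integration by parts: the derivative of [1 - e^{-ax} cos(ax)] is [a e^{-ax} (cos(ax) + sin(ax))], so up to a nonnegative boundary term [a * (fst + snd)] of the primitive is the integral of the nonnegative function [2 x e^{-x^2} (1 - e^{-ax} cos(ax))]. *)
Lemma gauss_primitive_ge (a x : R) :
  0 < a -> 2 <= x ->
  2 * exp (-4) / (1 + a) <= fst (gauss_primitive a x) + snd (gauss_primitive a x).
Proof.
  intros Ha Hx.
  set (psi := fun s => 1 - exp (- (a * s)) * cos (a * s)).
  set (T := fun s => a * (fst (gauss_primitive a s) + snd (gauss_primitive a s))
                     - exp (- (s * s)) * psi s).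
  assert (Hpsi : forall s, 0 <= s -> 1 - exp (- (a * s)) <= psi s).
  { intros s Hs. unfold psi. pose proof (COS_bound (a * s)).
    pose proof (exp_pos (- (a * s))). nra. }
  assert (Hpsi0 : forall s, 0 <= s -> 0 <= psi s).
  { intros s Hs. apply Rle_trans with (2 := Hpsi s Hs).
    assert (exp (- (a * s)) <= exp 0) by (apply exp_mono; nra). rewrite exp_0 in *. lra. }
  assert (DT : forall s, is_derive T s (2 * s * exp (- (s * s)) * psi s)).
  { intros s. destruct (gauss_primitive_deriv a s) as [D1 D2].
    assert (D3 : is_derive (fun s => exp (- (s * s)) * psi s) s
      (- (2 * s) * exp (- (s * s)) * psi s
       + exp (- (s * s)) * (a * exp (- (a * s)) * (cos (a * s) + sin (a * s))))).
    { unfold psi. auto_derive; [exact I | ring]. }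
    unfold T. eapply is_derive_eq.
    - exact (is_derive_minus _ _ _ _ _
        (is_derive_scal _ _ a _ (is_derive_plus _ _ _ _ _ D1 D2)) D3).
    - unfold minus, plus, opp, gauss, Cexp; simpl.
      replace (- (s * s) - a * s) with (- (s * s) + - (a * s)) by ring.
      rewrite exp_plus. ring. }
  assert (Hmono : forall u v, 0 <= u -> u <= v -> T u <= T v).
  { intros u v Hu Huv.
    pose proof (is_derive_le_increment (fun _ => 0) T (fun _ => 0)
      (fun s => 2 * s * exp (- (s * s)) * psi s) u v Huv) as H.
    enough (0 - 0 <= T v - T u) by lra. apply H.
    - intros; apply (is_derive_const (K := R_AbsRing) (V := R_NormedModule)).
    - intros; apply DT.
    - intros s Hs. pose proof (exp_pos (- (s * s))). specialize (Hpsi0 s ltac:(lra)).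
      apply Rmult_le_pos; [nra | exact Hpsi0]. }
  (* The interval [1, 2] alone gives the quantitative bound: there 2 s >= 2, exp (- s^2) >= exp (-4)
     and psi s >= 1 - exp (- a) >= a / (1 + a). Elsewhere monotonicity of T is enough. *)
  assert (H12 : 2 * exp (-4) * (a / (1 + a)) <= T 2 - T 1).
  { pose proof (one_minus_exp_ge a ltac:(lra)) as Hga.
    assert (Hq : 0 <= a / (1 + a)) by (apply Rdiv_le_0_compat; lra).
    set (q := a / (1 + a)) in *.
    replace (2 * exp (-4) * q) with (2 * exp (-4) * q * 2 - 2 * exp (-4) * q * 1) by ring.
    apply (is_derive_le_increment (fun s => 2 * exp (-4) * q * s) T
      (fun _ => 2 * exp (-4) * q) (fun s => 2 * s * exp (- (s * s)) * psi s)); [lra| | |].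
    - intros s _. auto_derive; [exact I | ring].
    - intros; apply DT.
    - intros s Hs.
      assert (E1 : exp (-4) <= exp (- (s * s))) by (apply exp_mono; nra).
      assert (E2 : q <= psi s).
      { apply Rle_trans with (2 := Hpsi s ltac:(lra)).
        assert (exp (- (a * s)) <= exp (- a)) by (apply exp_mono; nra). lra. }
      pose proof (exp_pos (-4)).
      apply Rmult_le_compat; [nra | exact Hq | nra | exact E2]. }
  assert (H01 : 0 <= T 1).
  { pose proof (Hmono 0 1 ltac:(lra) ltac:(lra)) as H.
    enough (T 0 = 0) by lra. unfold T, psi. rewrite gauss_primitive_0. simpl.
    rewrite !Rmult_0_r, Ropp_0, exp_0, cos_0. ring. }
  pose proof (Hmono 2 x ltac:(lra) Hx) as H2x.
  assert (HT : 2 * exp (-4) * (a / (1 + a))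
    <= a * (fst (gauss_primitive a x) + snd (gauss_primitive a x))).
  { assert (0 <= exp (- (x * x)) * psi x)
      by (apply Rmult_le_pos; [left; apply exp_pos | apply Hpsi0; lra]).
    assert (E : T x = a * (fst (gauss_primitive a x) + snd (gauss_primitive a x))
                     - exp (- (x * x)) * psi x) by reflexivity.
    lra. }
  apply Rmult_le_reg_l with a; [exact Ha|].
  replace (a * (2 * exp (-4) / (1 + a))) with (2 * exp (-4) * (a / (1 + a))) by (field; lra).
  exact HT.
Qed.

(** The integration by parts controls a times the primitive and says nothing at a = 0. There the
    integrand is exp (- s^2), positive and at least exp (-4) on [0, 2]. *)
Lemma gauss_primitive_0_ge (x : R) : 2 <= x -> exp (-4) <= fst (gauss_primitive 0 x).
Proof.
  intros Hx.
  assert (Hg : forall s, fst (gauss 0 s) = exp (- (s * s))).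
  { intros s. unfold gauss, Cexp; simpl. rewrite !Rmult_0_l, cos_0. 
    rewrite Rminus_0_r. ring. }
  assert (H : forall u v k, 0 <= u -> u <= v -> (forall s, u <= s <= v -> k <= exp (- (s * s))) ->
    k * (v - u) <= fst (gauss_primitive 0 v) - fst (gauss_primitive 0 u)).
  { intros u v k Hu Huv Hk. replace (k * (v - u)) with (k * v - k * u) by ring.
    apply (is_derive_le_increment (fun s => k * s) (fun s => fst (gauss_primitive 0 s))
      (fun _ => k) (fun s => fst (gauss 0 s))); [exact Huv | | |].
    - intros s _. auto_derive; [exact I | ring].
    - intros s _. exact (proj1 (gauss_primitive_deriv 0 s)).
    - intros s Hs. rewrite Hg. apply Hk, Hs. }
  pose proof (H 0 2 (exp (-4)) ltac:(lra) ltac:(lra)) as H1.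
  pose proof (H 2 x 0 ltac:(lra) Hx) as H2.
  rewrite gauss_primitive_0 in H1. simpl fst in H1 at 2.
  assert (A1 : forall s, 0 <= s <= 2 -> exp (-4) <= exp (- (s * s)))
    by (intros; apply exp_mono; nra).
  assert (A2 : forall s, 2 <= s <= x -> 0 <= exp (- (s * s)))
    by (intros; left; apply exp_pos).
  specialize (H1 A1). specialize (H2 A2). pose proof (exp_pos (-4)). lra.
Qed.

Lemma gauss_lim_ge (a : R) (G : C) :
  0 <= a -> curve_lim (gauss_primitive a) G -> exp (-4) / (1 + a) <= Cmod G.
Proof.
  intros Ha HG.
  pose proof (fst_le_Cmod G) as A1. pose proof (snd_le_Cmod G) as A2.
  pose proof (Rle_abs (fst G)) as A3. pose proof (Rle_abs (snd G)) as A4.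
  destruct (Req_dec a 0) as [->|H0].
  - pose proof (curve_lim_fst_ge _ G _ 2 HG gauss_primitive_0_ge). 
    replace (exp (-4) / (1 + 0)) with (exp (-4)) by field. lra.
  (* The real part of (1 - i) G is [fst G + snd G], the quantity bounded below by
     [gauss_primitive_ge]; it is at most 2 |G|. *)
  - assert (Hlim : curve_lim (fun x => (1 - Ci) * gauss_primitive a x)%C ((1 - Ci) * G)%C)
      by (apply curve_lim_scal, HG).
    assert (H : 2 * exp (-4) / (1 + a) <= fst ((1 - Ci) * G)%C).
    { apply (curve_lim_fst_ge _ _ _ 2 Hlim). intros x Hx.
      pose proof (gauss_primitive_ge a x ltac:(lra) Hx). simpl in *. lra. }
    simpl in H.
    replace (2 * exp (-4) / (1 + a)) with (2 * (exp (-4) / (1 + a))) in H by (field; lra).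
    lra.
Qed.

Lemma sqr_mul_exp_le (a x : R) :
  0 < a -> 0 <= x -> x * x * exp (- (a * x)) <= 16 / (a * a) * exp (- (a / 2) * x).
Proof.
  intros Ha Hx.
  replace (- (a * x)) with (- (a / 2) * x + (- (a / 4 * x) + - (a / 4 * x))) by field.
  rewrite !exp_plus, exp_Ropp.
  pose proof (exp_ineq1_le (a / 4 * x)) as E.
  assert (Hy : 0 <= a / 4 * x) by nra.
  assert (E2 : x * x * (/ exp (a / 4 * x) * / exp (a / 4 * x)) <= 16 / (a * a)).
  { set (y := exp (a / 4 * x)) in *. assert (Hy0 : 0 < y) by lra.
    assert (0 < a * a) by nra.
    apply Rmult_le_reg_r with (y * y * (a * a));
      [repeat apply Rmult_lt_0_compat; assumption|].
    replace (x * x * (/ y * / y) * (y * y * (a * a))) with (a * x * (a * x)) by (field; lra).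
    replace (16 / (a * a) * (y * y * (a * a))) with (4 * y * (4 * y)) by (field; lra).
    apply Rmult_le_compat; nra. }
  pose proof (exp_pos (- (a / 2) * x)). nra.
Qed.

(** Without the factor exp (- x^2) the integral is exactly 1 / (a (1 - i)). Dropping the factor
    costs at most the integral of x^2 exp (- a x), which has order a^(-3); the constant is 32 = 16 *
    2, from [sqr_mul_exp_le] integrated at rate a / 2. *)
Lemma gauss_lim_asymptotic (a : R) (G : C) :
  0 < a -> curve_lim (gauss_primitive a) G ->
  Cmod (G - / (RtoC a * (1 - Ci))) <= 32 / (a * a * a).
Proof.
  intros Ha HG.
  assert (Ha0 : RtoC a <> 0%C) by (apply RtoC_neq_0; lra).
  assert (H11 : (1 - Ci)%C <> 0%C) by (intros E; injection E; lra).
  set (k := (/ (RtoC a * (1 - Ci)))%C).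
  set (q := fun x => (gauss_primitive a x - (k - k * Cexp ((- a * x)%R, (a * x)%R)))%C).
  assert (Dq : forall x, curve_deriv q x (gauss a x - Cexp ((- a * x)%R, (a * x)%R))%C).
  { intros x. apply curve_deriv_minus; [apply gauss_primitive_deriv|].
    eapply curve_deriv_eq.
    - apply curve_deriv_minus; [apply curve_deriv_const|].
      apply curve_deriv_scal.
      apply (curve_deriv_Cexp (fun x => (- a * x, a * x)) x (- a, a)).
      split; simpl; auto_derive; try exact I; ring.
    - replace ((- a, a) : C) with (- (RtoC a * (1 - Ci)))%C
        by (apply C_ext; simpl; ring).
      unfold k. field. split; assumption. }
  assert (Bq : forall x, 0 <= x ->
    Cmod (gauss a x - Cexp ((- a * x)%R, (a * x)%R)) <= 16 / (a * a) * exp (- (a / 2) * x)).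
  { intros x Hx. apply Rle_trans with (2 := sqr_mul_exp_le a x Ha Hx).
    replace (gauss a x) with (RtoC (exp (- (x * x))) * Cexp ((- a * x)%R, (a * x)%R))%C.
    - replace (RtoC (exp (- (x * x))) * Cexp ((- a * x)%R, (a * x)%R)
               - Cexp ((- a * x)%R, (a * x)%R))%C
        with (RtoC (exp (- (x * x)) - 1) * Cexp ((- a * x)%R, (a * x)%R))%C
        by (rewrite RtoC_minus; ring).
      rewrite Cmod_mult, Cmod_R, Cmod_Cexp. simpl fst.
      replace (- a * x) with (- (a * x)) by ring.
      apply Rmult_le_compat_r; [left; apply exp_pos|].
      pose proof (exp_ineq1_le (- (x * x))).
      assert (exp (- (x * x)) <= exp 0) by (apply exp_mono; nra). rewrite exp_0 in *.
      rewrite Rabs_left1 by lra. lra.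
    - rewrite <- Cexp_RtoC, <- Cexp_plus. unfold gauss. f_equal.
      apply C_ext; simpl; ring. }
  assert (Lq : curve_lim q (G - k)%C).
  { apply (curve_lim_near (fun x => gauss_primitive a x - k)%C).
    - intros eps He. destruct (HG eps He) as [X HX]. exists X. intros x Hx.
      replace (gauss_primitive a x - k - (G - k))%C with (gauss_primitive a x - G)%C by ring.
      apply HX, Hx.
    - intros eps He. destruct (exp_small a (Cmod k) eps Ha He) as [X HX].
      exists X. intros x Hx.
      replace (q x - (gauss_primitive a x - k) - 0)%C
        with (k * Cexp ((- a * x)%R, (a * x)%R))%C by (unfold q; ring).
      rewrite Cmod_mult, Cmod_Cexp. simpl fst. apply HX, Hx. }
  replace (G - k)%C with (G - k - q 0)%C.
  - apply (curve_lim_Cmod_le q _ _ _ 0 Lq). intros x Hx.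
    replace (32 / (a * a * a)) with (16 / (a * a) / (a / 2) * exp (- (a / 2) * 0))
      by (rewrite Rmult_0_r, exp_0; field; lra).
    apply (curve_exp_increment q (fun x => gauss a x - Cexp ((- a * x)%R, (a * x)%R))%C);
      try lra.
    + intros y _. apply Dq.
    + intros y Hy. apply Bq, Hy.
  - unfold q. rewrite gauss_primitive_0, !Rmult_0_r.
    replace ((0, 0) : C) with (RtoC 0) by reflexivity. rewrite Cexp_0. ring.
Qed.

Lemma Cexp_PI4 : Cexp (0, PI / 4) = (RtoC (/ sqrt 2) * (1 + Ci))%C.
Proof.
  apply C_ext; unfold Cexp; simpl; rewrite exp_0, ?cos_PI4, ?sin_PI4; field;
    apply Rgt_not_eq, Rlt_sqrt2_0.
Qed.

Lemma fresnel_tail_gauss (w : R) (G : C) :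
  curve_lim (gauss_primitive (sqrt 2 * w)) G ->
  fresnel_tail w = (Cexp (Ci * RtoC (w * w)) * Cexp (0, (PI / 4)%R) * G)%C.
Proof.
  intros HG. unfold fresnel_tail, ray_int.
  set (k := (Cexp (Ci * RtoC (w * w)) * Cexp (0, (PI / 4)%R))%C).
  pose proof (improper_integral_curve_lim
    (fun r => k * gauss (sqrt 2 * w) r)%C (fun r => k * gauss_primitive (sqrt 2 * w) r)%C
    (k * G)%C) as H.
  cbv beta in H. rewrite gauss_primitive_0 in H.
  replace (k * G)%C with (k * G - k * 0)%C by ring. rewrite <- H; clear H.
  - f_equal. apply functional_extensionality. intros r.
    unfold k. match goal with |- ?u = ?v => change (u = v :> C) end.
    rewrite <- (Cmult_comm (gauss _ _)), Cmult_assoc. f_equal.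
    unfold gauss. rewrite <- Cexp_plus. f_equal. rewrite Cexp_PI4.
    assert (H0 : 0 < sqrt 2) by apply Rlt_sqrt2_0.
    assert (H2 : sqrt 2 * sqrt 2 = 2) by (apply sqrt_sqrt; lra).
    assert (H3 : / sqrt 2 * / sqrt 2 = / 2) by (rewrite <- Rinv_mult, H2; reflexivity).
    assert (H4 : sqrt 2 = 2 * / sqrt 2) by (rewrite <- H2 at 2; field; lra).
    set (s := / sqrt 2) in *. rewrite H4.
    apply C_ext; simpl.
    + transitivity (- (2 * (s * s)) * (r * r) - 2 * s * w * r); [ring | rewrite H3; field].
    + ring.
  - intros r _. apply curve_deriv_scal, gauss_primitive_deriv.
  - intros r _. eexists. apply curve_deriv_scal, gauss_deriv.
  - apply curve_lim_scal, HG.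
Qed.

(** * Comparison with the Fresnel tail *)

(** The half-plane Re <= m is convex, so the derivative of exp is bounded by exp m on the segment
    from B to A. *)
Lemma Cexp_lipschitz (A B : C) (m : R) :
  fst A <= m -> fst B <= m -> Cmod (Cexp A - Cexp B) <= Cmod (A - B) * exp m.
Proof.
  intros HA HB.
  pose proof (curve_mean_value (fun u => Cexp (B + RtoC u * (A - B)))%C
    (fun u => (A - B) * Cexp (B + RtoC u * (A - B)))%C
    (fun u => Cmod (A - B) * exp m * u) (fun _ => Cmod (A - B) * exp m) 0 1 Rle_0_1) as H.
  cbv beta in H.
  replace (B + 1 * (A - B))%C with A in H by ring.
  replace (B + 0 * (A - B))%C with B in H by ring.
  eapply Rle_trans; [apply H|right; ring].
  - intros u _. apply curve_deriv_Cexp, curve_deriv_affine.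
  - intros u _. auto_derive; [exact I | ring].
  - intros u Hu. rewrite Cmod_mult, Cmod_Cexp.
    apply Rmult_le_compat_l; [apply Cmod_ge_0|]. apply exp_mono. simpl.
    replace (u * (fst A + - fst B) - 0 * (snd A + - snd B))
      with (u * fst A - u * fst B) by ring.
    nra.
Qed.

(** The segment from 1 to 1 + w avoids the cut and stays at distance at least m from 0, which is
    what bounding log (1 + w) by integrating w / (1 + u w) along it requires. *)
Definition segment_slit (m : R) (w : C) : Prop :=
  forall u, 0 <= u <= 1 -> slit (1 + RtoC u * w) /\ m <= Cmod (1 + RtoC u * w).

Lemma segment_slit_scale (m u : R) (w : C) :
  0 <= u <= 1 -> segment_slit m w -> segment_slit m (RtoC u * w).
Proof.
  intros Hu H v Hv. rewrite Cmult_assoc, <- RtoC_mult. apply H. nra.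
Qed.

Lemma Cmod_div_le (a b : C) (m : R) :
  0 < m -> m <= Cmod b -> b <> 0 -> Cmod (a / b) <= Cmod a / m.
Proof.
  intros Hm Hb H0. rewrite Cmod_div by exact H0. unfold Rdiv.
  apply Rmult_le_compat_l; [apply Cmod_ge_0 | apply Rinv_le_contravar; assumption].
Qed.

Lemma Clog_segment_deriv (m u : R) (w : C) :
  segment_slit m w -> 0 <= u <= 1 ->
  curve_deriv (fun u => Clog (1 + RtoC u * w)) u (w / (1 + RtoC u * w))%C.
Proof.
  intros H Hu.
  apply (curve_deriv_Clog (fun u => 1 + RtoC u * w)%C); [apply H, Hu | apply curve_deriv_affine].
Qed.

Lemma Clog_1_plus_le (m : R) (w : C) :
  0 < m -> segment_slit m w -> Cmod (Clog (1 + w)) <= Cmod w / m.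
Proof.
  intros Hm H.
  pose proof (curve_mean_value (fun u => Clog (1 + RtoC u * w))%C
    (fun u => w / (1 + RtoC u * w))%C (fun u => Cmod w / m * u) (fun _ => Cmod w / m)
    0 1 Rle_0_1) as D. cbv beta in D.
  replace (1 + 1 * w)%C with (1 + w)%C in D by ring.
  replace (1 + 0 * w)%C with (RtoC 1) in D by ring. rewrite Clog_1 in D.
  replace (Clog (1 + w) - 0)%C with (Clog (1 + w)) in D by ring.
  eapply Rle_trans; [apply D | right; ring].
  - intros u Hu. apply (Clog_segment_deriv m); assumption.
  - intros u _. auto_derive; [exact I | ring].
  - intros u Hu. destruct (H u Hu) as [S1 S2].
    apply Cmod_div_le; [exact Hm | exact S2 | apply slit_neq_0, S1].
Qed.

Lemma Clog_1_plus_linear (m : R) (w : C) :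
  0 < m -> segment_slit m w -> Cmod (Clog (1 + w) - w) <= Cmod w * Cmod w / m.
Proof.
  intros Hm H.
  pose proof (curve_mean_value (fun u => Clog (1 + RtoC u * w) - RtoC u * w)%C
    (fun u => w / (1 + RtoC u * w) - w)%C
    (fun u => Cmod w * Cmod w / m * u) (fun _ => Cmod w * Cmod w / m)
    0 1 Rle_0_1) as D. cbv beta in D.
  replace (1 + 0 * w)%C with (RtoC 1) in D by ring. rewrite Clog_1 in D.
  replace (Clog (1 + 1 * w) - 1 * w - (0 - 0 * w))%C with (Clog (1 + w) - w)%C in D
    by (replace (1 + 1 * w)%C with (1 + w)%C by ring; ring).
  eapply Rle_trans; [apply D | right; ring].
  - intros u Hu. apply curve_deriv_minus; [apply (Clog_segment_deriv m); assumption|].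
    apply (curve_deriv_ext (fun u => 0 + RtoC u * w)%C); [intros; ring|].
    apply curve_deriv_affine.
  - intros u _. auto_derive; [exact I | ring].
  - intros u Hu. destruct (H u Hu) as [S1 S2]. pose proof (slit_neq_0 _ S1) as S0.
    replace (w / (1 + RtoC u * w) - w)%C with (- (RtoC u * w * w) / (1 + RtoC u * w))%C
      by (field; exact S0).
    eapply Rle_trans; [apply (Cmod_div_le _ _ m); assumption|].
    rewrite Cmod_opp, !Cmod_mult, Cmod_R, Rabs_pos_eq by lra. unfold Rdiv.
    apply Rmult_le_compat_r; [left; apply Rinv_0_lt_compat, Hm|].
    assert (0 <= Cmod w * Cmod w) by (apply Rmult_le_pos; apply Cmod_ge_0). nra.
Qed.

(** The Taylor remainder of (1 + w) log (1 + w) after w + w^2 / 2. Its derivative is log (1 + w) -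
    w, which is quadratic in w, so the remainder is cubic. *)
Definition entropy_remainder (w : C) : C :=
  ((1 + w) * Clog (1 + w) - w - w * w * RtoC (/ 2))%C.

Lemma entropy_remainder_le (m : R) (w : C) :
  0 < m -> segment_slit m w ->
  Cmod (entropy_remainder w) <= Cmod w * (Cmod w * Cmod w / m).
Proof.
  intros Hm H. set (k := Cmod w * (Cmod w * Cmod w / m)).
  pose proof (curve_mean_value (fun u => entropy_remainder (0 + RtoC u * w))%C
    (fun u => w * (Clog (1 + RtoC u * w) - RtoC u * w))%C
    (fun u => k * u) (fun _ => k) 0 1 Rle_0_1) as D. cbv beta in D.
  replace (0 + 1 * w)%C with w in D by ring.
  replace (0 + 0 * w)%C with (RtoC 0) in D by ring.
  replace (entropy_remainder w - entropy_remainder 0)%C with (entropy_remainder w) in D.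
  2: { unfold entropy_remainder at 3. replace (1 + 0)%C with (RtoC 1) by ring.
       rewrite Clog_1. ring. }
  eapply Rle_trans; [apply D | right; ring].
  - intros u Hu. destruct (H u Hu) as [S1 _].
    pose proof (curve_deriv_affine 0 w u) as A.
    eapply curve_deriv_eq.
    + unfold entropy_remainder. apply curve_deriv_minus; [apply curve_deriv_minus|].
      * apply curve_deriv_mult;
          [apply curve_deriv_plus; [apply curve_deriv_const | exact A]|].
        apply (curve_deriv_Clog (fun u => 1 + (0 + RtoC u * w))%C);
          [|apply curve_deriv_plus; [apply curve_deriv_const | exact A]].
        replace (1 + (0 + RtoC u * w))%C with (1 + RtoC u * w)%C by ring. exact S1.
      * exact A.
      * apply curve_deriv_mult; [apply curve_deriv_mult; exact A | apply curve_deriv_const].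
    + cbv beta. replace (0 + RtoC u * w)%C with (RtoC u * w)%C by ring.
      rewrite RtoC_inv by lra. field.
      exact (slit_neq_0 _ S1).
  - intros u _. auto_derive; [exact I | ring].
  - intros u Hu. rewrite Cmod_mult. unfold k.
    apply Rmult_le_compat_l; [apply Cmod_ge_0|].
    eapply Rle_trans;
      [apply (Clog_1_plus_linear m _ Hm), segment_slit_scale; assumption|].
    unfold Rdiv. apply Rmult_le_compat_r; [left; apply Rinv_0_lt_compat, Hm|].
    rewrite Cmod_mult, Cmod_R, Rabs_pos_eq by lra. pose proof (Cmod_ge_0 w).
    apply Rmult_le_compat; nra.
Qed.

(** [f1] regroups as c L z + (1 + c z) log (1 + c z) + c (1 - z) log (1 - z). The linear Taylor
    terms c z and - c z cancel, and the quadratic ones add up to c (1 + c) z^2 / 2. *)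
Lemma h_fun_entropy (c Lam : R) (z : C) :
  0 < c ->
  h_fun c Lam z
  = (RtoC (c * ln (1 + Lam) / (1 + c)) * z + RtoC (c / 2) * z * z
     + (entropy_remainder (RtoC c * z) + RtoC c * entropy_remainder (- z))
       * RtoC (/ (1 + c)))%C.
Proof.
  intros Hc.
  assert (N : (1 + RtoC c)%C <> 0%C) by (rewrite <- RtoC_plus; apply RtoC_neq_0; lra).
  unfold h_fun, f1, entropy_remainder.
  replace (1 + - z)%C with (1 - z)%C by ring.
  rewrite !RtoC_inv, !RtoC_div, RtoC_mult, !RtoC_plus by lra. field. exact N.
Qed.

Lemma segment_slit_re (m : R) (w : C) :
  0 < m -> (forall u, 0 <= u <= 1 -> m <= 1 + u * fst w) -> segment_slit m w.
Proof.
  intros Hm H u Hu. specialize (H u Hu).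
  assert (E : fst (1 + RtoC u * w)%C = 1 + u * fst w) by (simpl; ring).
  split; [left; rewrite E; lra|].
  rewrite <- E in H. eapply Rle_trans; [exact H|].
  eapply Rle_trans; [apply Rle_abs | apply fst_le_Cmod].
Qed.

(** The constants come from |z| <= 2 x and from the distances to 0 of the two segments: real parts
    stay at least 1/2 for 1 - u z and at least 1 for 1 + u c z. *)
Lemma diagonal_estimates (c x : R) :
  0 < c <= 1 -> 0 <= x <= 1 / 2 ->
  Cmod (Clog (1 - (x, x))) <= 4 * x /\ Cmod (Clog (1 + RtoC c * (x, x))) <= 2 * x
  /\ Cmod (entropy_remainder (RtoC c * (x, x))) <= 8 * c * (x * x * x)
  /\ Cmod (entropy_remainder (- (x, x))) <= 16 * (x * x * x).
Proof.
  intros Hc Hx.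
  assert (Hz : Cmod (x, x) <= 2 * x) by (apply Cmod_le_sqr; simpl; nra).
  pose proof (Cmod_ge_0 (x, x)) as Hz0.
  assert (Hcz : Cmod (RtoC c * (x, x)) = c * Cmod (x, x))
    by (rewrite Cmod_mult, Cmod_R, Rabs_pos_eq; lra).
  set (z := ((x, x) : C)) in *.
  assert (S1 : segment_slit (1 / 2) (- z))
    by (apply segment_slit_re; [lra | intros u Hu; simpl; nra]).
  assert (S2 : segment_slit 1 (RtoC c * z)).
  { apply segment_slit_re; [lra | intros u Hu]. simpl.
    assert (0 <= c * x) by nra. nra. }
  assert (Hsq : Cmod z * Cmod z <= 2 * x * (2 * x)) by (apply Rmult_le_compat; lra).
  assert (Hcu : Cmod z * (Cmod z * Cmod z) <= 2 * x * (2 * x * (2 * x)))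
    by (apply Rmult_le_compat; nra).
  assert (Hcu0 : 0 <= Cmod z * (Cmod z * Cmod z)) by (repeat apply Rmult_le_pos; lra).
  repeat split.
  - change (1 - z)%C with (1 + - z)%C.
    eapply Rle_trans; [apply (Clog_1_plus_le (1 / 2)); [lra | exact S1]|].
    rewrite Cmod_opp. lra.
  - eapply Rle_trans; [apply (Clog_1_plus_le 1); [lra | exact S2]|].
    rewrite Hcz. nra.
  - eapply Rle_trans; [apply (entropy_remainder_le 1); [lra | exact S2]|].
    rewrite Hcz.
    replace (c * Cmod z * (c * Cmod z * (c * Cmod z) / 1))
      with (c * (c * c) * (Cmod z * (Cmod z * Cmod z))) by field.
    replace (8 * c * (x * x * x)) with (c * 1 * (2 * x * (2 * x * (2 * x)))) by ring.
    apply Rmult_le_compat; try lra; [nra|]. apply Rmult_le_compat_l; nra.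
  - eapply Rle_trans; [apply (entropy_remainder_le (1 / 2)); [lra | exact S1]|].
    rewrite Cmod_opp. lra.
Qed.

(** With n = sqrt (c t), [gauss] at n x is the exponential of the linear and quadratic part of i t
    h, so the exponents differ by the amplitude, at most 3 x, and a remainder at most 24 n^2 x^3.
    Both real parts are bounded by the one from [im_h_diagonal], using c / (1 + c) >= c / 2; the 2
    in the exponent covers the amplitude, since 3 x <= 3/2. *)
Lemma diagonal_comparison (sigma c t Lam n x : R) :
  1 / 2 <= sigma < 1 -> 0 < c <= 1 -> 0 < t -> 0 <= Lam -> n * n = c * t ->
  0 <= x <= 1 / 2 ->
  Cmod (integrand sigma c t Lam (x, x) - gauss (n * ln (1 + Lam) / (1 + c)) (n * x))
  <= (3 * x + 24 * (n * n) * (x * x * x))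
     * exp (2 - n * n / 2 * (ln (1 + Lam) * x + x * x / 4)).
Proof.
  intros Hs Hc Ht HL Hn Hx.
  destruct (diagonal_estimates c x Hc Hx) as [B1 [B2 [B3 B4]]].
  pose proof (im_h_diagonal c Lam x (proj1 Hc) HL Hx) as Him.
  assert (HL0 : 0 <= ln (1 + Lam)) by (apply ln_nonneg; lra).
  set (L := ln (1 + Lam)) in *. set (z := ((x, x) : C)) in *.
  assert (Hamp : Cmod (amplitude_log sigma c z) <= 3 * x).
  { unfold amplitude_log. eapply Rle_trans; [apply Cmod_triangle|].
    rewrite !Cmod_mult, !Cmod_R, Rabs_Ropp, !Rabs_pos_eq by lra.
    pose proof (Cmod_ge_0 (Clog (1 + RtoC c * z))). nra. }
  rewrite integrand_exponent. unfold gauss.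
  set (a := n * L / (1 + c)).
  set (E := ((- (n * x * (n * x)) - a * (n * x), a * (n * x)) : C)).
  assert (Hq : 0 <= c / (1 + c) * (L * x + x * x / 4)).
  { apply Rmult_le_pos; [apply Rdiv_le_0_compat; lra | nra]. }
  assert (Hc2 : c / 2 <= c / (1 + c)).
  { unfold Rdiv. apply Rmult_le_compat_l; [lra|]. apply Rinv_le_contravar; lra. }
  assert (Hnn : n * n / 2 * (L * x + x * x / 4)
                <= t * (c / (1 + c) * (L * x + x * x / 4))).
  { rewrite Hn. replace (c * t / 2 * (L * x + x * x / 4))
      with (t * (c / 2 * (L * x + x * x / 4))) by field.
    apply Rmult_le_compat_l; [lra|]. apply Rmult_le_compat_r; [nra | exact Hc2]. }
  assert (Ha : a * (n * x) = t * (c / (1 + c)) * (L * x)).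
  { unfold a. replace (n * L / (1 + c) * (n * x)) with (n * n * (L / (1 + c) * x)) by (field; lra).
    rewrite Hn. field. lra. }
  apply Rle_trans with (Cmod (exponent sigma c t Lam z - E)
    * exp (2 - n * n / 2 * (L * x + x * x / 4)));
    [|apply Rmult_le_compat_r; [left; apply exp_pos|]].
  - apply Cexp_lipschitz.
    + unfold exponent.
      replace (fst (amplitude_log sigma c z + Ci * RtoC t * h_fun c Lam z)%C)
        with (fst (amplitude_log sigma c z) - t * snd (h_fun c Lam z)) by (simpl; ring).
      pose proof (fst_le_Cmod (amplitude_log sigma c z)) as F.
      pose proof (Rle_abs (fst (amplitude_log sigma c z))).
      assert (t * (c / (1 + c) * (L * x + x * x / 4)) <= t * snd (h_fun c Lam z))
        by (apply Rmult_le_compat_l; [lra | exact Him]).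
      lra.
    + unfold E. simpl. rewrite Ha.
      replace (- (n * x * (n * x))) with (- (n * n * (x * x))) by ring. rewrite Hn.
      rewrite Hn in Hnn.
      assert (0 <= t * (c * (x * x))) by (repeat apply Rmult_le_pos; lra).
      assert (t * (c / (1 + c) * (L * x + x * x / 4))
              <= t * (c / (1 + c)) * (L * x) + t * (c * (x * x))).
      { assert (c / (1 + c) <= c).
        { unfold Rdiv. rewrite <- (Rmult_1_r c) at 3. apply Rmult_le_compat_l; [lra|].
          rewrite <- Rinv_1. apply Rinv_le_contravar; lra. }
        assert (t * (c / (1 + c) * (x * x / 4)) <= t * (c * (x * x))).
        { apply Rmult_le_compat_l; [lra|]. apply Rmult_le_compat; nra. }
        lra. }
      lra.
  - replace (exponent sigma c t Lam z - E)%C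
      with (amplitude_log sigma c z
            + Ci * RtoC t * ((entropy_remainder (RtoC c * z)
                + RtoC c * entropy_remainder (- z)) * RtoC (/ (1 + c))))%C.
    + eapply Rle_trans; [apply Cmod_triangle|].
      rewrite !Cmod_mult, Cmod_Ci, !Cmod_R.
      pose proof (Rinv_0_lt_compat (1 + c) ltac:(lra)) as Hi.
      rewrite (Rabs_pos_eq t), (Rabs_pos_eq (/ (1 + c))) by lra.
      assert (Hi1 : / (1 + c) <= 1) by (rewrite <- Rinv_1; apply Rinv_le_contravar; lra).
      set (R1 := entropy_remainder (RtoC c * z)) in *.
      set (R2 := entropy_remainder (- z)) in *.
      assert (HR : Cmod (R1 + RtoC c * R2) <= 24 * c * (x * x * x)).
      { eapply Rle_trans; [apply Cmod_triangle|].
        rewrite Cmod_mult, Cmod_R, Rabs_pos_eq by lra.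
        assert (c * Cmod R2 <= c * (16 * (x * x * x))) by (apply Rmult_le_compat_l; lra).
        lra. }
      pose proof (Cmod_ge_0 (R1 + RtoC c * R2)).
      assert (Cmod (R1 + RtoC c * R2) * / (1 + c) <= 24 * c * (x * x * x) * 1)
        by (apply Rmult_le_compat; lra).
      assert (t * (Cmod (R1 + RtoC c * R2) * / (1 + c)) <= t * (24 * c * (x * x * x) * 1))
        by (apply Rmult_le_compat_l; lra).
      rewrite Hn. lra.
    + unfold exponent. rewrite h_fun_entropy by lra. fold L.
      assert (EE : E = (Ci * RtoC t * (RtoC (c * L / (1 + c)) * z + RtoC (c / 2) * z * z))%C).
      { unfold E. rewrite Ha.
        replace (- (n * x * (n * x))) with (- (n * n * (x * x))) by ring. rewrite Hn.
        unfold z. apply C_ext; simpl; field; lra. }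
      rewrite EE. ring.
Qed.

(** A Gaussian with polynomial weight is traded for a pure exponential, which [curve_exp_increment]
    integrates. With y = n x, half of y^2 / 8 pays for the polynomial and the other half, through y
    <= (y^2 + 1) / 2, yields the rate n / 8. The rate n^2 L / 8 is what later produces the factor 1
    / (n L + 1). *)
Lemma cubic_gaussian_bound (L n x : R) :
  0 <= L -> 0 < n -> 0 <= x ->
  (3 * x + 24 * (n * n) * (x * x * x)) * exp (- (n * n / 2 * (L * x + x * x / 4)))
  <= 60000 / n * exp (- ((n * n * L + n) / 8) * x).
Proof.
  intros HL Hn Hx. set (y := n * x).
  assert (Hy : 0 <= y) by (unfold y; nra).
  replace (3 * x + 24 * (n * n) * (x * x * x)) with ((3 * y + 24 * (y * y * y)) / n)
    by (unfold y; field; lra).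
  assert (E : exp (- (n * n / 2 * (L * x + x * x / 4)))
    <= exp (- ((n * n * L + n) / 8) * x) * (exp 1 * (/ exp (y * y / 32) * / exp (y * y / 32)))).
  { rewrite <- !exp_Ropp, <- !exp_plus. apply exp_mono.
    assert (0 <= n * n * (L * x)) by (repeat apply Rmult_le_pos; lra).
    pose proof (Rle_0_sqr (y - 1)) as Q. unfold Rsqr in Q.
    unfold y in *. lra. }
  assert (F : (3 * y + 24 * (y * y * y)) * (/ exp (y * y / 32) * / exp (y * y / 32)) <= 20000).
  { pose proof (exp_ineq1_le (y * y / 32)) as X. set (v := exp (y * y / 32)) in *.
    assert (Hv : 1 <= v) by nra.
    apply Rmult_le_reg_r with (v * v); [nra|].
    replace ((3 * y + 24 * (y * y * y)) * (/ v * / v) * (v * v))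
      with (3 * y + 24 * (y * y * y)) by (field; lra).
    assert (V : (1 + y * y / 32) * (1 + y * y / 32) <= v * v)
      by (apply Rmult_le_compat; nra).
    pose proof (Rle_0_sqr (y - 1)) as Q1. pose proof (Rle_0_sqr (y * (y - 1))) as Q2.
    unfold Rsqr in Q1, Q2. nra. }
  pose proof exp_le_3 as E3. pose proof (exp_pos (- ((n * n * L + n) / 8) * x)) as Ep.
  set (P := exp (- ((n * n * L + n) / 8) * x)) in *.
  set (W := / exp (y * y / 32) * / exp (y * y / 32)) in *.
  assert (Hp : 0 <= (3 * y + 24 * (y * y * y)) / n).
  { apply Rdiv_le_0_compat; [|exact Hn].
    assert (0 <= y * y * y) by (repeat apply Rmult_le_pos; lra). lra. }
  eapply Rle_trans; [apply Rmult_le_compat_l; [exact Hp | exact E]|].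
  replace ((3 * y + 24 * (y * y * y)) / n * (P * (exp 1 * W)))
    with (P / n * (exp 1 * ((3 * y + 24 * (y * y * y)) * W))) by (field; lra).
  replace (60000 / n * P) with (P / n * 60000) by (field; lra).
  apply Rmult_le_compat_l; [apply Rdiv_le_0_compat; lra|].
  apply Rle_trans with (exp 1 * 20000).
  - apply Rmult_le_compat_l; [left; apply exp_pos | exact F].
  - lra.
Qed.

(** The amplitude grows at most like exp (c x), by ln |1 + c z| <= |1 + c z| - 1. As t >= 32, part
    of the decay c t (x - 1/2) absorbs this and the rate c t / 4 is left. *)
Lemma horizontal_decay (sigma c t Lam x : R) :
  1 / 2 <= sigma < 1 -> 0 < c <= 1 -> 32 <= t -> 0 <= Lam -> 1 / 2 <= x ->
  Cmod (integrand sigma c t Lam (x, 1 / 2))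
  <= exp (3 - c * t * (ln (1 + Lam) / 4 + 1 / 32) - c * t / 4 * (x - 1 / 2)).
Proof.
  intros Hs Hc Ht HL Hx. rewrite Cmod_integrand, fst_exponent. apply exp_mono.
  pose proof (neg_ln_Cmod_1_minus x (1 / 2) (Rle_refl _)) as H1.
  pose proof (Cmod_1_plus_ge c x (1 / 2) (proj1 Hc) ltac:(lra)) as H2.
  pose proof (Cmod_1_plus_le c x (1 / 2) (proj1 Hc) ltac:(lra) ltac:(lra)) as H3.
  pose proof (ln_nonneg _ H2) as H4.
  pose proof (ln_le_linear 1 _ Rlt_0_1 (Rlt_le_trans _ _ _ Rlt_0_1 H2)) as H5.
  rewrite ln_1 in H5.
  pose proof (im_h_horizontal c Lam x (proj1 Hc) HL Hx) as H6.
  assert (HL0 : 0 <= ln (1 + Lam)) by (apply ln_nonneg; lra).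
  set (L := ln (1 + Lam)) in *.
  assert (Hc2 : c / 2 <= c / (1 + c)).
  { unfold Rdiv. apply Rmult_le_compat_l; [lra|]. apply Rinv_le_contravar; lra. }
  assert (H7 : t * (c / 2 * (L / 2 + 1 / 16 + 3 / 4 * (x - 1 / 2)))
               <= t * snd (h_fun c Lam (x, 1 / 2))).
  { apply Rmult_le_compat_l; [lra|]. eapply Rle_trans; [|exact H6].
    apply Rmult_le_compat_r; lra. }
  assert (H8 : (sigma - 1 / 2) * ln (Cmod (1 + RtoC c * (x, 1 / 2)))
               <= ln (Cmod (1 + RtoC c * (x, 1 / 2)))) by nra.
  assert (H9 : c * 32 * (x - 1 / 2) <= c * t * (x - 1 / 2)).
  { apply Rmult_le_compat_r; [lra|]. apply Rmult_le_compat_l; lra. }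
  assert (H10 : 0 <= c * t * (x - 1 / 2)) by (repeat apply Rmult_le_pos; lra).
  lra.
Qed.

Lemma primitive_diagonal (sigma c t Lam x : R) :
  0 < c -> 0 <= x <= 1 / 2 ->
  curve_deriv (fun s => star_primitive (integrand sigma c t Lam) (s, s)) x
    ((1 + Ci) * integrand sigma c t Lam (x, x))%C.
Proof.
  intros Hc Hx.
  assert (E : forall s, (0 + RtoC s * (1 + Ci))%C = (s, s))
    by (intros s; apply C_ext; simpl; ring).
  apply (curve_deriv_ext
    (fun s => star_primitive (integrand sigma c t Lam) (0 + RtoC s * (1 + Ci))%C));
    [intros s; rewrite E; reflexivity|].
  eapply curve_deriv_eq.
  - apply integrand_primitive; [exact Hc|]. rewrite E. split; left; simpl; nra.
  - rewrite E. reflexivity.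
Qed.

Lemma gauss_scaled_deriv (a n x : R) :
  0 < n ->
  curve_deriv (fun s => (1 + Ci) * RtoC (/ n) * gauss_primitive a (n * s))%C x
    ((1 + Ci) * gauss a (n * x))%C.
Proof.
  intros Hn. eapply curve_deriv_eq.
  - apply curve_deriv_scal.
    apply (curve_deriv_rescale (gauss_primitive a)), gauss_primitive_deriv.
  - rewrite RtoC_inv by lra. field. apply RtoC_neq_0. lra.
Qed.

Lemma Cmod_1_plus_i : 1 <= Cmod (1 + Ci) <= 2.
Proof.
  split; [apply Cmod_ge_sqr | apply Cmod_le_sqr]; simpl; lra.
Qed.

(** The three terms come from the diagonal, from the model past x = 1/2, and from the horizontal
    half-line. *)
Definition comparison_constant : R := 960000 * exp 2 + 960000 + 128 * exp 3.

(** The primitive turns right at (1 + i)/2 while the model [Q] continues along the diagonal; the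
    parameter x is shared. Each discrepancy is O(1 / D), where n b = D / 8 links the decay rate b to
    the target D = n^2 (n L + 1). *)
Lemma gauss_comparison (sigma c t Lam n : R) (J G : C) :
  1 / 2 <= sigma < 1 -> 0 < c <= 1 -> 32 <= t -> 0 <= Lam -> n * n = c * t -> 1 <= n ->
  curve_lim (fun x => star_primitive (integrand sigma c t Lam) (x, 1 / 2)) J ->
  curve_lim (gauss_primitive (n * ln (1 + Lam) / (1 + c))) G ->
  Cmod (J - (1 + Ci) * RtoC (/ n) * G)
  <= comparison_constant / (n * n * (n * ln (1 + Lam) + 1)).
Proof.
  intros Hs Hc Ht HL Hn Hn1 HJ HG.
  assert (HL0 : 0 <= ln (1 + Lam)) by (apply ln_nonneg; lra).
  set (L := ln (1 + Lam)) in *. set (a := n * L / (1 + c)) in *.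
  set (P := star_primitive (integrand sigma c t Lam)) in *.
  set (Q := fun s => ((1 + Ci) * RtoC (/ n) * gauss_primitive a (n * s))%C).
  set (b := (n * n * L + n) / 8).
  set (D := n * n * (n * L + 1)).
  assert (HnL : 0 <= n * n * L) by (repeat apply Rmult_le_pos; lra).
  assert (HnL1 : 0 <= n * L) by (apply Rmult_le_pos; lra).
  assert (Hb : 0 < b) by (unfold b; lra).
  assert (HD : 0 < D) by (unfold D; repeat apply Rmult_lt_0_compat; lra).
  pose proof Cmod_1_plus_i as H1i.
  assert (HMb : forall M x, 0 <= M -> 0 <= x -> M / n / b * exp (- b * x) <= 8 * M / D).
  { intros M x HM Hx.
    assert (Ex : exp (- b * x) <= exp 0) by (apply exp_mono; nra). rewrite exp_0 in Ex.
    replace (8 * M / D) with (M / n / b * 1)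
      by (unfold D, b; field; repeat split; nra).
    apply Rmult_le_compat_l; [|exact Ex]. repeat apply Rdiv_le_0_compat; lra. }
  assert (Hgauss : forall x, 0 <= x ->
    Cmod (gauss a (n * x)) <= exp (- (n * n / 2 * (L * x + x * x / 4)))).
  { intros x Hx. rewrite Cmod_gauss. apply exp_mono.
    assert (0 <= n * n * (x * x)) by (repeat apply Rmult_le_pos; lra).
    assert (n * n * L * x / 2 <= a * (n * x)).
    { unfold a. replace (n * L / (1 + c) * (n * x)) with (n * n * L * x * / (1 + c))
        by (field; lra).
      unfold Rdiv. apply Rmult_le_compat_l; [apply Rmult_le_pos; lra|].
      apply Rinv_le_contravar; lra. }
    lra. }
  assert (Hcub : forall x, 0 <= x ->
    (3 * x + 24 * (n * n) * (x * x * x)) * exp (- (n * n / 2 * (L * x + x * x / 4)))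
    <= 60000 / n * exp (- b * x)).
  { intros x Hx. apply cubic_gaussian_bound; lra. }
  assert (Step1 : Cmod (P (1 / 2, 1 / 2) - Q (1 / 2)) <= 8 * (120000 * exp 2) / D).
  { replace (P ((1 / 2)%R, (1 / 2)%R) - Q (1 / 2)%R)%C
      with ((P ((1 / 2)%R, (1 / 2)%R) - Q (1 / 2)%R) - (P (0%R, 0%R) - Q 0%R))%C.
    2: { unfold Q. rewrite Rmult_0_r, gauss_primitive_0. unfold P.
         change ((0, 0) : C) with (RtoC 0). rewrite star_primitive_0. ring. }
    eapply Rle_trans; [|apply (HMb _ 0); [|lra]].
    2: { apply Rmult_le_pos; [lra | left; apply exp_pos]. }
    apply (curve_exp_increment (fun x => P (x, x) - Q x)%C
      (fun x => (1 + Ci) * integrand sigma c t Lam (x, x) - (1 + Ci) * gauss a (n * x))%C);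
      [exact Hb | lra | |].
    - intros x Hx. apply curve_deriv_minus.
      + apply primitive_diagonal; lra.
      + apply gauss_scaled_deriv; lra.
    - intros x Hx.
      replace ((1 + Ci) * integrand sigma c t Lam (x, x) - (1 + Ci) * gauss a (n * x))%C
        with ((1 + Ci) * (integrand sigma c t Lam (x, x) - gauss a (n * x)))%C by ring.
      rewrite Cmod_mult.
      pose proof (diagonal_comparison sigma c t Lam n x Hs Hc ltac:(lra) HL Hn Hx) as H.
      fold L a in H.
      replace (2 - n * n / 2 * (L * x + x * x / 4))
        with (2 + - (n * n / 2 * (L * x + x * x / 4))) in H by ring.
      rewrite exp_plus in H.
      specialize (Hcub x (proj1 Hx)). pose proof (exp_pos 2).
      pose proof (Cmod_ge_0 (integrand sigma c t Lam (x, x) - gauss a (n * x))).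
      apply Rle_trans with (2 * (exp 2 * (60000 / n * exp (- b * x)))).
      + apply Rmult_le_compat; [lra | lra | lra|].
        eapply Rle_trans; [exact H|].
        rewrite (Rmult_comm (exp 2)), <- Rmult_assoc, (Rmult_comm _ (exp 2)).
        apply Rmult_le_compat_l; [lra | exact Hcub].
      + right. field. lra. }
  assert (Step2 : forall X, 1 / 2 <= X -> Cmod (Q X - Q (1 / 2)) <= 8 * 120000 / D).
  { intros X HX. eapply Rle_trans; [|apply (HMb 120000 (1 / 2)); lra].
    apply (curve_exp_increment Q (fun x => (1 + Ci) * gauss a (n * x))%C); [exact Hb | exact HX | |].
    - intros x _. apply gauss_scaled_deriv. lra.
    - intros x Hx. rewrite Cmod_mult. specialize (Hgauss x ltac:(lra)).
      specialize (Hcub x ltac:(lra)).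
      (* For x >= 1/2 the polynomial weight exceeds 1, so the bound with the weight also controls
         the bare Gaussian. *)
      assert (H3 : 1 <= 3 * x + 24 * (n * n) * (x * x * x)).
      { assert (0 <= 24 * (n * n) * (x * x * x)) by (repeat apply Rmult_le_pos; lra). lra. }
      set (e := exp (- (n * n / 2 * (L * x + x * x / 4)))) in *.
      assert (He : 0 < e) by apply exp_pos.
      pose proof (Cmod_ge_0 (gauss a (n * x))).
      apply Rle_trans with (2 * (60000 / n * exp (- b * x))).
      + apply Rmult_le_compat; [lra | lra | lra|].
        eapply Rle_trans; [exact Hgauss|]. eapply Rle_trans; [|exact Hcub].
        rewrite <- (Rmult_1_l e) at 1. apply Rmult_le_compat_r; lra.
      + right. field. lra. }
  assert (Step3 : forall X, 1 / 2 <= X ->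
    Cmod (P (X, 1 / 2) - P (1 / 2, 1 / 2)) <= 128 * exp 3 / D).
  { intros X HX.
    assert (HN : 0 < n * n) by nra.
    pose proof (curve_exp_increment (fun x => P (x, 1 / 2))
      (fun x => integrand sigma c t Lam (x, 1 / 2))
      (exp (3 - n * n * (L / 4 + 1 / 32) + n * n / 4 * (1 / 2))) (n * n / 4) (1 / 2) X
      ltac:(lra) HX) as H.
    eapply Rle_trans; [apply H|].
    - intros x _. apply primitive_horizontal, Hc.
    - intros x Hx.
      eapply Rle_trans; [apply horizontal_decay; try assumption; lra|].
      fold L. rewrite <- exp_plus, Hn. apply exp_mono. lra.
    - set (u := n * n * (L / 4 + 1 / 32)).
      replace (3 - u + n * n / 4 * (1 / 2)) with (3 + - u + n * n / 4 * (1 / 2)) by ring.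
      unfold Rdiv at 1. rewrite Rmult_assoc, (Rmult_comm (/ _)), <- Rmult_assoc, <- exp_plus.
      replace (3 + - u + n * n / 4 * (1 / 2) + - (n * n / 4) * (1 / 2)) with (3 + - u) by field.
      rewrite exp_plus, exp_Ropp.
      assert (Hu : 0 < u) by (unfold u; apply Rmult_lt_0_compat; lra).
      pose proof (exp_ineq1_le u) as E. pose proof (exp_pos 3) as E3.
      assert (EI : / exp u <= / u) by (apply Rinv_le_contravar; lra).
      (* Of the exponential smallness only exp (- u) <= 1 / u is kept; it suffices because n^2 (L +
         1) >= n L + 1 for n >= 1. *)
      assert (HF : / u * / (n * n / 4) <= 128 / D).
      { assert (HuD : D / 32 <= u * (n * n)).
        { unfold u, D.
          assert (n * n * (n * L + 1) <= n * n * (n * n * (L + 1))).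
          { apply Rmult_le_compat_l; [lra|]. nra. }
          assert (0 <= n * n * (n * n) * L) by (repeat apply Rmult_le_pos; lra).
          lra. }
        rewrite <- Rinv_mult. replace (128 / D) with (/ (D / 128)) by (field; lra).
        apply Rinv_le_contravar; lra. }
      apply Rle_trans with (exp 3 * (/ u * / (n * n / 4))).
      + rewrite Rmult_assoc. apply Rmult_le_compat_l; [lra|].
        apply Rmult_le_compat_r; [left; apply Rinv_0_lt_compat; lra | exact EI].
      + replace (128 * exp 3 / D) with (exp 3 * (128 / D)) by (field; lra).
        apply Rmult_le_compat_l; lra. }
  assert (Hlim : curve_lim (fun x => P (x, (1 / 2)%R) - Q x)%C
                   (J - (1 + Ci) * RtoC (/ n) * G)%C).
  { apply curve_lim_minus; [exact HJ|]. apply curve_lim_scal.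
    apply (curve_lim_rescale n (gauss_primitive a)); [lra | exact HG]. }
  replace (J - (1 + Ci) * RtoC (/ n) * G)%C
    with (J - (1 + Ci) * RtoC (/ n) * G - 0)%C by ring.
  apply (curve_lim_Cmod_le _ _ 0 _ (1 / 2) Hlim). intros X HX.
  specialize (Step2 X HX). specialize (Step3 X HX).
  replace (P (X, (1 / 2)%R) - Q X - 0)%C
    with ((P (X, (1 / 2)%R) - P ((1 / 2)%R, (1 / 2)%R)) + (P ((1 / 2)%R, (1 / 2)%R) - Q (1 / 2)%R)
          + - (Q X - Q (1 / 2)%R))%C by ring.
  eapply Rle_trans; [apply Cmod_triangle|]. rewrite Cmod_opp.
  eapply Rle_trans; [apply Rplus_le_compat_r, Cmod_triangle|].
  unfold comparison_constant.
  replace ((960000 * exp 2 + 960000 + 128 * exp 3) / D)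
    with (128 * exp 3 / D + 8 * (120000 * exp 2) / D + 8 * 120000 / D) by (field; lra).
  lra.
Qed.

(** * Relative error, uniformly as t tends to infinity *)

Lemma sqrt2_omega (delta t Lam : R) :
  0 < delta < 1 -> 1 < t ->
  sqrt 2 * omega delta t Lam
  = sqrt (lam_c delta t * t) * ln (1 + Lam) / (1 + lam_c delta t).
Proof.
  intros Hd Ht. pose proof (lam_c_pos delta t Hd Ht) as Hc. unfold omega.
  set (c := lam_c delta t) in *.
  assert (0 < c * t) by (apply Rmult_lt_0_compat; lra).
  replace (c * t) with (2 * (c * t / 2)) at 2 by field.
  rewrite sqrt_mult by lra. field. lra.
Qed.

Lemma omega_nonneg (delta t Lam : R) :
  0 < delta < 1 -> 1 < t -> 0 <= Lam -> 0 <= omega delta t Lam.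
Proof.
  intros Hd Ht HL. pose proof (lam_c_pos delta t Hd Ht) as Hc. unfold omega.
  apply Rmult_le_pos; [apply sqrt_pos|]. apply Rdiv_le_0_compat; [apply ln_nonneg; lra | lra].
Qed.

Lemma Cmod_Cexp_imag (a : R) : Cmod (Cexp (Ci * RtoC a)) = 1.
Proof. rewrite Cmod_Cexp. simpl. replace (0 * a - 1 * 0) with 0 by ring. apply exp_0. Qed.

Lemma Cmod_Cexp_angle (a : R) : Cmod (Cexp (0, a)) = 1.
Proof. rewrite Cmod_Cexp. apply exp_0. Qed.

Definition fresnel_approx (delta t Lam : R) : C :=
  (Cexp (- (Ci * RtoC (omega delta t Lam * omega delta t Lam)))
   * RtoC (sqrt (2 / (lam_c delta t * t))) * fresnel_tail (omega delta t Lam))%C.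

Lemma fresnel_approx_gauss (delta t Lam : R) (G : C) :
  0 < delta < 1 -> 1 < t ->
  curve_lim (gauss_primitive (sqrt 2 * omega delta t Lam)) G ->
  fresnel_approx delta t Lam
  = ((1 + Ci) * RtoC (/ sqrt (lam_c delta t * t)) * G)%C.
Proof.
  intros Hd Ht HG. pose proof (lam_c_pos delta t Hd Ht) as Hc.
  unfold fresnel_approx. rewrite (fresnel_tail_gauss _ G HG), Cexp_PI4.
  set (w := omega delta t Lam). set (c := lam_c delta t) in *.
  assert (Hct : 0 < c * t) by (apply Rmult_lt_0_compat; lra).
  assert (H0 : 0 < sqrt 2) by apply Rlt_sqrt2_0.
  assert (E : (Cexp (- (Ci * RtoC (w * w))) * Cexp (Ci * RtoC (w * w)))%C = RtoC 1).
  { rewrite <- Cexp_plus, <- Cexp_0. f_equal. ring. }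
  rewrite sqrt_div by lra.
  replace (/ sqrt (c * t)) with (sqrt 2 / sqrt (c * t) * / sqrt 2)
    by (field; split; [apply Rgt_not_eq, sqrt_lt_R0, Hct | lra]).
  rewrite (RtoC_mult (sqrt 2 / sqrt (c * t))).
  set (e1 := Cexp (- (Ci * RtoC (w * w)))) in *. set (e2 := Cexp (Ci * RtoC (w * w))) in *.
  set (k1 := RtoC (sqrt 2 / sqrt (c * t))). set (k2 := RtoC (/ sqrt 2)).
  transitivity ((e1 * e2) * (k1 * k2 * (1 + Ci) * G))%C; [ring|]. rewrite E. ring.
Qed.

(** The main term is at least exp (-4) / (n (n L + 1)) in modulus and the error at most a constant
    over n^2 (n L + 1). The factor n L + 1, which carries all dependence on [Lam], cancels in the
    quotient. *)
Lemma JB_tilde_asymptotic (delta sigma t Lam phi : R) :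
  0 < delta < 1 -> 1 / 2 <= sigma < 1 -> 32 <= t -> lam_c delta t <= 1 ->
  1 <= lam_c delta t * t -> 0 <= Lam -> adm_phi (lam_c delta t * (1 + Lam)) phi ->
  exists e : C,
    Cmod e <= comparison_constant / exp (-4) / sqrt (lam_c delta t * t)
    /\ JB_tilde delta sigma phi t Lam = (fresnel_approx delta t Lam * (1 + e))%C.
Proof.
  intros Hd Hs Ht Hc1 Hct HL Hadm.
  pose proof (lam_c_pos delta t Hd ltac:(lra)) as Hc.
  destruct (JB_tilde_lim delta sigma t Lam phi Hd Hs ltac:(lra) HL Hadm) as [_ HJ].
  pose proof (omega_nonneg delta t Lam Hd ltac:(lra) HL) as Hw.
  pose proof (sqrt2_omega delta t Lam Hd ltac:(lra)) as Ea.
  assert (Ha : 0 <= sqrt 2 * omega delta t Lam)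
    by (apply Rmult_le_pos; [apply sqrt_pos | exact Hw]).
  destruct (gauss_primitive_lim _ Ha) as [G HG].
  pose proof (gauss_lim_ge _ _ Ha HG) as HGlow.
  rewrite (fresnel_approx_gauss delta t Lam G Hd ltac:(lra) HG).
  rewrite Ea in Ha, HG, HGlow.
  assert (HL0 : 0 <= ln (1 + Lam)) by (apply ln_nonneg; lra).
  set (c := lam_c delta t) in *. set (n := sqrt (c * t)) in *.
  set (L := ln (1 + Lam)) in *. set (J := JB_tilde delta sigma phi t Lam) in *.
  assert (Hn : n * n = c * t) by (apply sqrt_sqrt; lra).
  assert (Hn1 : 1 <= n) by (unfold n; rewrite <- sqrt_1; apply sqrt_le_1_alt; lra).
  pose proof (gauss_comparison sigma c t Lam n J G Hs (conj Hc Hc1) Ht HL Hn Hn1 HJ HG) as Hcmp.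
  fold L in Hcmp.
  set (Y := ((1 + Ci) * RtoC (/ n) * G)%C) in *.
  pose proof (exp_pos (-4)) as He4.
  assert (HnL : 0 <= n * L) by (apply Rmult_le_pos; lra).
  assert (HY : exp (-4) / (n * (n * L + 1)) <= Cmod Y).
  { unfold Y. rewrite !Cmod_mult, Cmod_R.
    assert (Hi : 0 < / n) by (apply Rinv_0_lt_compat; lra).
    rewrite (Rabs_pos_eq (/ n)) by lra.
    assert (HG2 : exp (-4) / (n * L + 1) <= Cmod G).
    { eapply Rle_trans; [|exact HGlow]. unfold Rdiv at 1 2. apply Rmult_le_compat_l; [lra|].
      apply Rinv_le_contravar; [lra|].
      assert (n * L / (1 + c) <= n * L).
      { unfold Rdiv. rewrite <- (Rmult_1_r (n * L)) at 2. apply Rmult_le_compat_l; [lra|].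
        rewrite <- Rinv_1. apply Rinv_le_contravar; lra. }
      lra. }
    replace (exp (-4) / (n * (n * L + 1))) with (1 * / n * (exp (-4) / (n * L + 1)))
      by (field; lra).
    pose proof Cmod_1_plus_i.
    assert (0 <= exp (-4) / (n * L + 1)) by (apply Rdiv_le_0_compat; lra).
    apply Rmult_le_compat; [lra | assumption | | exact HG2].
    apply Rmult_le_compat_r; lra. }
  assert (Hden : 0 < n * (n * L + 1)) by (apply Rmult_lt_0_compat; lra).
  assert (HYlow : 0 < exp (-4) / (n * (n * L + 1))) by (apply Rdiv_lt_0_compat; assumption).
  assert (HY0 : Y <> 0%C) by (apply Cmod_gt_0; lra).
  exists ((J - Y) / Y)%C. split; [|field; exact HY0].
  eapply Rle_trans; [apply (Cmod_div_le _ _ _ HYlow HY HY0)|].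
  assert (HK : 0 <= comparison_constant).
  { unfold comparison_constant. pose proof (exp_pos 2). pose proof (exp_pos 3). lra. }
  apply Rle_trans with
    (comparison_constant / (n * n * (n * L + 1)) / (exp (-4) / (n * (n * L + 1)))).
  - unfold Rdiv at 1. apply Rmult_le_compat_r; [left; apply Rinv_0_lt_compat, HYlow | exact Hcmp].
  - right. field. repeat split; lra.
Qed.

Lemma Rpower_neg_small (s e : R) :
  0 < s -> 0 < e -> exists T, forall t, T < t -> 0 < t /\ Rpower t (- s) < e.
Proof.
  intros Hs He. exists (exp (- ln e / s)). intros t Ht.
  pose proof (exp_pos (- ln e / s)) as Hp.
  assert (Ht0 : 0 < t) by lra. split; [exact Ht0|].
  pose proof (ln_increasing _ _ Hp Ht) as H. rewrite ln_exp in H.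
  unfold Rpower. rewrite <- (exp_ln e He) at 1. apply exp_increasing.
  apply Rmult_lt_compat_l with (r := s) in H; [|exact Hs].
  replace (s * (- ln e / s)) with (- ln e) in H by (field; lra). lra.
Qed.

(** Once t^(delta - 1) <= 1/2, [lam_c] is at most 1. It is always at least t^(delta - 1), so N = c t
    is at least t^delta and 1 / sqrt N is at most t^(- delta / 2). *)
Lemma lam_c_large_t (delta : R) :
  0 < delta < 1 ->
  exists T, forall t, T < t ->
    32 <= t /\ lam_c delta t <= 1 /\ 1 <= lam_c delta t * t
    /\ / sqrt (lam_c delta t * t) <= Rpower t (- (delta / 2)).
Proof.
  intros Hd.
  destruct (Rpower_neg_small (1 - delta) (1 / 2) ltac:(lra) ltac:(lra)) as [T HT].
  exists (Rmax T 32). intros t Ht.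
  pose proof (Rmax_l T 32). pose proof (Rmax_r T 32).
  destruct (HT t ltac:(lra)) as [_ Hq].
  replace (- (1 - delta)) with (delta - 1) in Hq by ring.
  assert (Ht32 : 32 < t) by lra.
  assert (Hq0 : 0 < Rpower t (delta - 1)) by apply exp_pos.
  assert (Hlc : Rpower t (delta - 1) <= lam_c delta t).
  { unfold lam_c. rewrite <- (Rmult_1_r (Rpower t (delta - 1))) at 1.
    apply Rmult_le_compat_l; [lra|]. rewrite <- Rinv_1 at 1.
    apply Rinv_le_contravar; lra. }
  assert (Hct : Rpower t delta <= lam_c delta t * t).
  { replace delta with (delta - 1 + 1) at 1 by ring.
    rewrite Rpower_plus, Rpower_1 by lra. apply Rmult_le_compat_r; lra. }
  assert (H1 : 1 <= Rpower t delta).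
  { pose proof (Rpower_lt t 0 delta ltac:(lra) ltac:(lra)) as P.
    rewrite Rpower_O in P by lra. lra. }
  split; [lra|]. split; [|split; [lra|]].
  - unfold lam_c. apply Rmult_le_reg_r with (1 - Rpower t (delta - 1)); [lra|].
    replace (Rpower t (delta - 1) / (1 - Rpower t (delta - 1)) * (1 - Rpower t (delta - 1)))
      with (Rpower t (delta - 1)) by (field; lra). lra.
  - rewrite Rpower_Ropp. apply Rinv_le_contravar; [apply exp_pos|].
    replace (Rpower t (delta / 2)) with (sqrt (Rpower t delta)).
    + apply sqrt_le_1_alt, Hct.
    + replace delta with (delta / 2 + delta / 2) at 1 by field. rewrite Rpower_plus.
      apply sqrt_square. left. apply exp_pos.
Qed.

Definition relative_error (delta t : R) : R :=
  comparison_constant / exp (-4) * Rpower t (- (delta / 2)).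

Lemma relative_error_0 (delta : R) : 0 < delta -> tends_to_0 (relative_error delta).
Proof.
  intros Hd e He. set (K := comparison_constant / exp (-4)).
  assert (HK : 0 < K).
  { apply Rdiv_lt_0_compat; [|apply exp_pos].
    unfold comparison_constant. pose proof (exp_pos 2). pose proof (exp_pos 3). lra. }
  destruct (Rpower_neg_small (delta / 2) (e / K) ltac:(lra)) as [T HT];
    [apply Rdiv_lt_0_compat; assumption|].
  exists T. intros t Ht. destruct (HT t Ht) as [_ H].
  pose proof (exp_pos (- (delta / 2) * ln t)) as Hp. fold (Rpower t (- (delta / 2))) in Hp.
  unfold relative_error. fold K. rewrite Rabs_pos_eq by nra.
  apply Rmult_lt_compat_l with (r := K) in H; [|exact HK].
  replace (K * (e / K)) with e in H by (field; lra). exact H.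
Qed.

Lemma JB_tilde_relative_error (delta sigma : R) :
  0 < delta < 1 -> 1 / 2 <= sigma < 1 ->
  exists T, forall t Lam phi, T < t -> 1 < t -> adm_Lam delta t Lam ->
    adm_phi (lam_c delta t * (1 + Lam)) phi ->
    exists e : C, Cmod e <= relative_error delta t /\
      JB_tilde delta sigma phi t Lam = (fresnel_approx delta t Lam * (1 + e))%C.
Proof.
  intros Hd Hs. destruct (lam_c_large_t delta Hd) as [T HT].
  exists T. intros t Lam phi Ht Ht1 HLam Hadm.
  destruct (HT t Ht) as [H1 [H2 [H3 H4]]].
  pose proof (adm_Lam_nonneg delta t Lam Hd Ht1 HLam) as HL.
  destruct (JB_tilde_asymptotic delta sigma t Lam phi Hd Hs H1 H2 H3 HL Hadm) as [e [He1 He2]].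
  exists e. split; [|exact He2].
  eapply Rle_trans; [exact He1|]. unfold relative_error. unfold Rdiv at 1.
  apply Rmult_le_compat_l; [|exact H4].
  apply Rdiv_le_0_compat; [|apply exp_pos].
  unfold comparison_constant. pose proof (exp_pos 2). pose proof (exp_pos 3). lra.
Qed.

Lemma fresnel_tail_le (w : R) : 0 <= w -> Cmod (fresnel_tail w) <= exp 1 / 2.
Proof.
  intros Hw.
  assert (Ha : 0 <= sqrt 2 * w) by (apply Rmult_le_pos; [apply sqrt_pos | exact Hw]).
  destruct (gauss_primitive_lim _ Ha) as [G HG].
  rewrite (fresnel_tail_gauss w G HG), !Cmod_mult, Cmod_Cexp_imag, Cmod_Cexp_angle, !Rmult_1_l.
  exact (gauss_lim_le _ G Ha HG).
Qed.

Lemma fresnel_tail_asymptotic (w : R) :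
  1 <= w ->
  Cmod (Cexp (- (Ci * RtoC (w * w))) * fresnel_tail w - (- 1 / (2 * Ci * RtoC w)))
  <= 32 / (w * w * w).
Proof.
  intros Hw. assert (H0 : 0 < sqrt 2) by apply Rlt_sqrt2_0.
  assert (H1 : 1 <= sqrt 2) by (rewrite <- sqrt_1 at 1; apply sqrt_le_1_alt; lra).
  assert (Ha : 0 < sqrt 2 * w) by (apply Rmult_lt_0_compat; lra).
  destruct (gauss_primitive_lim _ (Rlt_le _ _ Ha)) as [G HG].
  pose proof (gauss_lim_asymptotic _ G Ha HG) as HA.
  rewrite (fresnel_tail_gauss w G HG).
  assert (E : (Cexp (- (Ci * RtoC (w * w))) * Cexp (Ci * RtoC (w * w)))%C = RtoC 1).
  { rewrite <- Cexp_plus, <- Cexp_0. f_equal. ring. }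
  assert (N1 : RtoC w <> 0%C) by (apply RtoC_neq_0; lra).
  assert (N2 : Ci <> 0%C) by (intros X; injection X; lra).
  assert (N3 : (1 - Ci)%C <> 0%C) by (intros X; injection X; lra).
  assert (N4 : RtoC (sqrt 2) <> 0%C) by (apply RtoC_neq_0; lra).
  assert (S2 : (RtoC (sqrt 2) * RtoC (sqrt 2))%C = RtoC 2)
    by (rewrite <- RtoC_mult; f_equal; apply sqrt_sqrt; lra).
  assert (I2 : (Ci * Ci)%C = (- (1))%C) by (apply C_ext; simpl; ring).
  assert (EQ : (Cexp (0, (PI / 4)%R) * / (RtoC (sqrt 2 * w) * (1 - Ci)))%C
               = (- 1 / (2 * Ci * RtoC w))%C).
  { rewrite Cexp_PI4, RtoC_inv, RtoC_mult by lra.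
    transitivity ((1 + Ci) / (RtoC (sqrt 2) * RtoC (sqrt 2) * RtoC w * (1 - Ci)))%C;
      [field; repeat split; assumption|].
    rewrite S2.
    (* Multiplying numerator and denominator by i turns 1 + i into i - 1 = - (1 - i), which cancels
       against the denominator. *)
    transitivity ((Ci + Ci * Ci) / (2 * Ci * RtoC w * (1 - Ci)))%C;
      [field; repeat split; assumption|].
    rewrite I2. field. repeat split; assumption. }
  rewrite <- EQ.
  replace (Cexp (- (Ci * RtoC (w * w))) * (Cexp (Ci * RtoC (w * w)) * Cexp (0, (PI / 4)%R) * G)
           - Cexp (0, (PI / 4)%R) * / (RtoC (sqrt 2 * w) * (1 - Ci)))%C
    with (Cexp (0, (PI / 4)%R) * (G - / (RtoC (sqrt 2 * w) * (1 - Ci))))%C.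
  - rewrite Cmod_mult, Cmod_Cexp_angle, Rmult_1_l.
    eapply Rle_trans; [exact HA|]. unfold Rdiv. apply Rmult_le_compat_l; [lra|].
    assert (Hsw : w <= sqrt 2 * w) by nra.
    apply Rinv_le_contravar; [repeat apply Rmult_lt_0_compat; lra|].
    repeat apply Rmult_le_compat; try lra. nra.
  - set (e1 := Cexp (- (Ci * RtoC (w * w)))) in *. set (e2 := Cexp (Ci * RtoC (w * w))) in *.
    set (e3 := Cexp (0, (PI / 4)%R)). set (k := (/ (RtoC (sqrt 2 * w) * (1 - Ci)))%C).
    transitivity ((e1 * e2) * (e3 * G) - e3 * k)%C; [rewrite E|]; ring.
Qed.

Theorem theorem1p3 (delta sigma : R)
  (Hdelta : 0 < delta < 1) (Hsigma : 1/2 <= sigma < 1) :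
  (* exact identity *)
  (forall t Lam phi, 1 < t -> adm_Lam delta t Lam ->
     adm_phi (lam_c delta t * (1 + Lam)) phi ->
     let lc := lam_c delta t in
     J_B delta sigma phi t (lc * (1 + Lam)) =
       (RtoC (Rpower (lc / (1 + lc)) (1/2))
        * RtoC (Rpower (1 / (1 + lc)) (sigma - 1/2))
        * Cexp (Ci * RtoC (t * f0 Lam lc / (1 + lc)))
        * JB_tilde delta sigma phi t Lam)%C)
  /\
  (* main asymptotics, o(1) uniform in Lambda *)
  (exists eps : R -> R, tends_to_0 eps /\
   exists T, forall t Lam phi, T < t -> 1 < t -> adm_Lam delta t Lam ->
     adm_phi (lam_c delta t * (1 + Lam)) phi ->
     let lc := lam_c delta t in
     let w := omega delta t Lam in
     exists e : C, Cmod e <= eps t /\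
       JB_tilde delta sigma phi t Lam =
         (Cexp (- (Ci * RtoC (w * w))) * RtoC (sqrt (2 / (lc * t)))
          * fresnel_tail w * (1 + e))%C)
  /\
  (* omega = O(1)  ==>  Fresnel tail = O(1), constant independent of Lambda *)
  (forall B, exists C0, forall t Lam, 1 < t -> adm_Lam delta t Lam ->
     omega delta t Lam <= B -> Cmod (fresnel_tail (omega delta t Lam)) <= C0)
  /\
  (* omega -> infinity regime *)
  (exists w0 K : R, 0 < w0 /\ exists eps : R -> R, tends_to_0 eps /\
   exists T, forall t Lam phi, T < t -> 1 < t -> adm_Lam delta t Lam ->
     adm_phi (lam_c delta t * (1 + Lam)) phi ->
     let lc := lam_c delta t in
     let w := omega delta t Lam in
     w0 <= w ->
     exists e1 e2 : C, Cmod e1 <= K / (w * w * w) /\ Cmod e2 <= eps t /\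
       JB_tilde delta sigma phi t Lam =
         (RtoC (sqrt (2 / (lc * t)))
          * (- 1 / (2 * Ci * RtoC w) + e1) * (1 + e2))%C).
Proof.
  destruct (JB_tilde_relative_error delta sigma Hdelta Hsigma) as [T HT].
  pose proof (relative_error_0 delta (proj1 Hdelta)) as Heps.
  split; [|split; [|split]].
  - intros t Lam phi Ht HLam Hadm.
    exact (J_B_identity delta sigma t Lam phi Hdelta Hsigma Ht
             (adm_Lam_nonneg delta t Lam Hdelta Ht HLam) Hadm).
  - exists (relative_error delta). split; [exact Heps|].
    exists T. exact HT.
  - intros B. exists (exp 1 / 2). intros t Lam Ht HLam _.
    apply fresnel_tail_le, omega_nonneg; [exact Hdelta | exact Ht|].
    exact (adm_Lam_nonneg delta t Lam Hdelta Ht HLam).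
  - exists 1, 32. split; [lra|].
    exists (relative_error delta). split; [exact Heps|].
    exists T. intros t Lam phi HtT Ht HLam Hadm lc w Hw.
    destruct (HT t Lam phi HtT Ht HLam Hadm) as [e [He HJ]].
    exists (Cexp (- (Ci * RtoC (w * w))) * fresnel_tail w - (- 1 / (2 * Ci * RtoC w)))%C, e.
    split; [exact (fresnel_tail_asymptotic w Hw)|]. split; [exact He|].
    rewrite HJ. unfold fresnel_approx. fold w lc. ring.
Qed.
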